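(* Let $0<b<\infty$, let $q\in L^1((0,b))$ be real-valued, let $h\in\mathbb R\cup\{\infty\}$, and let $m(z)$ be the $m$-function of $-\frac{d^2}{dx^2}+q$ on $(0,b)$ with boundary condition $u'(b_-)+hu(b_-)=0$. Then there are numbers $A_n,B_n$, $n=1,2,\dots$, a function $A(\alpha)$ on $(0,\infty)$, and constants $C,K_0>0$ such that (i) $|A_n|\le C$; (ii) $|B_n|\le Cn$; (iii) $\int_0^a|A(\alpha)|\,d\alpha\le C\exp(K_0|a|)$ for all $a>0$, and such that for $\operatorname{Re}(\kappa)>\frac12K_0$, $$m(-\kappa^2)=-\kappa-\sum_{n=1}^\infty A_n\kappa e^{-2\kappa bn}-\sum_{n=1}^\infty B_ne^{-2\kappa bn}-\int_0^\infty A(\alpha)e^{-2\alpha\kappa}\,d\alpha.$$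
   Context: $h=\infty$ means the Dirichlet condition $u(b_-)=0$. For $z\in\mathbb C$, let $u(x,z)$ be a nonzero solution of $-u''+qu=zu$ on $(0,b)$ satisfying the boundary condition at $b$; then $m(z)=u'(0_+,z)/u(0_+,z)$, which is meromorphic in $\mathbb C$ with poles only on a subset of $\mathbb R$ bounded from below. *)

(* Defs.v *)
From HB Require Import structures.
From mathcomp Require Import all_boot all_order all_algebra.
From mathcomp Require Import complex.
From mathcomp Require Import all_classical all_reals all_analysis.

Set Implicit Arguments.
Unset Strict Implicit.
Unset Printing Implicit Defensive.

Import Order.TTheory GRing.Theory Num.Theory.
Import numFieldNormedType.Exports.

Local Open Scope classical_set_scope.
Local Open Scope ring_scope.
Local Open Scope complex_scope.

#[global] Arguments complex.Re {R} _.
#[global] Arguments complex.Im {R} _.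

Section complex_valued.
Context {R : realType}.
Implicit Types f : R -> R[i].

Definition cexp (z : R[i]) : R[i] :=
  (expR (complex.Re z))%:C * (cos (complex.Im z) +i* sin (complex.Im z)).

(* R[i] carries no structure of normed module over R in the library, so the
   derivative and the integral of an R[i]-valued function of a real variable
   are taken componentwise. *)
Definition cderivable f (x : R) : Prop :=
  derivable (complex.Re \o f) x 1 /\ derivable (complex.Im \o f) x 1.

Definition cderive f (x : R) : R[i] :=
  derive1 (complex.Re \o f) x +i* derive1 (complex.Im \o f) x.

Definition cintegral (D : set R) f : R[i] :=
  (\int[lebesgue_measure]_(x in D) complex.Re (f x))
  +i* (\int[lebesgue_measure]_(x in D) complex.Im (f x)).

(* The norm of R[i] takes its values in R[i]; complex.Re casts it to R. *)
Definition abs_continuous (c d : R) f : Prop :=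
  forall e : R, 0 < e -> exists2 delta : R, 0 < delta &
    forall (n : nat) (s t : 'I_n -> R),
      (forall i, c <= s i /\ s i <= t i /\ t i <= d) ->
      (forall i j, i != j -> t i <= s j \/ t j <= s i) ->
      \sum_(i < n) (t i - s i) < delta ->
      \sum_(i < n) complex.Re `|f (t i) - f (s i)| < e.

(* The library puts the topology of the norm on R[i]^o, the regular module. *)
Definition rlim f (x : R) : R[i] := lim ((f y : R[i]^o) @[y --> x^'+]).

Definition llim f (x : R) : R[i] := lim ((f y : R[i]^o) @[y --> x^'-]).

(* The sum of the u n over n >= 1. *)
Definition csum (u : nat -> R[i]) : R[i] :=
  lim ((\sum_(1 <= k < n) u k : R[i]^o) @[n --> \oo]).

End complex_valued.

Section m_function.
Context {R : realType}.
Variables (q : R -> R) (b : R).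

(* Solutions in the Caratheodory sense, which is the usual one when q is only
   integrable: u' is locally absolutely continuous on (0, b) and the equation
   holds almost everywhere. *)
Definition solution (z : R[i]) (u : R -> R[i]) : Prop :=
  [/\ forall x : R, 0 < x < b -> cderivable u x,
      forall c d : R, 0 < c -> c <= d -> d < b -> abs_continuous c d (cderive u) &
      {ae lebesgue_measure, forall x : R, 0 < x < b ->
        cderivable (cderive u) x /\
        - cderive (cderive u) x + (q x)%:C * u x = z * u x}].

(* None stands for h = oo. For integrable q the one-sided limits of u and u'
   at 0 and at b exist for every solution u. *)
Definition boundary_condition (h : option R) (u : R -> R[i]) : Prop :=
  if h is Some h0 then llim (cderive u) b + h0%:C * llim u b = 0
  else llim u b = 0.

Definition weyl_solution (h : option R) (z : R[i]) (u : R -> R[i]) : Prop :=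
  [/\ solution z u, boundary_condition h u &
      exists2 x, 0 < x < b & u x != 0].

(* Independent of the choice of u, as Weyl solutions are unique on (0, b) up to
   a nonzero factor; at a pole the value is the meaningless _ / 0. *)
Definition m_fun (h : option R) (z : R[i]) : R[i] :=
  let u := xget (fun=> 0) [set u | weyl_solution h z u] in
  rlim (cderive u) 0 / rlim u 0.

Definition m_pole (h : option R) (z : R[i]) : Prop :=
  exists2 u, weyl_solution h z u & rlim u 0 = 0.

End m_function.

(* Main.v *)
(* Write a solution of -u'' + q u = - kappa^2 u as u(x) = e^{kappa (b - x)} psi(x).
   With sigma = 1, a = 0 for the Dirichlet condition and sigma = - 1, a = 2 h
   otherwise, psi(x) = 1 - sigma e^{- 2 kappa (b - x)} + khat(x), where khat solves
   the Volterra equation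
     khat(x) = int_0^{b - x} e^{- 2 kappa g} (a + int_{x + g}^b q psi) dg.
   Taking khat(x) to be the Laplace transform of y |-> k(x, y) turns this into a
   fixed-point equation for k that no longer contains kappa and is a contraction
   for sup |k(x, y)| e^{- rate y}.  Then
     m = kappa - (2 kappa + a + int_0^b q psi) / psi(0).
   Integrating the Volterra equation by parts at x = 0 shows that
   2 kappa khat(0) is a + int_0^b q psi up to multiples of w = sigma e^{- 2 kappa b}
   and Laplace transforms of functions.  Laplace transforms of exponentially
   bounded densities are closed under sums, products, delays and geometric
   series, so for Re kappa large the quotient is - kappa - 2 kappa w / (1 - w)
   minus a multiple of e^{- 2 kappa b} / (1 - w)^2 minus one Laplace transform;
   the first two fractions are the A_n and the B_n series.  Constancy of
   Wronskians, hence the fact that an absolutely continuous function with zero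
   derivative almost everywhere is constant, shows that every Weyl solution is a
   multiple of this u. *)

(* The obstacle is the factor kappa in the numerator: kappa times a Laplace transform is in general
   no longer the transform of a function. So kappa is only ever absorbed in the one product 2 kappa
   khat(0), whose point masses are known. Let l = e^{- 2 kappa b}, w = sigma l and P = khat(0). The
   numerator is 2 kappa (1 - w + P) + 2 kappa w plus a constant multiple of l plus a transform.
   Writing 2 kappa w / (1 - w + P) as 2 kappa w / (1 - w) minus 2 kappa P w / ((1 - w) (1 - w + P))
   and inserting 2 kappa P once more leaves, up to transforms, c l / (1 - w)^2 with c = a (1 -
   sigma) - 2 sigma int_0^b q. Hence A_n = 2 sigma^n and B_n = c n sigma^{n - 1}. Norms are tracked
   explicitly because the divisions by 1 - w and by 1 + P / (1 - w) are geometric series, whose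
   ratios become small only when Re kappa is raised. A second solution, with parameters - sigma and
   0, completes a fundamental system; writing an arbitrary solution in it yields the existence of
   its one-sided limits as well as uniqueness. *)
Require Import Defs.
From HB Require Import structures.
From mathcomp Require Import all_boot all_order all_algebra.
From mathcomp Require Import complex.
From mathcomp Require Import all_classical all_reals all_analysis.
From mathcomp Require Import measurable_realfun ring lra.

Set Implicit Arguments.
Unset Strict Implicit.
Unset Printing Implicit Defensive.

Import Order.TTheory GRing.Theory Num.Theory.
Import numFieldNormedType.Exports.

Local Open Scope classical_set_scope.
Local Open Scope ring_scope.
Local Open Scope complex_scope.

(** * Real integrals *)

Section RealIntegral.
Context d {T : measurableType d} {R : realType}.
Variable m : {measure set T -> \bar R}.

(** The integral of |f| is infinite, so one of the two parts of f has infinite integral. The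
    difference is then infinite as well, with the convention oo - oo = - oo, and [fine] sends it to
    0. *)
Lemma Rintegral_nonintegrable (f : T -> R) : measurable_fun setT f ->
  ~ m.-integrable setT (EFin \o f) -> \int[m]_x f x = 0.
Proof.
move=> mf nf; rewrite /Rintegral integralE.
have mE : measurable_fun setT (EFin \o f) by exact/measurable_EFinP.
have mp := measurable_funepos mE; have mn := measurable_funeneg mE.
have : (\int[m]_x (EFin \o f)^\+ x + \int[m]_x (EFin \o f)^\- x = +oo)%E.
  rewrite -ge0_integralD//.
  apply/eqP; rewrite -leye_eq; apply: contra_notT nf; rewrite -ltNge => h.
  apply/integrableP; split => //; apply: le_lt_trans h.
  by under eq_integral do rewrite -/((abse \o (EFin \o f)) _) fune_abse.
have p0 : (0 <= \int[m]_x (EFin \o f)^\+ x)%E by exact: integral_ge0.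
have n0 : (0 <= \int[m]_x (EFin \o f)^\- x)%E by exact: integral_ge0.
move: p0 n0.
by case: (\int[m]_x _)%E => [r| |] //; case: (\int[m]_x _)%E => [s| |].
Qed.

(* No integrability is required: the integral of a non-integrable function is 0. *)
Lemma RintegralZl_measurable (f : T -> R) (c : R) : measurable_fun setT f ->
  \int[m]_x (c * f x) = c * \int[m]_x f x.
Proof.
move=> mf; have [intf|intf] := pselect (m.-integrable setT (EFin \o f)).
  by rewrite RintegralZl.
rewrite [in RHS]Rintegral_nonintegrable// mulr0.
have [->|c0] := eqVneq c 0.
  by under eq_Rintegral do rewrite mul0r; rewrite Rintegral_cst// mul0r.
rewrite Rintegral_nonintegrable//; first exact: measurable_funM.
apply: contra_not intf => /(integrableZl measurableT c^-1).
by apply: eq_integrable => // x _; rewrite /= -EFinM mulrA mulVf// mul1r.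
Qed.

Lemma integrable_dominated (f g : T -> R) : measurable_fun setT f ->
  m.-integrable setT (EFin \o g) -> (forall x, `|f x| <= g x) ->
  m.-integrable setT (EFin \o f).
Proof.
move=> mf ig fg; apply: le_integrable ig => //; first exact/measurable_EFinP.
by move=> x _; rewrite /= lee_fin (le_trans (fg x))// ler_norm.
Qed.

Lemma le_normr_Rintegral_dominated (f g : T -> R) : measurable_fun setT f ->
  m.-integrable setT (EFin \o g) -> (forall x, `|f x| <= g x) ->
  `|\int[m]_x f x| <= \int[m]_x g x.
Proof.
move=> mf ig fg; have intf := integrable_dominated mf ig fg.
apply: (le_trans (le_normr_Rintegral _ intf)) => //.
apply: le_Rintegral => //.
by have /integrable_norm := intf.
Qed.

(* The hypothesis bounds the integral in the extended reals, hence covers the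
   case where the function is not integrable. *)
Lemma le_normr_Rintegral_ereal (f : T -> R) (c : R) : measurable_fun setT f ->
  (\int[m]_x `|f x|%:E <= c%:E)%E -> `|\int[m]_x f x| <= c.
Proof.
move=> mf fc.
have intf : m.-integrable setT (EFin \o f).
  apply/integrableP; split; first exact/measurable_EFinP.
  exact: le_lt_trans fc (ltry _).
apply: (le_trans (le_normr_Rintegral measurableT intf)).
rewrite /Rintegral -lee_fin fineK//.
apply: integrable_fin_num => //.
by have /integrable_norm := intf.
Qed.
End RealIntegral.

Section ProductIntegral.
Context d1 d2 {T1 : measurableType d1} {T2 : measurableType d2} {R : realType}.
Variables (m1 : {sigma_finite_measure set T1 -> \bar R}).
Variables (m2 : {sigma_finite_measure set T2 -> \bar R}).

(** No integrability is required: Tonelli gives measurability for the positive and the negative part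
    separately, and [fine] is measurable. *)
Lemma measurable_Rintegral_param (f : T1 * T2 -> R) : measurable_fun setT f ->
  measurable_fun setT (fun x => \int[m2]_y f (x, y)).
Proof.
move=> mf; apply: (measurableT_comp (fine_measurable measurableT)).
have mE : measurable_fun setT (EFin \o f) by exact/measurable_EFinP.
rewrite (_ : (fun x => _) = (fun x =>
   \int[m2]_y (EFin \o f)^\+ (x, y) - \int[m2]_y (EFin \o f)^\- (x, y))%E);
  last first.
  apply/funext => x; rewrite integralE.
  by congr (_ - _)%E; apply: eq_integral => y _; rewrite ?funeposE ?funenegE.
apply: emeasurable_funB.
  have := @measurable_fun_fubini_tonelli_F _ _ _ _ _ m2 _ (measurable_funepos mE).
  by apply => z; exact: funepos_ge0.
have := @measurable_fun_fubini_tonelli_F _ _ _ _ _ m2 _ (measurable_funeneg mE).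
by apply => z; exact: funeneg_ge0.
Qed.

(** An integrable function is finite almost everywhere, so [fine] changes it on a null set only. *)
Lemma Rintegral_fin_ae d {T : measurableType d} (m : {measure set T -> \bar R})
    (F : T -> \bar R) : m.-integrable setT F ->
  \int[m]_x fine (F x) = fine (\int[m]_x F x)%E.
Proof.
move=> iF; rewrite /Rintegral; congr fine.
have mF := measurable_int _ iF.
apply: ae_eq_integral => //.
  apply/measurable_EFinP.
  exact: (measurableT_comp (fine_measurable measurableT)).
have := integrable_ae measurableT iF.
by apply: filterS => x /= /(_ I) Fx _; rewrite fineK.
Qed.

Lemma integrable_fine_fubini_F (f : T1 * T2 -> R) :
  (m1 \x m2)%E.-integrable setT (EFin \o f) ->
  m1.-integrable setT (EFin \o (fun x => \int[m2]_y f (x, y))).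
Proof.
move=> intf; have iF := integrable_fubini_F intf.
have mF := measurable_int _ iF.
apply: (le_integrable measurableT _ _ iF).
  apply/measurable_EFinP.
  exact: (measurableT_comp (fine_measurable measurableT)).
move=> x _; rewrite /= /Rintegral /fubini_F/=.
by case: (integral m2 setT _) => [r| |] //=; rewrite normr0 leey.
Qed.

Lemma Rintegral12 (f : T1 * T2 -> R) :
  (m1 \x m2)%E.-integrable setT (EFin \o f) ->
  \int[m1]_x \int[m2]_y f (x, y) = \int[(m1 \x m2)%E]_z f z.
Proof.
move=> intf; rewrite [RHS]/Rintegral -(integral12_prod_meas1 intf).
by rewrite -Rintegral_fin_ae//; exact: integrable_fubini_F.
Qed.

Lemma integrable_fubini_Gl (f : T1 * T2 -> R) :
  (m1 \x m2)%E.-integrable setT (EFin \o f) ->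
  m2.-integrable setT (fun y => \int[m1]_x (f (x, y))%:E)%E.
Proof.
move=> intf; have mf := measurable_int _ intf.
have mG := measurable_fubini_G intf.
apply/integrableP; split => //.
move/integrableP : (intf) => [_].
rewrite (fubini_tonelli2 (abse \o (EFin \o f)))//=; last exact: measurableT_comp.
apply: le_lt_trans; apply: ge0_le_integral => //.
- exact: measurableT_comp.
- apply: (measurable_fun_fubini_tonelli_G (abse \o (EFin \o f))) => //=.
  exact: measurableT_comp.
- move=> y _; apply: le_abse_integral => //.
  exact: (measurableT_comp mf (pair2_measurable y)).
Qed.

Lemma Rintegral21 (f : T1 * T2 -> R) :
  (m1 \x m2)%E.-integrable setT (EFin \o f) ->
  \int[m2]_y \int[m1]_x f (x, y) = \int[(m1 \x m2)%E]_z f z.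
Proof.
move=> intf; rewrite [RHS]/Rintegral -(integral21_prod_meas1 intf).
by rewrite -Rintegral_fin_ae//; exact: integrable_fubini_Gl.
Qed.

Lemma integrable_prod (f : T1 -> R) (g : T2 -> R) :
  m1.-integrable setT (EFin \o f) -> m2.-integrable setT (EFin \o g) ->
  (m1 \x m2)%E.-integrable setT (EFin \o (fun z => f z.1 * g z.2)).
Proof.
move=> intf intg.
have /measurable_EFinP mf := measurable_int _ intf.
have /measurable_EFinP mg := measurable_int _ intg.
apply/integrable12ltyP.
  apply/measurable_EFinP.
  apply: measurable_funM; exact: measurableT_comp.
rewrite /=; under eq_integral => x _.
  under eq_integral => y _ do rewrite normrM EFinM.
  rewrite ge0_integralZl//; last first.
    by apply/measurable_EFinP; exact: measurableT_comp.
  over.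
have /integrableP[_ fi] := intf; have /integrableP[_ gi] := intg.
rewrite ge0_integralZr//.
- by apply: lte_mul_pinfty => //; [exact: integral_ge0|rewrite ge0_fin_numE//; exact: integral_ge0].
- by apply/measurable_EFinP; exact: measurableT_comp.
- exact: integral_ge0.
Qed.

End ProductIntegral.

Section Reflection.
Context {R : realType}.
Local Notation mu := (@lebesgue_measure R).
Local Notation TR := (measurableTypeR R).

Lemma measurable_reflect (c : R) : measurable_fun setT (fun x : TR => c - x : TR).
Proof. by apply: measurable_funB. Qed.

(** Lebesgue measure is determined by its values on half-open intervals. Reflection moves the closed
    end to the other side and preserves the length. *)
Lemma lebesgue_measure_reflect (c : R) (A : set TR) : measurable A ->
  mu [set x | A (c - x)] = mu A.
Proof.
move=> mA; apply/esym.
have mr := measurable_reflect c.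
pose nu : {measure set TR -> \bar R} := [the measure _ _ of pushforward mu (fun x : TR => c - x : TR)].
apply: (@lebesgue_measure_unique R (nu mr)) => // _ [[a b]] _ <-.
rewrite /nu /= /pushforward.
rewrite (_ : _ @^-1` _ = `[c - b, c - a[%classic).
  rewrite !lebesgue_measure_itv/= !lte_fin ltrD2l ltrN2.
  by case: ifP => // _; rewrite -!EFinB; congr EFin; ring.
apply/seteqP; split => x /=; rewrite !in_itv/= => /andP[h1 h2]; apply/andP; lra.
Qed.

Lemma ge0_integral_reflect (c : R) (f : TR -> \bar R) : measurable_fun setT f ->
  (forall x, (0 <= f x)%E) -> (\int[mu]_x f (c - x)%R = \int[mu]_x f x)%E.
Proof.
move=> mf f0; have mr := measurable_reflect c.
rewrite -[LHS](ge0_integral_pushforward mr mu measurableT)//.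
apply: eq_measure_integral => A mA _.
exact: lebesgue_measure_reflect.
Qed.

Lemma integral_reflect (c : R) (f : TR -> \bar R) : measurable_fun setT f ->
  (\int[mu]_x f (c - x)%R = \int[mu]_x f x)%E.
Proof.
move=> mf; rewrite integralE [in RHS]integralE; congr (_ - _)%E.
  rewrite -(ge0_integral_reflect c (measurable_funepos mf)); last by move=> x; exact: funepos_ge0.
  by apply: eq_integral => x _; rewrite ?funeposE ?funenegE.
rewrite -(ge0_integral_reflect c (measurable_funeneg mf)); last by move=> x; exact: funeneg_ge0.
  by apply: eq_integral => x _; rewrite ?funeposE ?funenegE.
Qed.

(** A translation is the composite of two reflections. *)
Lemma integral_translate (c : R) (f : TR -> \bar R) : measurable_fun setT f ->
  (\int[mu]_x f (x - c)%R = \int[mu]_x f x)%E.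
Proof.
move=> mf; rewrite -(integral_reflect (- c) mf).
have mg : measurable_fun setT (fun x : TR => f (- c - x)%R).
  exact: (measurableT_comp mf (measurable_reflect _)).
rewrite -(integral_reflect 0 mg).
by apply: eq_integral => x _; congr f; ring.
Qed.

Lemma Rintegral_reflect (c : R) (f : TR -> R) : measurable_fun setT f ->
  \int[mu]_x f (c - x) = \int[mu]_x f x.
Proof.
move=> mf; rewrite /Rintegral; congr fine.
exact/(integral_reflect c (f := EFin \o f))/measurable_EFinP.
Qed.

Lemma Rintegral_translate (c : R) (f : TR -> R) : measurable_fun setT f ->
  \int[mu]_x f (x - c) = \int[mu]_x f x.
Proof.
move=> mf; rewrite /Rintegral; congr fine.
exact/(integral_translate c (f := EFin \o f))/measurable_EFinP.
Qed.

Lemma integrable_reflect (c : R) (f : TR -> R) :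
  mu.-integrable setT (EFin \o f) ->
  mu.-integrable setT (EFin \o (fun x => f (c - x))).
Proof.
move=> /integrableP[/measurable_EFinP mf fi]; apply/integrableP; split.
  by apply/measurable_EFinP; exact: (measurableT_comp mf (measurable_reflect _)).
have mnf : measurable_fun setT (fun x : TR => `|f x|%:E).
  by apply/measurable_EFinP; exact: measurableT_comp.
by rewrite /= (integral_reflect c mnf).
Qed.

End Reflection.

(** * Complex-valued functions and integrals *)

Section ComplexNorm.
Context {R : realType}.
Implicit Types z w : R[i].

(** The l1 norm of the plane serves for all estimates: it is real-valued, submultiplicative and
    visibly measurable, and it dominates the modulus. It costs the factor 2 that appears in the
    bounds on exponentials. *)
Definition nrm1 z : R := `|complex.Re z| + `|complex.Im z|.

Lemma nrm1_ge0 z : 0 <= nrm1 z. Proof. exact: addr_ge0. Qed.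

Lemma ReD z w : complex.Re (z + w) = complex.Re z + complex.Re w.
Proof. by case: z; case: w. Qed.

Lemma ImD z w : complex.Im (z + w) = complex.Im z + complex.Im w.
Proof. by case: z; case: w. Qed.

Lemma ReN z : complex.Re (- z) = - complex.Re z. Proof. by case: z. Qed.

Lemma ImN z : complex.Im (- z) = - complex.Im z. Proof. by case: z. Qed.

Lemma ReM z w : complex.Re (z * w) =
  complex.Re z * complex.Re w - complex.Im z * complex.Im w.
Proof. by case: z; case: w. Qed.

Lemma ImM z w : complex.Im (z * w) =
  complex.Re z * complex.Im w + complex.Im z * complex.Re w.
Proof. by case: z => a b; case: w => c e /=; rewrite (mulrC b). Qed.

Lemma complex_eqP z w :
  complex.Re z = complex.Re w -> complex.Im z = complex.Im w -> z = w.
Proof. by case: z; case: w => a b c e /= -> ->. Qed.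

Lemma nrm1D z w : nrm1 (z + w) <= nrm1 z + nrm1 w.
Proof.
rewrite /nrm1 ReD ImD addrACA.
by apply: lerD; exact: ler_normD.
Qed.

Lemma nrm1N z : nrm1 (- z) = nrm1 z.
Proof. by rewrite /nrm1 ReN ImN !normrN. Qed.

Lemma nrm1M z w : nrm1 (z * w) <= nrm1 z * nrm1 w.
Proof.
rewrite /nrm1 ReM ImM.
apply: (@le_trans _ _ ((`|complex.Re z| * `|complex.Re w| +
    `|complex.Im z| * `|complex.Im w|) + (`|complex.Re z| * `|complex.Im w| +
    `|complex.Im z| * `|complex.Re w|))).
  by rewrite -!normrM; apply: lerD; [exact: ler_normB|exact: ler_normD].
by rewrite le_eqVlt; apply/orP; left; apply/eqP; ring.
Qed.

Lemma nrm1_real (x : R) : nrm1 x%:C = `|x|.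
Proof. by rewrite /nrm1 /= normr0 addr0. Qed.

Lemma nrm1_0 : nrm1 0 = 0. Proof. by rewrite nrm1_real normr0. Qed.

Lemma nrm1Mr (x : R) z : nrm1 (x%:C * z) = `|x| * nrm1 z.
Proof. by rewrite /nrm1 ReM ImM /= !mul0r subr0 addr0 !normrM mulrDr. Qed.

Lemma norm_nrm1 z : complex.Re `|z| <= nrm1 z.
Proof.
rewrite normc_def /= /nrm1 -[leRHS]ger0_norm ?addr_ge0// -sqrtr_sqr ler_wsqrtr//.
rewrite sqrrD !real_normK ?num_real// lerD2r lerDl mulrn_wge0//.
Qed.

End ComplexNorm.

Section ComplexExponential.
Context {R : realType}.
Implicit Types z w k : R[i].

Lemma cexpD z w : cexp (z + w) = cexp z * cexp w.
Proof.
rewrite /cexp ReD ImD expRD cosD sinD.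
by apply: complex_eqP; rewrite !(ReM, ImM) /= ?(ReM, ImM) /=; ring.
Qed.

Lemma cexp0 : cexp (0 : R[i]) = 1.
Proof. by rewrite /cexp /= expR0 cos0 sin0 mul1r. Qed.

(** The Laplace kernel e^{- 2 k x}; the factor 2 is that of the representation to be proved. *)
Definition lexp k (x : R) : R[i] := cexp (- (2 * x%:C * k)).

Lemma lexpE k x : lexp k x =
  (expR (- (2 * complex.Re k * x)))%:C *
  (cos (2 * complex.Im k * x) -i* sin (2 * complex.Im k * x)).
Proof.
rewrite /lexp /cexp.
have -> : complex.Re (- (2 * x%:C * k)) = - (2 * complex.Re k * x).
  by case: k => a b /=; ring.
have -> : complex.Im (- (2 * x%:C * k)) = - (2 * complex.Im k * x).
  by case: k => a b /=; ring.
by rewrite cosN sinN.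
Qed.

Lemma lexpD k x y : lexp k (x + y) = lexp k x * lexp k y.
Proof. by rewrite /lexp -cexpD rmorphD/=; congr cexp; ring. Qed.

Lemma lexp0 k : lexp k 0 = 1.
Proof. by rewrite /lexp mulr0 mul0r oppr0 cexp0. Qed.

Lemma lexpM k x n : lexp k (x * n%:R) = lexp k x ^+ n.
Proof.
elim: n => [|n IH]; first by rewrite mulr0 lexp0.
by rewrite exprS -IH -lexpD; congr lexp; rewrite -natr1; ring.
Qed.

Lemma lexpB k x y : lexp k x = lexp k (x - y) * lexp k y.
Proof. by rewrite -lexpD subrK. Qed.

Lemma lexpN k x : lexp k (- x) * lexp k x = 1.
Proof. by rewrite -lexpD addNr lexp0. Qed.

Lemma lexp_neq0 k x : lexp k x != 0.
Proof.
apply/negP => /eqP h; have := lexpN k x; rewrite h mulr0 => /esym/eqP.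
by rewrite oner_eq0.
Qed.

Lemma Re_lexp_le k x : `|complex.Re (lexp k x)| <= expR (- (2 * complex.Re k * x)).
Proof.
rewrite lexpE ReM /= mul0r subr0 normrM gtr0_norm ?expR_gt0//.
by rewrite ler_piMr ?expR_ge0// ler_norml cos_geN1 cos_le1.
Qed.

Lemma Im_lexp_le k x : `|complex.Im (lexp k x)| <= expR (- (2 * complex.Re k * x)).
Proof.
rewrite lexpE ImM /= mul0r addr0 normrM gtr0_norm ?expR_gt0//.
by rewrite normrN ler_piMr ?expR_ge0// ler_norml sin_geN1 sin_le1.
Qed.

Lemma nrm1_lexp k x : nrm1 (lexp k x) <= 2 * expR (- (2 * complex.Re k * x)).
Proof.
by rewrite mulr_natl mulr2n lerD ?Re_lexp_le ?Im_lexp_le.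
Qed.

End ComplexExponential.

Section ComplexMeasurable.
Context d {T : measurableType d} {R : realType}.
Implicit Types f g : T -> R[i].

Definition cmeasurable f := measurable_fun setT (fun x => complex.Re (f x)) /\
  measurable_fun setT (fun x => complex.Im (f x)).

Lemma cmeasurableD f g : cmeasurable f -> cmeasurable g ->
  cmeasurable (fun x => f x + g x).
Proof.
move=> [f1 f2] [g1 g2]; split.
  by under eq_fun do rewrite ReD; exact: measurable_funD.
by under eq_fun do rewrite ImD; exact: measurable_funD.
Qed.

Lemma cmeasurableN f : cmeasurable f -> cmeasurable (fun x => - f x).
Proof.
move=> [f1 f2]; split.
  by under eq_fun do rewrite ReN; exact: measurableT_comp.
by under eq_fun do rewrite ImN; exact: measurableT_comp.
Qed.

Lemma cmeasurableM f g : cmeasurable f -> cmeasurable g ->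
  cmeasurable (fun x => f x * g x).
Proof.
move=> [f1 f2] [g1 g2]; split.
  by under eq_fun do rewrite ReM; apply: measurable_funB; exact: measurable_funM.
by under eq_fun do rewrite ImM; apply: measurable_funD; exact: measurable_funM.
Qed.

Lemma cmeasurable_real (f : T -> R) : measurable_fun setT f ->
  cmeasurable (fun x => (f x)%:C).
Proof. by move=> mf; split => //=; exact: measurable_cst. Qed.

Lemma cmeasurable_cst (z : R[i]) : cmeasurable (fun=> z).
Proof. by split; exact: measurable_cst. Qed.

Lemma cmeasurable_lexp (k : R[i]) (f : T -> R) : measurable_fun setT f ->
  cmeasurable (fun x => lexp k (f x)).
Proof.
move=> mf; under eq_fun do rewrite lexpE; apply: cmeasurableM.
  apply: cmeasurable_real; apply: measurableT_comp => //.
  by apply: measurableT_comp => //; exact: measurable_funM.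
split => /=.
  apply: (measurableT_comp (continuous_measurable_fun (@continuous_cos R))).
  exact: measurable_funM.
apply: measurableT_comp => //.
apply: (measurableT_comp (continuous_measurable_fun (@continuous_sin R))).
exact: measurable_funM.
Qed.

Lemma measurable_nrm1 f : cmeasurable f ->
  measurable_fun setT (fun x => nrm1 (f x)).
Proof.
by move=> [f1 f2]; apply: measurable_funD; exact: measurableT_comp.
Qed.

End ComplexMeasurable.

Lemma cmeasurable_comp d1 d2 (T1 : measurableType d1) (T2 : measurableType d2)
    (R : realType) (f : T2 -> R[i]) (h : T1 -> T2) :
  cmeasurable f -> measurable_fun setT h -> cmeasurable (fun x => f (h x)).
Proof.
by move=> [f1 f2] mh; split; [exact: (measurableT_comp f1 mh)|exact: (measurableT_comp f2 mh)].
Qed.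

Section ComplexIntegral.
Context d {T : measurableType d} {R : realType}.
Variable m : {measure set T -> \bar R}.
Implicit Types f g : T -> R[i].

Definition cint f : R[i] :=
  (\int[m]_x complex.Re (f x)) +i* (\int[m]_x complex.Im (f x)).

Definition cintegrable f := cmeasurable f /\
  m.-integrable setT (EFin \o (fun x => nrm1 (f x))).

Lemma cintegrable_dominated f (g : T -> R) : cmeasurable f ->
  m.-integrable setT (EFin \o g) -> (forall x, nrm1 (f x) <= g x) ->
  cintegrable f.
Proof.
move=> mf ig fg; split => //; apply: integrable_dominated ig _.
  exact: measurable_nrm1.
by move=> x; rewrite ger0_norm ?nrm1_ge0.
Qed.

Lemma cintegrable_Re f : cintegrable f ->
  m.-integrable setT (EFin \o (fun x => complex.Re (f x))).
Proof.
move=> [[f1 f2] fi]; apply: integrable_dominated fi _ => // x.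
by rewrite /nrm1 lerDl.
Qed.

Lemma cintegrable_Im f : cintegrable f ->
  m.-integrable setT (EFin \o (fun x => complex.Im (f x))).
Proof.
move=> [[f1 f2] fi]; apply: integrable_dominated fi _ => // x.
by rewrite /nrm1 lerDr.
Qed.

Lemma cintegrableD f g : cintegrable f -> cintegrable g ->
  cintegrable (fun x => f x + g x).
Proof.
move=> [mf fi] [mg gi].
apply: (cintegrable_dominated (g := fun x => nrm1 (f x) + nrm1 (g x))).
- exact: cmeasurableD.
- exact: (integrableD _ fi gi).
- by move=> x; exact: nrm1D.
Qed.

Lemma cintegrableZ (z : R[i]) f : cintegrable f ->
  cintegrable (fun x => z * f x).
Proof.
move=> [mf fi].
apply: (cintegrable_dominated (g := fun x => nrm1 z * nrm1 (f x))).
- by apply: cmeasurableM => //; exact: cmeasurable_cst.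
- exact: (integrableZl _ _ fi).
- by move=> x; exact: nrm1M.
Qed.

Lemma eq_cint f g : f =1 g -> cint f = cint g.
Proof. by move=> fg; congr cint; apply/funext. Qed.

Lemma cint_eq0 f : (forall x, f x = 0) -> cint f = 0.
Proof.
move=> f0; apply: complex_eqP => /=; under eq_Rintegral do rewrite f0;
  by rewrite Rintegral_cst// mul0r.
Qed.

Lemma cintD f g : cintegrable f -> cintegrable g ->
  cint (fun x => f x + g x) = cint f + cint g.
Proof.
move=> fi gi; apply: complex_eqP => /=.
  under eq_Rintegral do rewrite ReD.
  by rewrite RintegralD//; exact: cintegrable_Re.
under eq_Rintegral do rewrite ImD.
by rewrite RintegralD//; exact: cintegrable_Im.
Qed.

Lemma cintZ (z : R[i]) f : cintegrable f -> cint (fun x => z * f x) = z * cint f.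
Proof.
move=> fi; have r := cintegrable_Re fi; have i := cintegrable_Im fi.
apply: complex_eqP; rewrite ?ReM ?ImM /=.
  under eq_Rintegral do rewrite ReM.
  rewrite RintegralB; [|done|exact: (integrableZl _ _ r)|exact: (integrableZl _ _ i)].
  by rewrite !RintegralZl.
under eq_Rintegral do rewrite ImM.
rewrite RintegralD; [|done|exact: (integrableZl _ _ i)|exact: (integrableZl _ _ r)].
by rewrite !RintegralZl.
Qed.

(* Holds without integrability, the integral of a non-integrable function being 0. *)
Lemma cint_real_scale (f : T -> R) (z : R[i]) : measurable_fun setT f ->
  cint (fun x => (f x)%:C * z) = (\int[m]_x f x)%:C * z.
Proof.
move=> mf; apply: complex_eqP; rewrite ?ReM ?ImM /= mul0r ?subr0 ?addr0.
  under eq_Rintegral do rewrite ReM /= mul0r subr0 mulrC.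
  by rewrite RintegralZl_measurable// mulrC.
under eq_Rintegral do rewrite ImM /= mul0r addr0 mulrC.
by rewrite RintegralZl_measurable// mulrC.
Qed.

Lemma nrm1_cint f : cintegrable f -> nrm1 (cint f) <= \int[m]_x nrm1 (f x).
Proof.
move=> fi; have r := cintegrable_Re fi; have i := cintegrable_Im fi.
have nr : m.-integrable setT (EFin \o (fun x => `|complex.Re (f x)|)).
  by have /integrable_norm := r.
have ni : m.-integrable setT (EFin \o (fun x => `|complex.Im (f x)|)).
  by have /integrable_norm := i.
by rewrite /nrm1 RintegralD// lerD//= le_normr_Rintegral.
Qed.

Lemma nrm1_cint_dominated f (g : T -> R) : cmeasurable f ->
  m.-integrable setT (EFin \o g) -> (forall x, nrm1 (f x) <= g x) ->
  nrm1 (cint f) <= \int[m]_x g x.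
Proof.
move=> mf ig fg; have fi := cintegrable_dominated mf ig fg.
apply: (le_trans (nrm1_cint fi)); apply: le_Rintegral => //; exact: fi.2.
Qed.

Lemma nrm1_cint_ereal f (c : R) : cmeasurable f ->
  (\int[m]_x (nrm1 (f x))%:E <= c%:E)%E -> nrm1 (cint f) <= c.
Proof.
move=> mf fc; have mn := measurable_nrm1 mf.
have fi : m.-integrable setT (EFin \o (fun x => nrm1 (f x))).
  apply/integrableP; split; first exact/measurable_EFinP.
  apply: le_lt_trans (ltry c); apply: le_trans fc.
  by under eq_integral do rewrite /= ger0_norm ?nrm1_ge0//.
apply: (le_trans (nrm1_cint (conj mf fi))).
by rewrite /Rintegral -lee_fin fineK//; exact: integrable_fin_num.
Qed.

End ComplexIntegral.

Section ComplexFubini.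
Context d1 d2 {T1 : measurableType d1} {T2 : measurableType d2} {R : realType}.
Variables (m1 : {sigma_finite_measure set T1 -> \bar R}).
Variables (m2 : {sigma_finite_measure set T2 -> \bar R}).
Implicit Types f : T1 * T2 -> R[i].

Lemma cint12 f : cintegrable (m1 \x m2)%E f ->
  cint m1 (fun x => cint m2 (fun y => f (x, y))) = cint (m1 \x m2)%E f.
Proof.
move=> fi; rewrite /cint /=; congr (_ +i* _).
  by rewrite (Rintegral12 (cintegrable_Re fi)).
by rewrite (Rintegral12 (cintegrable_Im fi)).
Qed.

Lemma cint21 f : cintegrable (m1 \x m2)%E f ->
  cint m2 (fun y => cint m1 (fun x => f (x, y))) = cint (m1 \x m2)%E f.
Proof.
move=> fi; rewrite /cint /=; congr (_ +i* _).
  by rewrite (Rintegral21 (cintegrable_Re fi)).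
by rewrite (Rintegral21 (cintegrable_Im fi)).
Qed.

Lemma cint_fubini f : cintegrable (m1 \x m2)%E f ->
  cint m1 (fun x => cint m2 (fun y => f (x, y))) =
  cint m2 (fun y => cint m1 (fun x => f (x, y))).
Proof. by move=> fi; rewrite cint12// cint21. Qed.

Lemma cmeasurable_cint f : cmeasurable f ->
  cmeasurable (fun x => cint m2 (fun y => f (x, y))).
Proof.
by move=> [f1 f2]; split => /=; [exact: (measurable_Rintegral_param m2 f1)|exact: (measurable_Rintegral_param m2 f2)].
Qed.

Lemma cintegrable_cint f : cintegrable (m1 \x m2)%E f ->
  cintegrable m1 (fun x => cint m2 (fun y => f (x, y))).
Proof.
move=> fi; split; first exact: cmeasurable_cint fi.1.
have h1 := integrable_fine_fubini_F (cintegrable_Re fi).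
have h2 := integrable_fine_fubini_F (cintegrable_Im fi).
have := integrableD measurableT (integrable_norm h1) (integrable_norm h2).
by apply: eq_integrable => // x _.
Qed.

End ComplexFubini.

Section ComplexTranslate.
Context {R : realType}.
Local Notation mu := (@lebesgue_measure R).
Local Notation TR := (measurableTypeR R).

Lemma cint_translate (c : R) (f : TR -> R[i]) : cmeasurable f ->
  cint mu (fun x => f (x - c)) = cint mu f.
Proof.
move=> [f1 f2]; rewrite /cint.
by rewrite (Rintegral_translate c f1) (Rintegral_translate c f2).
Qed.

Lemma cint_reflect (c : R) (f : TR -> R[i]) : cmeasurable f ->
  cint mu (fun x => f (c - x)) = cint mu f.
Proof.
move=> [f1 f2]; rewrite /cint.
by rewrite (Rintegral_reflect c f1) (Rintegral_reflect c f2).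
Qed.

End ComplexTranslate.

Lemma EFin_normr_Rintegral_le d (T : measurableType d) (R : realType)
    (m : {measure set T -> \bar R}) (f : T -> R) : measurable_fun setT f ->
  (`|\int[m]_x f x|%:E <= \int[m]_x `|f x|%:E)%E.
Proof.
move=> mf; have mE : measurable_fun setT (EFin \o f) by exact/measurable_EFinP.
apply: le_trans (le_abse_integral m measurableT mE).
rewrite /Rintegral /=.
by case: (integral m setT _) => [r| |] //=; rewrite normr0 leey.
Qed.

(** * Laplace transforms *)

Section Laplace.
Context {R : realType}.
Local Notation mu := (@lebesgue_measure R).
Local Notation TR := (measurableTypeR R).
Implicit Types (K c : R) (F G : R[i] -> R[i]) (k : R[i]).

Definition laplace (f : TR -> R) k : R[i] :=
  cint mu (fun x => (f x)%:C * lexp k x).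

Definition weight K (x : R) : R := expR (- (2 * K * x)).

Lemma measurable_weight K : measurable_fun setT (weight K : TR -> R).
Proof.
by apply: measurableT_comp => //; exact: measurableT_comp.
Qed.

Lemma weight_ge0 K x : 0 <= weight K x. Proof. exact: expR_ge0. Qed.

Lemma weightD K x y : weight K (x + y) = weight K x * weight K y.
Proof. by rewrite /weight mulrDr opprD expRD. Qed.

(** One real density serves all k at once, and c bounds its norm in the L1 space with weight e^{- 2
    K x}, a convolution algebra. Vanishing for x <= 0 makes this norm decrease in K, so that K can
    be raised later. Stating the bound in the extended reals includes integrability. *)
Definition is_laplace K F c := exists f : TR -> R,
  [/\ measurable_fun setT f, forall x, x <= 0 -> f x = 0,
      (\int[mu]_x (`|f x| * weight K x)%:E <= c%:E)%E &
      forall k, K <= complex.Re k -> F k = laplace f k].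

Lemma nrm1_real_lexp K k (r : R) (x : R) : K <= complex.Re k ->
  (x <= 0 -> r = 0) -> nrm1 (r%:C * lexp k x) <= 2 * (`|r| * weight K x).
Proof.
move=> Kk r0; rewrite nrm1Mr; have [/r0->|x0] := leP x 0.
  by rewrite normr0 !mul0r mulr0.
rewrite mulrCA ler_wpM2l//; apply: (le_trans (nrm1_lexp _ _)).
rewrite ler_wpM2l// ler_expR lerN2 ler_wpM2r ?(ltW x0)//.
by rewrite ler_wpM2l.
Qed.

Lemma cintegrable_laplace K (f : TR -> R) k (c : R) :
  measurable_fun setT f -> (forall x, x <= 0 -> f x = 0) ->
  (\int[mu]_x (`|f x| * weight K x)%:E <= c%:E)%E -> K <= complex.Re k ->
  cintegrable mu (fun x => (f x)%:C * lexp k x).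
Proof.
move=> mf f0 fc Kk.
apply: (cintegrable_dominated (g := fun x => 2 * (`|f x| * weight K x))).
- by apply: cmeasurableM; [exact: cmeasurable_real|exact: cmeasurable_lexp].
- apply: (integrableZl _ _ (f := fun x => (`|f x| * weight K x)%:E)) => //.
  apply/integrableP; split.
    apply/measurable_EFinP; apply: measurable_funM; last exact: measurable_weight.
    exact: measurableT_comp.
  apply: le_lt_trans (ltry c); apply: le_trans fc.
  by under eq_integral do rewrite /= ger0_norm ?mulr_ge0 ?weight_ge0//.
- by move=> x; apply: nrm1_real_lexp => //; exact: f0.
Qed.

Lemma is_laplace_bound K F c k : is_laplace K F c -> K <= complex.Re k ->
  nrm1 (F k) <= 2 * c.
Proof.
move=> [f [mf f0 fc Ff]] Kk; rewrite Ff//.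
have fi := cintegrable_laplace mf f0 fc Kk.
apply: nrm1_cint_ereal; first exact: fi.1.
have mw : measurable_fun setT (fun x : TR => (`|f x| * weight K x)%:E).
  apply/measurable_EFinP; apply: measurable_funM; last exact: measurable_weight.
  exact: measurableT_comp.
apply: (@le_trans _ _ (\int[mu]_x (2%:E * (`|f x| * weight K x)%:E))%E).
  apply: ge0_le_integral => //.
  - by move=> x _; rewrite lee_fin nrm1_ge0.
  - by apply/measurable_EFinP; apply: measurable_nrm1; exact: fi.1.
  - by apply: measurable_funeM.
  - move=> x _; rewrite -EFinM lee_fin; apply: nrm1_real_lexp => //; exact: f0.
rewrite ge0_integralZl//; last first.
  by move=> x _; rewrite lee_fin mulr_ge0 ?weight_ge0.
by rewrite EFinM lee_pmul2l// lte_fin.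
Qed.

Section Shear.
Context d (T : measurableType d) (m : {sigma_finite_measure set T -> \bar R}).
Variables (h : T * TR -> R) (tau : T -> TR) (K c : R).
Hypothesis mh : measurable_fun setT h.
Hypothesis mtau : measurable_fun setT tau.
Hypothesis tau0 : forall t, 0 <= tau t.
Hypothesis h0 : forall t x, x <= 0 -> h (t, x) = 0.
Hypothesis hc : (\int[m]_t \int[mu]_x (`|h (t, x)| * weight K (x + tau t))%:E
                 <= c%:E)%E.

Let H (z : TR * T) : R := h (z.2, z.1 - tau z.2).

Let mH : measurable_fun setT H.
Proof.
apply: (measurableT_comp mh); apply/measurable_fun_pair => //=.
by apply: measurable_funB => //; exact: measurableT_comp.
Qed.

Let mHw : measurable_fun setT (fun z : TR * T => `|H z| * weight K z.1).
Proof.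
apply: measurable_funM; first exact: measurableT_comp.
exact: (measurableT_comp (measurable_weight K)).
Qed.

Let H0 x t : x <= 0 -> H (x, t) = 0.
Proof.
by move=> x0; apply: h0 => /=; rewrite subr_le0 (le_trans x0)// tau0.
Qed.

Let intH : (\int[mu]_x \int[m]_t (`|H (x, t)| * weight K x)%:E <= c%:E)%E.
Proof.
have mHwE : measurable_fun setT (fun z : TR * T => (`|H z| * weight K z.1)%:E).
  exact/measurable_EFinP.
have Hw0 (z : TR * T) : (0 <= (`|H z| * weight K z.1)%:E)%E.
  by rewrite lee_fin mulr_ge0 ?weight_ge0.
have := @fubini_tonelli _ _ TR T R mu m _ mHwE Hw0.
rewrite /= => ->; apply: le_trans hc; rewrite le_eqVlt; apply/orP; left; apply/eqP.
apply: eq_integral => t _.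
have mt : measurable_fun setT (fun x : TR => (`|h (t, x)| * weight K (x + tau t))%:E).
  apply/measurable_EFinP; apply: measurable_funM.
    by apply: measurableT_comp => //; exact: (measurableT_comp mh (pair1_measurable t)).
  apply: (measurableT_comp (measurable_weight K)).
  by apply: measurable_funD.
rewrite -(integral_translate (tau t) mt).
by apply: eq_integral => x _; rewrite /H /= subrK.
Qed.

(** A family of densities h(t, -), each delayed by tau t, is superposed into one density: translate
    in x, then exchange the integrals. Leaving the measure on t abstract lets the same argument
    serve convolutions, geometric series and the Volterra operator. *)
Lemma laplace_shear k : K <= complex.Re k ->
  cint m (fun t => cint mu (fun x => (h (t, x))%:C * lexp k (x + tau t))) =
  laplace (fun x => \int[m]_t h (t, x - tau t)) k.
Proof.
move=> Kk.
transitivity (cint m (fun t => cint mu (fun x => (H (x, t))%:C * lexp k x))).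
  apply: eq_cint => t.
  have mt : cmeasurable (fun x : TR => (h (t, x))%:C * lexp k (x + tau t)).
    apply: cmeasurableM.
      by apply: cmeasurable_real; exact: (measurableT_comp mh (pair1_measurable t)).
    apply: cmeasurable_lexp.
    by apply: measurable_funD.
  rewrite -(cint_translate (tau t) mt).
  by apply: eq_cint => x; rewrite subrK.
have iH : cintegrable (mu \x m)%E (fun z : TR * T => (H z)%:C * lexp k z.1).
  apply: (cintegrable_dominated (g := fun z => 2 * (`|H z| * weight K z.1))).
  - by apply: cmeasurableM; [exact: cmeasurable_real|exact: cmeasurable_lexp].
  - apply: (integrableZl _ _ (f := fun z => (`|H z| * weight K z.1)%:E)) => //.
    apply/integrable12ltyP; first exact/measurable_EFinP.
    apply: le_lt_trans (ltry c); apply: le_trans intH.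
    under eq_integral do under eq_integral do
      rewrite /= ger0_norm ?mulr_ge0 ?weight_ge0//.
    by [].
  - by move=> [x t]; apply: nrm1_real_lexp => // x0; rewrite H0.
rewrite -(cint_fubini iH) /laplace; apply: eq_cint => x.
rewrite /= cint_real_scale//.
exact: (measurableT_comp mH (pair1_measurable x)).
Qed.

Lemma is_laplace_shear F :
  (forall k, K <= complex.Re k -> F k =
     cint m (fun t => cint mu (fun x => (h (t, x))%:C * lexp k (x + tau t)))) ->
  is_laplace K F c.
Proof.
move=> FE.
have mf : measurable_fun setT (fun x : TR => \int[m]_t H (x, t)).
  exact: (measurable_Rintegral_param m mH).
exists (fun x => \int[m]_t H (x, t)); split => //.
- move=> x x0; under eq_Rintegral do rewrite H0//.
  by rewrite Rintegral_cst// mul0r.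
- apply: le_trans intH; apply: ge0_le_integral => //.
  + by move=> x _; rewrite lee_fin mulr_ge0 ?weight_ge0.
  + apply/measurable_EFinP; apply: measurable_funM; last exact: measurable_weight.
    exact: measurableT_comp.
  + have := @measurable_fun_fubini_tonelli_F _ _ _ _ _ m
      (fun z : TR * T => (`|H z| * weight K z.1)%:E).
    apply; first exact/measurable_EFinP.
    by move=> z; rewrite lee_fin mulr_ge0 ?weight_ge0.
  + move=> x _; rewrite EFinM.
    under eq_integral do rewrite EFinM.
    have mHx : measurable_fun setT (fun t : T => H (x, t)).
      exact: (measurableT_comp mH (pair1_measurable x)).
    rewrite ge0_integralZr ?lee_fin ?weight_ge0//; last first.
      by apply/measurable_EFinP; exact: measurableT_comp.
    rewrite lee_wpmul2r ?lee_fin ?weight_ge0//.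
    exact: EFin_normr_Rintegral_le.
by move=> k Kk; rewrite FE// laplace_shear.
Qed.

End Shear.
End Laplace.

(** The preimage of a set is the countable union of its slices at fixed n. *)
Lemma measurable_natX d (T : measurableType d) (R : realType) (f : nat -> T -> R) :
  (forall n, measurable_fun setT (f n)) ->
  measurable_fun setT (fun z : nat * T => f z.1 z.2).
Proof.
move=> mf _ B mB; rewrite setTI.
rewrite (_ : _ @^-1` B = \bigcup_n ([set n] `*` (f n @^-1` B))).
  apply: bigcup_measurable => n _; apply: measurableX => //.
  by rewrite -[X in measurable X]setTI; exact: mf.
apply/seteqP; split => [[n x] /= Bx|[n x] /= [k _ [/= -> //]]].
by exists n.
Qed.

(* The library only declares the sigma-finite content. *)
HB.instance Definition _ (R : realType) :=
  @Measure_isSigmaFinite.Build _ nat R (@counting nat R) (sigma_finite_counting R).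

(** * Series as integrals against the counting measure *)

Section Counting.
Context {R : realType}.
Implicit Types (c theta : R) (r : nat -> R).

Lemma geometric_nneseries_le c theta : 0 <= c -> 0 <= theta -> theta < 1 ->
  (\sum_(k <oo) (theta ^+ k * c)%:E <= (c / (1 - theta))%:E)%E.
Proof.
move=> c0 t0 t1.
apply: lime_le.
  by apply: is_cvg_nneseries => n _ _; rewrite lee_fin mulr_ge0 ?exprn_ge0.
apply: nearW => n /=; rewrite sumEFin lee_fin -mulr_suml mulrC.
rewrite ler_wpM2l// -[leRHS]div1r ler_pdivlMr ?subr_gt0// mulr_suml.
rewrite (_ : \sum_(0 <= k < n) _ = 1 - theta ^+ n).
  by rewrite gerBl exprn_ge0.
under eq_bigr do rewrite mulrBr mulr1 -exprSr.
rewrite -[LHS]opprK -sumrN.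
under eq_bigr do rewrite opprB.
by rewrite telescope_sumr// expr0 opprB.
Qed.

(** Both kinds of geometric series below are summed in this form: inverses 1 / (1 - M) and the
    Neumann series of the Volterra operator. As integrals they come under Fubini. *)
Lemma Rintegral_counting_telescope r c theta : 0 <= theta -> theta < 1 ->
  (forall n, `|r n| <= theta ^+ n * c) ->
  \int[counting]_n (r n - r n.+1) = r 0%N.
Proof.
move=> t0 t1 rc.
have c0 : 0 <= c by have := rc 0%N; rewrite expr0 mul1r; exact: le_trans.
have bd n : `|r n - r n.+1| <= theta ^+ n * (c + c).
  apply: (le_trans (ler_normB _ _)); rewrite mulrDr lerD//.
  apply: (le_trans (rc _)); rewrite ler_wpM2r// exprS ler_piMl ?exprn_ge0//.
  exact: ltW.
have sm : summable setT (fun n => (r n - r n.+1)%:E).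
  rewrite /summable -nneseries_esumT//.
  apply: (@le_lt_trans _ _ (\sum_(k <oo) (theta ^+ k * (c + c))%:E)%E).
    by apply: lee_nneseries => // n _; rewrite /= lee_fin.
  by apply: le_lt_trans (ltry ((c + c) / (1 - theta)));
    apply: geometric_nneseries_le => //; exact: addr_ge0.
rewrite /Rintegral integral_count//.
rewrite (_ : limn _ = (r 0%N)%:E)//; apply/cvg_lim => //.
have -> : (fun n => (\sum_(0 <= k < n) (r k - r k.+1)%:E)%E) =
          (fun n => (r 0%N - r n)%:E).
  apply/funext => n; rewrite sumEFin; congr EFin.
  rewrite -[LHS]opprK -sumrN.
  under eq_bigr do rewrite opprB.
  by rewrite telescope_sumr// opprB.
apply: cvg_EFin; first exact: nearW.
rewrite -[X in _ --> X]subr0; apply: cvgB; first exact: cvg_cst.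
apply/norm_cvg0P.
apply: (@squeeze_cvgr _ _ _ _ (fun=> 0) (fun n => theta ^+ n * c)).
- by apply: nearW => n; rewrite /= normr_ge0 rc.
- exact: cvg_cst.
- rewrite -[X in _ --> X](mul0r c); apply: cvgMr_tmp; apply: cvg_expr.
  by rewrite ger0_norm.
Qed.

Lemma integrable_counting r c theta : 0 <= c -> 0 <= theta -> theta < 1 ->
  (forall n, `|r n| <= theta ^+ n * c) ->
  (counting : {measure set nat -> \bar R}).-integrable setT (EFin \o r).
Proof.
move=> c0 t0 t1 rc; apply/integrableP; split => //.
rewrite ge0_integral_count//.
apply: (@le_lt_trans _ _ (\sum_(k <oo) (theta ^+ k * c)%:E)%E).
  by apply: lee_nneseries => // n _; rewrite /= lee_fin.
by apply: le_lt_trans (ltry (c / (1 - theta))); exact: geometric_nneseries_le.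
Qed.

End Counting.

(** * The algebra of Laplace transforms *)

Section LaplaceAlgebra.
Context {R : realType}.
Local Notation mu := (@lebesgue_measure R).
Local Notation TR := (measurableTypeR R).
Implicit Types (K c : R) (F G M : R[i] -> R[i]) (k : R[i]).

Lemma measurable_norm_weight K (f : TR -> R) : measurable_fun setT f ->
  measurable_fun setT (fun x : TR => (`|f x| * weight K x)%:E).
Proof.
move=> mf; apply/measurable_EFinP; apply: measurable_funM.
  exact: measurableT_comp.
exact: measurable_weight.
Qed.

Lemma norm_weight_ge0 K (f : TR -> R) x : (0 <= (`|f x| * weight K x)%:E)%E.
Proof. by rewrite lee_fin mulr_ge0 ?weight_ge0. Qed.

Lemma eq_is_laplace K F G c : (forall k, K <= complex.Re k -> F k = G k) ->
  is_laplace K F c -> is_laplace K G c.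
Proof.
move=> FG [f [mf f0 fc Ff]]; exists f; split => // k Kk.
by rewrite -FG// Ff.
Qed.

Lemma is_laplace_ge0 K F c : is_laplace K F c -> 0 <= c.
Proof.
move=> [f [mf f0 fc Ff]]; rewrite -lee_fin; apply: le_trans fc.
by apply: integral_ge0 => x _; exact: norm_weight_ge0.
Qed.

Lemma is_laplace_le K F c c' : c <= c' -> is_laplace K F c -> is_laplace K F c'.
Proof.
move=> cc [f [mf f0 fc Ff]]; exists f; split => //; apply: le_trans fc _.
by rewrite lee_fin.
Qed.

Lemma is_laplaceS K K' F c : K <= K' -> is_laplace K F c -> is_laplace K' F c.
Proof.
move=> KK [f [mf f0 fc Ff]]; exists f; split; [exact: mf|exact: f0| |by move=> k K'k; apply: Ff; exact: le_trans K'k].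
apply: le_trans fc; apply: ge0_le_integral => //.
- by move=> x _; exact: norm_weight_ge0.
- exact: measurable_norm_weight.
- exact: measurable_norm_weight.
- move=> x _; rewrite lee_fin; have [/f0->|x0] := leP x 0.
    by rewrite normr0 !mul0r.
  rewrite ler_wpM2l// ler_expR lerN2 ler_wpM2r ?(ltW x0)//.
  by rewrite ler_wpM2l.
Qed.

Lemma is_laplaceD K F G c c' : is_laplace K F c -> is_laplace K G c' ->
  is_laplace K (fun k => F k + G k) (c + c').
Proof.
move=> [f [mf f0 fc Ff]] [g [mg g0 gc Gg]]; exists (fun x => f x + g x).
split => [||| k Kk].
- exact: measurable_funD.
- by move=> x x0; rewrite f0// g0// addr0.
- rewrite EFinD; apply: le_trans (leeD fc gc).
  rewrite -ge0_integralD//; last 4 first.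
  + by move=> x _; exact: norm_weight_ge0.
  + exact: measurable_norm_weight.
  + by move=> x _; exact: norm_weight_ge0.
  + exact: measurable_norm_weight.
  apply: ge0_le_integral => //.
  + by move=> x _; exact: (norm_weight_ge0 K (fun x => f x + g x)).
  + by apply: (@measurable_norm_weight K (fun x => f x + g x)); exact: measurable_funD.
  + by apply: emeasurable_funD; exact: measurable_norm_weight.
  + by move=> x _; rewrite -EFinD lee_fin -mulrDl ler_wpM2r ?weight_ge0// ler_normD.
- rewrite Ff// Gg// /laplace -cintD//; last 2 first.
  + exact: cintegrable_laplace fc Kk.
  + exact: cintegrable_laplace gc Kk.
  by apply: eq_cint => x; rewrite rmorphD/= mulrDl.
Qed.

Lemma is_laplaceZ K F c (r : R) : is_laplace K F c ->
  is_laplace K (fun k => r%:C * F k) (`|r| * c).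
Proof.
move=> [f [mf f0 fc Ff]]; exists (fun x => r * f x); split => [||| k Kk].
- exact: measurable_funM.
- by move=> x x0; rewrite f0// mulr0.
- under eq_integral do rewrite normrM -mulrA EFinM.
  rewrite ge0_integralZl//; last 2 first.
  + exact: measurable_norm_weight.
  + by move=> x _; exact: norm_weight_ge0.
  by rewrite EFinM lee_wpmul2l.
- rewrite Ff// /laplace -cintZ; last exact: cintegrable_laplace fc Kk.
  by apply: eq_cint => x; rewrite rmorphM/= mulrA.
Qed.

Lemma is_laplace_delay K F c (s : R) : 0 <= s -> is_laplace K F c ->
  is_laplace K (fun k => lexp k s * F k) (weight K s * c).
Proof.
move=> s0 [f [mf f0 fc Ff]].
have mfs : measurable_fun setT (fun x : TR => f (x - s)).
  by apply: (measurableT_comp mf); exact: measurable_funB.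
exists (fun x => f (x - s)); split => [||| k Kk] //.
- by move=> x x0; apply: f0; rewrite subr_le0 (le_trans x0).
- rewrite (_ : integral _ _ _ =
    \int[mu]_x ((weight K s)%:E * (`|f x| * weight K x)%:E))%E.
    rewrite ge0_integralZl ?lee_fin ?weight_ge0//; last 2 first.
    + exact: measurable_norm_weight.
    + by move=> x _; exact: norm_weight_ge0.
    by rewrite EFinM lee_wpmul2l// lee_fin weight_ge0.
  rewrite -(integral_translate s (measurable_funeM _ (measurable_norm_weight K mf))).
  apply: eq_integral => x _; rewrite -EFinM; congr EFin.
  have -> : weight K x = weight K (x - s) * weight K s by rewrite -weightD subrK.
  by ring.
- have fi := cintegrable_laplace mf f0 fc Kk.
  rewrite Ff// /laplace -cintZ// -(cint_translate s); last first.
    by apply: cmeasurableM; [exact: cmeasurable_cst|exact: fi.1].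
  by apply: eq_cint => x; rewrite (lexpB k x s); ring.
Qed.

(** The convolution theorem, as the shear of f(t) g(x) with delay t. [Num.max t 0] equals t wherever
    f can be nonzero and keeps the delay nonnegative elsewhere. *)
Lemma is_laplaceM K F G c c' : is_laplace K F c -> is_laplace K G c' ->
  is_laplace K (fun k => F k * G k) (c * c').
Proof.
move=> Fc Gc; have c0 := is_laplace_ge0 Fc; have c'0 := is_laplace_ge0 Gc.
move: Fc Gc => [f [mf f0 fc Ff]] [g [mg g0 gc Gg]].
apply: (@is_laplace_shear _ _ TR mu (fun z => f z.1 * g z.2)
  (fun t : TR => Num.max t 0)) => //.
- by apply: measurable_funM; exact: measurableT_comp.
- exact: measurable_maxr.
- by move=> t; rewrite le_max lexx orbT.
- by move=> t x x0 /=; rewrite g0// mulr0.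
- have E t x : (`|f t * g x| * weight K (x + Num.max t 0))%:E =
      ((`|f t| * weight K t)%:E * (`|g x| * weight K x)%:E)%E.
    rewrite -EFinM; congr EFin; have [t0|t0] := leP t 0.
      by rewrite f0// mul0r normr0 !mul0r.
    by rewrite normrM weightD; ring.
  under eq_integral => t _.
    under eq_integral do rewrite /= E.
    rewrite ge0_integralZl//; last 3 first.
    + exact: measurable_norm_weight.
    + by move=> x _; exact: norm_weight_ge0.
    + exact: norm_weight_ge0.
    over.
  rewrite ge0_integralZr//.
  + by rewrite EFinM lee_pmul// integral_ge0// => x _; exact: norm_weight_ge0.
  + exact: measurable_norm_weight.
  + by move=> x _; exact: norm_weight_ge0.
  + by apply: integral_ge0 => x _; exact: norm_weight_ge0.
- move=> k Kk; rewrite Ff// Gg// /laplace.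
  have fi := cintegrable_laplace mf f0 fc Kk.
  have gi := cintegrable_laplace mg g0 gc Kk.
  rewrite mulrC -cintZ//; apply: eq_cint => t.
  rewrite mulrC -cintZ//; apply: eq_cint => x /=.
  have [t0|t0] := leP t 0; first by rewrite f0// !mul0r.
  by rewrite lexpD rmorphM/=; ring.
Qed.

(** M is only required to contract the norm under multiplication, and need not be a transform
    itself. This covers both M = sigma e^{- 2 k b}, which is the transform of a point mass, and
    multiplication by a transform of small norm. *)
Lemma is_laplace_geometric K M F c theta : 0 <= theta -> theta < 1 ->
  (forall G c', is_laplace K G c' -> is_laplace K (fun k => M k * G k) (theta * c')) ->
  is_laplace K F c -> is_laplace K (fun k => F k / (1 - M k)) (c / (1 - theta)).
Proof.
move=> t0 t1 hM Fc; have c0 := is_laplace_ge0 Fc.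
have Fn n : is_laplace K (fun k => M k ^+ n * F k) (theta ^+ n * c).
  elim: n => [|n /hM IH].
    by apply: eq_is_laplace (is_laplace_le _ Fc) => [k _|]; rewrite expr0 mul1r.
  rewrite exprS -mulrA; apply: eq_is_laplace IH => k _.
  by rewrite exprS mulrA.
pose f n := sval (cid (Fn n)).
have [mf f0 fc Ff] : [/\ forall n, measurable_fun setT (f n),
    forall n x, x <= 0 -> f n x = 0,
    forall n, (\int[mu]_x (`|f n x| * weight K x)%:E <= (theta ^+ n * c)%:E)%E &
    forall n k, K <= complex.Re k -> M k ^+ n * F k = laplace (f n) k].
  by split => n; rewrite /f; case: (cid _) => g /= [].
pose cn : {sigma_finite_measure set nat -> \bar R} := @counting nat R.
apply: (@is_laplace_shear _ _ nat cn (fun z => f z.1 z.2) (fun=> 0)) => //.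
- exact: measurable_natX.
- under eq_integral do under eq_integral do rewrite /= addr0.
  rewrite ge0_integral_count; last first.
    by move=> n; apply: integral_ge0 => x _; exact: norm_weight_ge0.
  apply: le_trans (geometric_nneseries_le c0 t0 t1).
  apply: lee_nneseries => n _ //.
  by move=> _; apply: integral_ge0 => x _; exact: norm_weight_ge0.
move=> k Kk.
have -> : cint cn (fun t => cint mu (fun x => (f t x)%:C * lexp k (x + 0))) =
    cint cn (fun n => M k ^+ n * F k).
  apply: eq_cint => n; rewrite Ff//; apply: eq_cint => x; by rewrite addr0.
have bd n : nrm1 (M k ^+ n * F k) <= theta ^+ n * (2 * c).
  by apply: (le_trans (is_laplace_bound (Fn n) Kk)); rewrite mulrCA.
have bdRe n : `|complex.Re (M k ^+ n * F k)| <= theta ^+ n * (2 * c).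
  by apply: le_trans (bd n); rewrite lerDl.
have bdIm n : `|complex.Im (M k ^+ n * F k)| <= theta ^+ n * (2 * c).
  by apply: le_trans (bd n); rewrite lerDr.
have iX : cintegrable cn (fun n => M k ^+ n * F k).
  split; first by split.
  apply: (@integrable_counting _ _ (2 * c) theta) => //; first exact: mulr_ge0.
  by move=> n; rewrite ger0_norm ?nrm1_ge0.
(* The series telescopes after multiplication by 1 - M k, whether or not this factor vanishes. *)
have E : (1 - M k) * cint cn (fun n => M k ^+ n * F k) = F k.
  rewrite -cintZ//; apply: complex_eqP => /=.
    rewrite (_ : (fun n => _) = (fun n => complex.Re (M k ^+ n * F k) -
        complex.Re (M k ^+ n.+1 * F k))).
      by rewrite (Rintegral_counting_telescope t0 t1 bdRe) expr0 mul1r.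
    by apply/funext => n; rewrite -ReN -ReD exprS; congr complex.Re; ring.
  rewrite (_ : (fun n => _) = (fun n => complex.Im (M k ^+ n * F k) -
      complex.Im (M k ^+ n.+1 * F k))).
    by rewrite (Rintegral_counting_telescope t0 t1 bdIm) expr0 mul1r.
  by apply/funext => n; rewrite -ImN -ImD exprS; congr complex.Im; ring.
(* If M k = 1, then E forces F k = 0; the series is 0, and so is the quotient by 0. *)
have [M1|M1] := eqVneq (1 - M k) 0; last by rewrite -{1}E mulrAC divff// mul1r.
have Fk0 : F k = 0 by rewrite -E M1 mul0r.
rewrite Fk0 mul0r; apply/esym/complex_eqP => /=.
  under eq_Rintegral do rewrite mulr0.
  by rewrite Rintegral_cst// mul0r.
under eq_Rintegral do rewrite mulr0.
by rewrite Rintegral_cst// mul0r.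
Qed.

End LaplaceAlgebra.

(** * Dominated Fubini, cut-off factors and exponential bounds *)

Section FubiniDominated.
Context d1 d2 {T1 : measurableType d1} {T2 : measurableType d2} {R : realType}.
Variables (m1 : {sigma_finite_measure set T1 -> \bar R}).
Variables (m2 : {sigma_finite_measure set T2 -> \bar R}).
Variables (g1 : T1 -> R) (g2 : T2 -> R).
Hypothesis ig1 : m1.-integrable setT (EFin \o g1).
Hypothesis ig2 : m2.-integrable setT (EFin \o g2).

Lemma integrable_prod_dominated (f : T1 * T2 -> R) : measurable_fun setT f ->
  (forall x y, `|f (x, y)| <= g1 x * g2 y) ->
  (m1 \x m2)%E.-integrable setT (EFin \o f).
Proof.
move=> mf fg; apply: integrable_dominated (integrable_prod ig1 ig2) _ => //.
by move=> [x y]; exact: fg.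
Qed.

Lemma Rintegral_fubini_dominated (f : T1 * T2 -> R) : measurable_fun setT f ->
  (forall x y, `|f (x, y)| <= g1 x * g2 y) ->
  \int[m1]_x \int[m2]_y f (x, y) = \int[m2]_y \int[m1]_x f (x, y).
Proof.
move=> mf fg; have fi := integrable_prod_dominated mf fg.
by rewrite Rintegral12// Rintegral21.
Qed.

End FubiniDominated.

Section Indicator.
Context {R : realType}.

(** Domains of integration are encoded as factors of the integrand, so that every integral runs over
    the whole line and Fubini needs no manipulation of sets. *)
Definition lt1 (x y : R) : R := (x < y)%R%:R.

Lemma lt1_ge0 x y : 0 <= lt1 x y. Proof. exact: ler0n. Qed.

Lemma lt1_le1 x y : lt1 x y <= 1. Proof. by rewrite /lt1; case: (x < y). Qed.

Lemma normr_lt1 x y : `|lt1 x y| <= 1.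
Proof. by rewrite ger0_norm ?lt1_ge0// lt1_le1. Qed.

Lemma lt1_lt x y : x < y -> lt1 x y = 1. Proof. by rewrite /lt1 => ->. Qed.

Lemma lt1_le x y : y <= x -> lt1 x y = 0.
Proof. by rewrite /lt1 leNgt => /negbTE ->. Qed.

Lemma measurable_lt1 d (T : measurableType d) (f g : T -> R) :
  measurable_fun setT f -> measurable_fun setT g ->
  measurable_fun setT (fun x => lt1 (f x) (g x)).
Proof.
move=> mf mg; have mb := measurable_fun_ltr mf mg.
rewrite (_ : (fun x => _) = (fun x => if (f x < g x)%R then 1 else 0)).
  by apply: measurable_fun_ifT => //; exact: measurable_cst.
by apply/funext => x; rewrite /lt1; case: ltP.
Qed.

End Indicator.

Section ExponentialDecay.
Context {R : realType}.
Local Notation mu := (@lebesgue_measure R).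
Local Notation TR := (measurableTypeR R).
Variable l : R.
Hypothesis l0 : 0 < l.

(** This is e^{- l x} for x >= 0, taken from the exponential distribution because the total mass 1
    of the latter yields the integral 1 / l. *)
Definition decay (x : TR) : R := l^-1 * exponential_pdf l x.

Lemma integrable_decay : mu.-integrable setT (EFin \o decay).
Proof.
exact: (integrableZl measurableT l^-1 (integrable_exponential_pdf l0)).
Qed.

Lemma decay_ge0 x : 0 <= decay x.
Proof. by rewrite mulr_ge0 ?invr_ge0 ?exponential_pdf_ge0// ltW. Qed.

Lemma decayE x : 0 <= x -> decay x = expR (- (l * x)).
Proof.
move=> x0; rewrite /decay exponential_pdfE//.
by rewrite mulrA mulVf ?gt_eqF// mul1r mulNr.
Qed.

Lemma lt1_expR_decay x : lt1 0 x * expR (- (l * x)) <= decay x.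
Proof.
have [x0|x0] := ltP 0 x; first by rewrite lt1_lt// mul1r decayE// ltW.
by rewrite lt1_le// mul0r decay_ge0.
Qed.

Lemma integral_decay : (\int[mu]_x (decay x)%:E = (l^-1)%:E)%E.
Proof.
rewrite /decay; under eq_integral do rewrite EFinM.
rewrite ge0_integralZl//; last 3 first.
- apply/measurable_EFinP; exact: measurable_exponential_pdf.
- by move=> x _; rewrite lee_fin exponential_pdf_ge0// ltW.
- by rewrite lee_fin invr_ge0 ltW.
by rewrite integral_exponential_pdf// mule1.
Qed.

Lemma Rintegral_decay : \int[mu]_x decay x = l^-1.
Proof. by rewrite /Rintegral integral_decay. Qed.

End ExponentialDecay.

(** * The Volterra equation *)

Section Kernel.
Context {R : realType}.
Local Notation mu := (@lebesgue_measure R).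
Local Notation TR := (measurableTypeR R).
Variable q : TR -> R.
Hypothesis iq : mu.-integrable setT (EFin \o q).

Let mq : measurable_fun setT q.
Proof. by have /measurable_EFinP := measurable_int _ iq. Qed.

Let niq : mu.-integrable setT (EFin \o (fun x => `|q x|)).
Proof. by have /integrable_norm := iq. Qed.

Definition qnorm : R := \int[mu]_x `|q x|.

Lemma qnorm_ge0 : 0 <= qnorm. Proof. exact: Rintegral_ge0. Qed.

(** Large enough for [qnorm / rate <= 1/2], which is the contraction factor of the Volterra
    operator; the summand 1 keeps it positive for q = 0. *)
Definition rate : R := 2 * qnorm + 1.

Lemma rate_gt0 : 0 < rate.
Proof. by rewrite ltr_wpDl ?mulr_ge0 ?qnorm_ge0. Qed.

Lemma qnorm_rate : qnorm * rate^-1 <= 2^-1.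
Proof.
rewrite ler_pdivrMr ?rate_gt0// /rate mulrDr mulrA mulVf ?mul1r ?mulr1//.
by rewrite lerDl invr_ge0.
Qed.

(** Growth e^{rate y} is compatible with the Laplace kernel e^{- 2 kappa y} as soon as Re kappa >=
    rate, with e^{- rate y} to spare. *)
Definition kernel_bound (C : R) (k : TR * TR -> R) :=
  [/\ measurable_fun setT k, forall x y, y <= 0 -> k (x, y) = 0 &
      forall x y, `|k (x, y)| <= C * expR (rate * y)].

(* The Laplace transform of [volterra k] in its second argument is the double
   integral of [e^{- 2 kappa g} q khat]: multiplication by [e^{- 2 kappa g}] delays [k]. *)
Definition volterra (k : TR * TR -> R) (z : TR * TR) : R :=
  \int[mu]_g (lt1 0 g * \int[mu]_t (lt1 (z.1 + g) t * q t * k (t, z.2 - g))).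

Let inner_integrand (k : TR * TR -> R) (w : TR * TR * TR * TR) : R :=
  lt1 (w.1.1.1 + w.1.2) w.2 * q w.2 * k (w.2, w.1.1.2 - w.1.2).

Let measurable_inner k : measurable_fun setT k ->
  measurable_fun setT (inner_integrand k).
Proof.
move=> mk; apply: measurable_funM.
  apply: measurable_funM; last exact: measurableT_comp.
  apply: measurable_lt1 => //.
  by apply: measurable_funD; repeat apply: measurableT_comp.
apply: (measurableT_comp mk); apply/measurable_fun_pair => //=.
by apply: measurable_funB; repeat apply: measurableT_comp.
Qed.

Let measurable_outer k : measurable_fun setT k -> measurable_fun setT
  (fun w : TR * TR * TR => lt1 0 w.2 *
    \int[mu]_t (lt1 (w.1.1 + w.2) t * q t * k (t, w.1.2 - w.2))).
Proof.
move=> mk; apply: measurable_funM; first exact: measurable_lt1.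
exact: (measurable_Rintegral_param mu (measurable_inner mk)).
Qed.

Lemma measurable_volterra k : measurable_fun setT k ->
  measurable_fun setT (volterra k).
Proof. by move=> mk; exact: (measurable_Rintegral_param mu (measurable_outer mk)). Qed.

Section Bounded.
Variables (C : R) (k : TR * TR -> R).
Hypothesis kC : kernel_bound C k.

Let C0 : 0 <= C.
Proof.
case: kC => _ _ /(_ 0 0); rewrite mulr0 expR0 mulr1; exact: le_trans.
Qed.

Let mk : measurable_fun setT k. Proof. by case: kC. Qed.

Lemma kernel_bound_lt1 x y : `|k (x, y)| <= lt1 0 y * (C * expR (rate * y)).
Proof.
case: kC => _ k0 kb; have [y0|y0] := leP y 0.
  by rewrite k0// normr0 mulr_ge0 ?lt1_ge0// mulr_ge0 ?expR_ge0.
by rewrite lt1_lt// mul1r.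
Qed.

Lemma inner_bound x g y t :
  `|lt1 (x + g) t * q t * k (t, y - g)| <=
    `|q t| * (lt1 0 (y - g) * (C * expR (rate * (y - g)))).
Proof.
rewrite !normrM ler_pM ?mulr_ge0 ?kernel_bound_lt1//.
by rewrite ler_piMl ?normr_lt1.
Qed.

Let measurable_inner_t x g y :
  measurable_fun setT (fun t : TR => lt1 (x + g) t * q t * k (t, y - g)).
Proof.
exact: (measurableT_comp (measurable_inner mk) (pair1_measurable ((x, y), g))).
Qed.

Lemma inner_integral_bound x g y :
  `|\int[mu]_t (lt1 (x + g) t * q t * k (t, y - g))| <=
    lt1 0 (y - g) * (C * expR (rate * (y - g))) * qnorm.
Proof.
rewrite /qnorm -RintegralZl//.
apply: le_normr_Rintegral_dominated => //; first exact: (integrableZl _ _ niq).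
by move=> t; rewrite [leRHS]mulrC inner_bound.
Qed.

Lemma outer_bound x g y :
  `|lt1 0 g * \int[mu]_t (lt1 (x + g) t * q t * k (t, y - g))| <=
    qnorm * C * expR (rate * y) * decay rate g.
Proof.
rewrite normrM ger0_norm ?lt1_ge0//.
apply: (@le_trans _ _ (lt1 0 g * (1 * (C * expR (rate * (y - g))) * qnorm))).
  rewrite ler_wpM2l ?lt1_ge0//; apply: (le_trans (inner_integral_bound _ _ _)).
  rewrite ler_wpM2r ?qnorm_ge0// ler_wpM2r ?lt1_le1//.
  by rewrite mulr_ge0 ?expR_ge0.
rewrite mulrBr expRD.
rewrite (_ : _ * _ = qnorm * C * expR (rate * y) * (lt1 0 g * expR (- (rate * g)))).
  rewrite ler_wpM2l ?lt1_expR_decay ?rate_gt0//.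
  by rewrite mulr_ge0 ?expR_ge0// mulr_ge0 ?qnorm_ge0.
by ring.
Qed.

Let measurable_outer_g x y : measurable_fun setT (fun g : TR =>
  lt1 0 g * \int[mu]_t (lt1 (x + g) t * q t * k (t, y - g))).
Proof.
exact: (measurableT_comp (measurable_outer mk) (pair1_measurable (x, y))).
Qed.

(** The delay by g replaces e^{rate y} by e^{rate y} e^{- rate g}. Integrating over g > 0 gives 1 /
    rate, the integral in t gives [qnorm], and the product is at most 1/2. *)
Lemma kernel_bound_volterra : kernel_bound (2^-1 * C) (volterra k).
Proof.
split; first exact: measurable_volterra.
- move=> x y y0; rewrite /volterra /=.
  transitivity (\int[mu]_(g in setT) (0 : R)); last by rewrite Rintegral_cst// mul0r.
  apply: eq_Rintegral => g _; have [g0|g0] := leP g 0.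
    by rewrite lt1_le// mul0r.
  have k0 t : k (t, y - g) = 0.
    by case: kC => _ + _; apply; rewrite subr_le0 (le_trans y0)// ltW.
  under eq_Rintegral do rewrite k0 mulr0.
  by rewrite Rintegral_cst// mul0r mulr0.
- move=> x y; rewrite /volterra /=.
  apply: (@le_trans _ _ (\int[mu]_g (qnorm * C * expR (rate * y) * decay rate g))).
    apply: le_normr_Rintegral_dominated => //.
      exact: (integrableZl _ _ (integrable_decay rate_gt0)).
    by move=> g; exact: outer_bound.
  rewrite RintegralZl//; last exact: integrable_decay rate_gt0.
  rewrite (Rintegral_decay rate_gt0).
  rewrite (_ : _ * _ = qnorm * rate^-1 * (C * expR (rate * y))); last by ring.
  rewrite -[leRHS]mulrA ler_wpM2r ?qnorm_rate//.
  by rewrite mulr_ge0 ?expR_ge0.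
Qed.

End Bounded.

Section FixedPoint.
Variables (C : R) (k0 : TR * TR -> R).
Hypothesis k0C : kernel_bound C k0.

Let kn n := iter n volterra k0.

Let knC n : kernel_bound (2^-1 ^+ n * C) (kn n).
Proof.
elim: n => [|n IH]; first by rewrite expr0 mul1r.
by rewrite exprS -mulrA; exact: kernel_bound_volterra.
Qed.

Let kn_le n z : `|kn n z| <= 2^-1 ^+ n * (C * expR (rate * z.2)).
Proof. by case: z => x y; rewrite mulrA; case: (knC n) => _ _; exact. Qed.

Let C0 : 0 <= C.
Proof.
case: k0C => _ _ /(_ 0 0); rewrite mulr0 expR0 mulr1; exact: le_trans.
Qed.

Let half0 : 0 <= 2^-1 :> R. Proof. by rewrite invr_ge0. Qed.

Let half1 : 2^-1 < 1 :> R. Proof. by rewrite invf_lt1// ltr1n. Qed.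

Let cn : {sigma_finite_measure set nat -> \bar R} := @counting nat R.

Let measurable_kn : measurable_fun setT (fun w : (TR * TR) * nat => kn w.2 w.1).
Proof.
have mn : measurable_fun setT (fun w : nat * (TR * TR) => kn w.1 w.2).
  by apply: measurable_natX => n; case: (knC n).
apply: (measurableT_comp mn (g := fun w : (TR * TR) * nat => (w.2, w.1))).
exact/measurable_fun_pair.
Qed.

Let integrable_geometric c : 0 <= c ->
  cn.-integrable setT (EFin \o (fun n => 2^-1 ^+ n * c)).
Proof.
move=> c0; apply: (@integrable_counting _ _ c 2^-1) => // n.
by rewrite ger0_norm// mulr_ge0// exprn_ge0.
Qed.

(** The Neumann series of the iterates of [volterra]; the constant 2 is the sum of the powers of
    1/2. *)
Lemma volterra_fixpoint :
  exists2 k, kernel_bound (2 * C) k & forall z, k z = k0 z + volterra k z.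
Proof.
exists (fun z => \int[cn]_n kn n z).
  split; first exact: (measurable_Rintegral_param cn measurable_kn).
  - move=> x y y0.
    have E n : kn n (x, y) = 0 by case: (knC n) => _ + _; apply.
    under eq_Rintegral do rewrite E.
    by rewrite Rintegral_cst// mul0r.
  - move=> x y; apply: le_normr_Rintegral_ereal => //.
    rewrite ge0_integral_count//.
    apply: (@le_trans _ _ (\sum_(n <oo) (2^-1 ^+ n * (C * expR (rate * y)))%:E)%E).
      by apply: lee_nneseries => // n _; rewrite lee_fin kn_le.
    apply: (le_trans (geometric_nneseries_le _ half0 half1)).
      by rewrite mulr_ge0 ?expR_ge0.
    by rewrite lee_fin le_eqVlt; apply/orP; left; apply/eqP; field.
move=> [x y].
have ikn : cn.-integrable setT (EFin \o (fun n => kn n (x, y))).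
  by apply: (@integrable_counting _ _ (C * expR (rate * y)) 2^-1) => //;
    rewrite mulr_ge0 ?expR_ge0.
have ikS : cn.-integrable setT (EFin \o (fun n => kn n.+1 (x, y))).
  apply: (@integrable_counting _ _ (C * expR (rate * y)) 2^-1) => //.
    by rewrite mulr_ge0 ?expR_ge0.
  move=> n; apply: (le_trans (kn_le _ _)) => /=.
  by rewrite ler_wpM2r ?mulr_ge0 ?expR_ge0// exprS ler_piMl ?exprn_ge0// ltW.
(* [volterra] passes under the sum by two applications of Fubini, for the integral in t and for that
   in g; the powers of 1/2 provide the dominating sequence. *)
have -> : volterra (fun z => \int[cn]_n kn n z) (x, y) = \int[cn]_n kn n.+1 (x, y).
  rewrite /volterra /=.
  transitivity (\int[mu]_g \int[cn]_n (lt1 0 g *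
      \int[mu]_t (lt1 (x + g) t * q t * kn n (t, y - g)))).
    apply: eq_Rintegral => g _; rewrite RintegralZl_measurable//; congr (_ * _).
    transitivity (\int[mu]_t \int[cn]_n (lt1 (x + g) t * q t * kn n (t, y - g))).
      by apply: eq_Rintegral => t _; rewrite RintegralZl_measurable.
    have ig : cn.-integrable setT
        (EFin \o (fun n => 2^-1 ^+ n * (C * expR (rate * (y - g))))).
      by apply: integrable_geometric; rewrite mulr_ge0 ?expR_ge0.
    apply: (Rintegral_fubini_dominated niq ig
      (f := fun w => lt1 (x + g) w.1 * q w.1 * kn w.2 (w.1, y - g))).
      apply: measurable_funM.
        apply: measurable_funM; last exact: measurableT_comp.
        exact: measurable_lt1.
      apply: (measurableT_comp measurable_kn
        (g := fun w : TR * nat => ((w.1, y - g), w.2))).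
      by apply/measurable_fun_pair => //; exact/measurable_fun_pair.
    move=> t n; rewrite !normrM /= ler_pM ?mulr_ge0//.
    by rewrite ler_piMl ?normr_lt1.
  have ig : cn.-integrable setT
      (EFin \o (fun n => 2^-1 ^+ n * (qnorm * C * expR (rate * y)))).
    by apply: integrable_geometric; rewrite !mulr_ge0 ?expR_ge0 ?qnorm_ge0.
  apply: (Rintegral_fubini_dominated (integrable_decay rate_gt0) ig
    (f := fun w => lt1 0 w.1 * \int[mu]_t (lt1 (x + w.1) t * q t * kn w.2 (t, y - w.1)))).
    apply: measurable_funM; first exact: measurable_lt1.
    apply: (measurable_Rintegral_param mu
      (f := fun w : (TR * nat) * TR => lt1 (x + w.1.1) w.2 * q w.2 * kn w.1.2 (w.2, y - w.1.1))).
    apply: measurable_funM.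
      apply: measurable_funM; last exact: measurableT_comp.
      apply: measurable_lt1 => //.
      by apply: measurable_funD => //; exact: measurableT_comp.
    apply: (measurableT_comp measurable_kn
      (g := fun w : (TR * nat) * TR => ((w.2, y - w.1.1), w.1.2))).
    apply/measurable_fun_pair => //=; last exact: measurableT_comp.
    apply/measurable_fun_pair => //=.
    by apply: measurable_funB => //; exact: measurableT_comp.
  move=> g n; apply: (le_trans (outer_bound (knC n) _ _ _)).
  by rewrite le_eqVlt; apply/orP; left; apply/eqP; rewrite /=; ring.
(* The sum minus its shift telescopes to the term n = 0, which is [k0]. *)
apply/eqP; rewrite -subr_eq -RintegralB//; apply/eqP.
by rewrite (Rintegral_counting_telescope half0 half1 (kn_le ^~ (x, y))).
Qed.

End FixedPoint.
End Kernel.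

Section ShearIntegrable.
Context {R : realType}.
Local Notation mu := (@lebesgue_measure R).
Local Notation TR := (measurableTypeR R).
Context d (T : measurableType d) (m : {sigma_finite_measure set T -> \bar R}).
Variables (h : T * TR -> R) (tau : T -> TR) (K : R).
Hypothesis mh : measurable_fun setT h.
Hypothesis mtau : measurable_fun setT tau.
Hypothesis tau0 : forall t, 0 <= tau t.
Hypothesis h0 : forall t x, x <= 0 -> h (t, x) = 0.
Hypothesis ih : (m \x mu)%E.-integrable setT
  (EFin \o (fun z => `|h z| * weight K (z.2 + tau z.1))).

Let hc : exists c, (\int[m]_t \int[mu]_x (`|h (t, x)| * weight K (x + tau t))%:E
                 <= c%:E)%E.
Proof.
have mhw := measurable_int _ ih.
have /(integrable12ltyP m mu mhw) hlt := ih.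
exists (fine (\int[m]_t \int[mu]_x (`|h (t, x)| * weight K (x + tau t))%:E)%E).
rewrite fineK// ge0_fin_numE.
  apply: le_lt_trans hlt; rewrite le_eqVlt; apply/orP; left; apply/eqP.
  apply: eq_integral => t _; apply: eq_integral => x _ /=.
  by rewrite [in RHS]ger0_norm ?mulr_ge0 ?weight_ge0.
apply: integral_ge0 => t _; apply: integral_ge0 => x _.
by rewrite lee_fin mulr_ge0// weight_ge0.
Qed.

(** For uses where the constant only has to be finite, it is extracted from integrability on the
    product. *)
Lemma laplace_shear_integrable k : K <= complex.Re k ->
  cint m (fun t => cint mu (fun x => (h (t, x))%:C * lexp k (x + tau t))) =
  laplace (fun x => \int[m]_t h (t, x - tau t)) k.
Proof. by have [c /laplace_shear] := hc; apply. Qed.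

Lemma is_laplace_shear_integrable F :
  (forall k, K <= complex.Re k -> F k =
     cint m (fun t => cint mu (fun x => (h (t, x))%:C * lexp k (x + tau t)))) ->
  exists c, is_laplace K F c.
Proof. by move=> FE; have [c hc'] := hc; exists c; apply: is_laplace_shear hc' _ FE. Qed.

End ShearIntegrable.

(** * Laplace transform of the kernel in its second argument *)

Section KernelLaplace.
Context {R : realType}.
Local Notation mu := (@lebesgue_measure R).
Local Notation TR := (measurableTypeR R).
Variable q : TR -> R.
Hypothesis iq : mu.-integrable setT (EFin \o q).
Local Notation rate := (rate q).

Let mq : measurable_fun setT q.
Proof. by have /measurable_EFinP := measurable_int _ iq. Qed.

Let niq : mu.-integrable setT (EFin \o (fun x => `|q x|)).
Proof. by have /integrable_norm := iq. Qed.

Let rate0 : 0 < rate. Proof. exact: rate_gt0. Qed.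

Definition khat (k : TR * TR -> R) (kap : R[i]) (x : TR) : R[i] :=
  laplace (fun y => k (x, y)) kap.

Section Bounds.
Variables (C : R) (k : TR * TR -> R).
Hypothesis kC : kernel_bound q C k.

Let mk : measurable_fun setT k. Proof. by case: kC. Qed.

Let C0 : 0 <= C.
Proof.
case: kC => _ _ /(_ 0 0); rewrite mulr0 expR0 mulr1; exact: le_trans.
Qed.

Let mkx x : measurable_fun setT (fun y => k (x, y)).
Proof. exact: (measurableT_comp mk (pair1_measurable x)). Qed.

Let k0 x y : y <= 0 -> k (x, y) = 0. Proof. by case: kC => _ + _; apply. Qed.

(** Half of the weight e^{- 2 K y} absorbs the growth e^{rate y}, as rate <= K; the other half
    remains as decay. *)
Lemma kernel_weight_decay K x y : rate <= K ->
  `|k (x, y)| * weight K y <= C * decay K y.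
Proof.
move=> rK; have K0 := lt_le_trans rate0 rK.
apply: (@le_trans _ _ (lt1 0 y * (C * expR (rate * y)) * weight K y)).
  by rewrite ler_wpM2r ?weight_ge0//; exact: kernel_bound_lt1.
apply: (@le_trans _ _ (C * (lt1 0 y * expR (- (K * y))))); last first.
  by rewrite ler_wpM2l// lt1_expR_decay.
have [y0|y0] := leP y 0; first by rewrite lt1_le// !mul0r mulr0.
rewrite lt1_lt// !mul1r -mulrA ler_wpM2l// -expRD ler_expR.
rewrite (_ : - (K * y) = K * y - 2 * K * y); last by ring.
by rewrite lerD2r ler_wpM2r// ltW.
Qed.

Lemma nrm1_khat_integrand kap x y : rate <= complex.Re kap ->
  nrm1 ((k (x, y))%:C * lexp kap y) <= 2 * C * decay rate y.
Proof.
move=> rk; apply: (le_trans (nrm1_real_lexp rk (@k0 x y))).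
by rewrite -mulrA ler_wpM2l// kernel_weight_decay.
Qed.

Let idecay K c : rate <= K -> mu.-integrable setT (EFin \o (fun y => c * decay K y)).
Proof.
move=> rK; exact: (integrableZl measurableT c (integrable_decay (lt_le_trans rate0 rK))).
Qed.

Lemma cintegrable_khat kap x : rate <= complex.Re kap ->
  cintegrable mu (fun y => (k (x, y))%:C * lexp kap y).
Proof.
move=> rk; apply: (cintegrable_dominated (g := fun y => 2 * C * decay rate y)).
- by apply: cmeasurableM; [exact: cmeasurable_real|exact: cmeasurable_lexp].
- exact: idecay.
- by move=> y; exact: nrm1_khat_integrand.
Qed.

Lemma nrm1_khat kap x : rate <= complex.Re kap ->
  nrm1 (khat k kap x) <= 2 * C * rate^-1.
Proof.
move=> rk; rewrite -(Rintegral_decay rate0) -RintegralZl//; last exact: integrable_decay.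
apply: nrm1_cint_dominated; first exact: (cintegrable_khat x rk).1.
  exact: idecay.
by move=> y; exact: nrm1_khat_integrand.
Qed.

(** The factor 1 / K is essential: raising K makes the norm of khat(0) as small as desired, and this
    makes psi(0) invertible. *)
Lemma is_laplace_khat K x : rate <= K ->
  is_laplace K (fun kap => khat k kap x) (C * K^-1).
Proof.
move=> rK; have K0 := lt_le_trans rate0 rK.
exists (fun y => k (x, y)); split => //; first exact: k0.
apply: (@le_trans _ _ (\int[mu]_y (C%:E * (decay K y)%:E))%E).
  apply: ge0_le_integral => //.
  - by move=> y _; rewrite lee_fin mulr_ge0 ?weight_ge0.
  - exact: (measurable_norm_weight K (mkx x)).
  - by have := measurable_int _ (idecay C rK).
  - by move=> y _; rewrite -EFinM lee_fin kernel_weight_decay.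
rewrite ge0_integralZl// ?integral_decay//.
  by have := measurable_int _ (integrable_decay K0).
by move=> y _; rewrite lee_fin decay_ge0.
Qed.

Lemma cmeasurable_khat kap : cmeasurable (khat k kap).
Proof.
apply: (cmeasurable_cint mu (f := fun z : TR * TR => (k z)%:C * lexp kap z.2)).
by apply: cmeasurableM; [exact: cmeasurable_real|exact: cmeasurable_lexp].
Qed.

Let volterra_h x (z : TR * TR) : R :=
  lt1 0 z.1 * \int[mu]_t (lt1 (x + z.1) t * q t * k (t, z.2)).

Let measurable_volterra_h x : measurable_fun setT (volterra_h x).
Proof.
apply: measurable_funM; first exact: measurable_lt1.
apply: (measurable_Rintegral_param mu
  (f := fun w : TR * TR * TR => lt1 (x + w.1.1) w.2 * q w.2 * k (w.2, w.1.2))).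
apply: measurable_funM.
  apply: measurable_funM; last exact: measurableT_comp.
  apply: measurable_lt1 => //.
  by apply: measurable_funD => //; exact: measurableT_comp.
apply: (measurableT_comp mk); apply/measurable_fun_pair => //=.
exact: measurableT_comp.
Qed.

Let volterra_h_le x g y : `|volterra_h x (g, y)| * weight rate (y + Num.max g 0) <=
  qnorm q * decay rate g * (C * decay rate y).
Proof.
have := inner_integral_bound iq kC x g (y + g).
rewrite /volterra_h /= addrK => ib.
have [g0|g0] := leP g 0.
  rewrite lt1_le// mul0r normr0 mul0r.
  by apply: mulr_ge0; apply: mulr_ge0 => //; by [exact: qnorm_ge0|exact: decay_ge0].
rewrite lt1_lt// mul1r weightD.
apply: (@le_trans _ _ (lt1 0 y * (C * expR (rate * y)) * qnorm q *
    (weight rate y * weight rate g))).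
  by rewrite ler_wpM2r// mulr_ge0 ?weight_ge0.
rewrite (_ : _ * _ * _ = (qnorm q * weight rate g) *
  (C * (lt1 0 y * (expR (rate * y) * weight rate y)))); last by ring.
apply: ler_pM.
- by rewrite mulr_ge0 ?weight_ge0 ?qnorm_ge0.
- by rewrite !mulr_ge0 ?lt1_ge0 ?expR_ge0 ?weight_ge0.
- rewrite ler_wpM2l ?qnorm_ge0// decayE ?(ltW g0)// ler_expR lerN2.
  by rewrite ler_wpM2r ?(ltW g0)// ler_peMl ?ler1n// ltW.
- rewrite ler_wpM2l// -expRD.
  rewrite (_ : rate * y - _ = - (rate * y)); last by ring.
  exact: lt1_expR_decay.
Qed.

(** For fixed g, [volterra_h] is the density before its delay by g, so the shear lemma pulls out
    e^{- 2 kap g}. A second exchange, of y and t, turns k(t, -) into khat(t). *)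
Lemma khat_volterra kap x : rate <= complex.Re kap ->
  khat (volterra q k) kap x = cint mu (fun g => (lt1 0 g)%:C * lexp kap g *
    cint mu (fun t => (lt1 (x + g) t * q t)%:C * khat k kap t)).
Proof.
move=> rk.
have mmax : measurable_fun setT (fun g : TR => Num.max g 0 : TR) by exact: measurable_maxr.
have max0 (g : TR) : 0 <= (Num.max g 0 : TR) by rewrite le_max lexx orbT.
have h0 g y : y <= 0 -> volterra_h x (g, y) = 0.
  move=> y0; rewrite /volterra_h /=; under eq_Rintegral do rewrite k0// mulr0.
  by rewrite Rintegral_cst// mul0r mulr0.
have ih : (mu \x mu)%E.-integrable setT
    (EFin \o (fun z => `|volterra_h x z| * weight rate (z.2 + Num.max z.1 0))).
  have i1 := integrableZl measurableT (qnorm q) (integrable_decay rate0).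
  apply: (integrable_prod_dominated i1 (idecay C (lexx _))).
    apply: measurable_funM; first exact: measurableT_comp.
    apply: (measurableT_comp (measurable_weight _)).
    by apply: measurable_funD => //; apply: measurable_maxr => //; exact: measurable_cst.
  move=> g y; rewrite [leLHS]ger0_norm ?mulr_ge0 ?weight_ge0//.
have := laplace_shear_integrable (measurable_volterra_h x) mmax max0 h0 ih rk.
rewrite (_ : laplace _ kap = khat (volterra q k) kap x).
  move=> <-; apply: eq_cint => g.
  have [g0|g0] := leP g 0.
    rewrite lt1_le// mul0r mul0r.
    by apply: cint_eq0 => y; rewrite /volterra_h /= lt1_le// !mul0r.
  rewrite lt1_lt// mul1r.
  transitivity (cint mu (fun y => lexp kap g * cint mu (fun t =>
      (lt1 (x + g) t * q t * k (t, y))%:C * lexp kap y))).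
    apply: eq_cint => y.
    rewrite cint_real_scale; last first.
      apply: measurable_funM.
        by apply: measurable_funM => //; exact: measurable_lt1.
      exact: (measurableT_comp mk (pair2_measurable y)).
    by rewrite /volterra_h /= lt1_lt// mul1r lexpD; ring.
  have mF : cmeasurable (fun z : TR * TR =>
      (lt1 (x + g) z.2 * q z.2 * k (z.2, z.1))%:C * lexp kap z.1).
    apply: cmeasurableM; last exact: cmeasurable_lexp.
    apply: cmeasurable_real; apply: measurable_funM.
      by apply: measurable_funM; [exact: measurable_lt1|exact: measurableT_comp].
    by apply: (measurableT_comp mk); exact/measurable_fun_pair.
  have bF y t : nrm1 ((lt1 (x + g) t * q t * k (t, y))%:C * lexp kap y) <=
      2 * C * decay rate y * `|q t|.
    apply: (@le_trans _ _ (nrm1 ((k (t, y))%:C * lexp kap y) * `|q t|)).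
      rewrite (nrm1Mr (_ * _)) (nrm1Mr (k (t, y))) !normrM.
      rewrite [leLHS](_ : _ = `|lt1 (x + g) t| *
        (`|k (t, y)| * nrm1 (lexp kap y) * `|q t|)); last by ring.
      apply: ler_piMl; last exact: normr_lt1.
      by rewrite mulr_ge0// mulr_ge0// nrm1_ge0.
    by rewrite ler_wpM2r// nrm1_khat_integrand.
  have iF : cintegrable (mu \x mu)%E (fun z : TR * TR =>
      (lt1 (x + g) z.2 * q z.2 * k (z.2, z.1))%:C * lexp kap z.1).
    by apply: cintegrable_dominated (integrable_prod (idecay (2 * C) (lexx _)) niq) _ => // -[].
  have := cintZ (lexp kap g) (cintegrable_cint iF); rewrite /= => ->.
  congr (_ * _); rewrite (cint_fubini iF); apply: eq_cint => t /=.
  rewrite /khat /laplace -cintZ; last exact: cintegrable_khat.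
  by apply: eq_cint => y; rewrite rmorphM/= mulrA.
rewrite /khat; congr (laplace _ kap); apply/funext => y; rewrite /volterra /=.
apply: eq_Rintegral => g _.
rewrite /volterra_h /=; have [g0|g0] := leP g 0; first by rewrite lt1_le// !mul0r.
by [].
Qed.

End Bounds.
End KernelLaplace.

(** * The inhomogeneous term and the solution of the Volterra equation *)

Section Source.
Context {R : realType}.
Local Notation mu := (@lebesgue_measure R).
Local Notation TR := (measurableTypeR R).
Variable q : TR -> R.
Hypothesis iq : mu.-integrable setT (EFin \o q).
Variable b : R.
Hypothesis qb : forall x, b <= x -> q x = 0.
Variables sigma a : R.
Local Notation rate := (rate q).

Let mq : measurable_fun setT q.
Proof. by have /measurable_EFinP := measurable_int _ iq. Qed.

Let niq : mu.-integrable setT (EFin \o (fun x => `|q x|)).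
Proof. by have /integrable_norm := iq. Qed.

Let rate0 : 0 < rate. Proof. exact: rate_gt0. Qed.

Let mlt1q y : measurable_fun setT (fun t : TR => lt1 y t * q t).
Proof. by apply: measurable_funM => //; exact: measurable_lt1. Qed.

Let lt1q_le y t : `|lt1 y t * q t| <= `|q t|.
Proof. by rewrite normrM ler_piMl// normr_lt1. Qed.

Definition qtail (y : TR) : R := \int[mu]_t (lt1 y t * q t).

Lemma measurable_qtail : measurable_fun setT qtail.
Proof.
apply: (measurable_Rintegral_param mu (f := fun z : TR * TR => lt1 z.1 z.2 * q z.2)).
by apply: measurable_funM; [exact: measurable_lt1|exact: measurableT_comp].
Qed.

Lemma qtail_le y : `|qtail y| <= qnorm q.
Proof. exact: le_normr_Rintegral_dominated. Qed.

Definition source_bound := `|a| + (1 + `|sigma|) * qnorm q.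

(** The density of the Volterra integral with psi replaced by 1 - sigma e^{- 2 kappa (b - t)}. The
    part 1 contributes with y = g. In the other part the exponents add up to y = g + b - t; at fixed
    y, the condition g > 0 reads t > b - y, whence [qtail (b - y)], and t > x + g reads y < b - x,
    the same window. *)
Definition source (z : TR * TR) : R :=
  lt1 0 z.2 * lt1 z.2 (b - z.1) * (a + qtail (z.1 + z.2) - sigma * qtail (b - z.2)).

Let measurable_window : measurable_fun setT
  (fun z : TR * TR => lt1 0 z.2 * lt1 z.2 (b - z.1)).
Proof.
apply: measurable_funM; first exact: measurable_lt1.
by apply: measurable_lt1 => //; exact: measurable_funB.
Qed.

Lemma kernel_bound_source : kernel_bound q source_bound source.
Proof.
split.
- apply: measurable_funM => //.
  apply: measurable_funB.
    apply: measurable_funD => //; apply: (measurableT_comp measurable_qtail).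
    exact: measurable_funD.
  apply: measurable_funM => //; apply: (measurableT_comp measurable_qtail).
  exact: measurable_funB.
- by move=> x y y0; rewrite /source /= lt1_le// !mul0r.
- move=> x y; rewrite /source /=.
  have s0 : 0 <= source_bound.
    by rewrite addr_ge0// mulr_ge0 ?qnorm_ge0// addr_ge0.
  have [y0|y0] := leP y 0.
    by rewrite lt1_le// !mul0r normr0 mulr_ge0 ?expR_ge0.
  rewrite lt1_lt// mul1r normrM.
  apply: (@le_trans _ _ (1 * source_bound)); last first.
    rewrite mul1r ler_peMr// -expR0 ler_expR.
    by rewrite mulr_ge0 ?(ltW y0)// ltW.
  rewrite ler_pM ?normr_lt1// /source_bound mulrDl mul1r addrA.
  apply: (le_trans (ler_normB _ _)); apply: lerD.
    by apply: (le_trans (ler_normD _ _)); rewrite lerD2l qtail_le.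
  by rewrite normrM ler_wpM2l// qtail_le.
Qed.

Let window x g : R := lt1 0 g * lt1 g (b - x).

Let mwindow x : measurable_fun setT (window x : TR -> R).
Proof. by apply: measurable_funM; exact: measurable_lt1. Qed.

Let window_le x g : 0 <= window x g <= 1.
Proof.
rewrite /window mulr_ge0 ?lt1_ge0//=.
by rewrite -[leRHS]mulr1 ler_pM ?lt1_ge0 ?lt1_le1.
Qed.

(** The substitution of b - y for t turns e^{- 2 kappa (b - t)} into the Laplace kernel at y, so
    that the shear with delay g applies. *)
Let reflected (x : TR) (z : TR * TR) : R :=
  window x z.1 * (lt1 (x + z.1) (b - z.2) * q (b - z.2)).

Let mreflected x : measurable_fun setT (reflected x).
Proof.
apply: measurable_funM; first by apply: (measurableT_comp (mwindow x)).
apply: measurable_funM.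
  by apply: measurable_lt1; [exact: measurable_funD|exact: measurable_funB].
by apply: (measurableT_comp mq); exact: measurable_funB.
Qed.

Let mmax : measurable_fun setT (fun g : TR => Num.max g 0 : TR).
Proof. exact: measurable_maxr. Qed.

Let max0 (g : TR) : 0 <= (Num.max g 0 : TR).
Proof. by rewrite le_max lexx orbT. Qed.

Let reflected0 x g y : y <= 0 -> reflected x (g, y) = 0.
Proof. by move=> y0; rewrite /reflected /= qb ?mulr0// lerBrDr gerDl. Qed.

Let reflected_le x g y : `|reflected x (g, y)| * weight rate (y + Num.max g 0) <=
  decay rate g * `|q (b - y)|.
Proof.
have [g0|g0] := leP g 0.
  by rewrite /reflected /window /= lt1_le// !mul0r normr0 mul0r mulr_ge0// decay_ge0.
have [y0|y0] := leP y 0.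
  by rewrite reflected0// normr0 mul0r mulr_ge0// decay_ge0.
rewrite mulrC ler_pM ?weight_ge0//.
  rewrite decayE ?(ltW g0)// ler_expR lerN2 mulrDr -[leLHS]add0r lerD//.
    by rewrite !mulr_ge0// ltW.
  by rewrite ler_wpM2r ?(ltW g0)// ler_peMl ?ler1n// ltW.
rewrite /reflected normrM /= -[leRHS]mul1r ler_pM//.
by have /andP[w0 w1] := window_le x g; rewrite ger0_norm.
Qed.

Let ireflected x : (mu \x mu)%E.-integrable setT
  (EFin \o (fun z => `|reflected x z| * weight rate (z.2 + Num.max z.1 0))).
Proof.
apply: (integrable_prod_dominated (integrable_decay rate0)
    (integrable_reflect b niq)).
  apply: measurable_funM; first exact: measurableT_comp.
  apply: (measurableT_comp (measurable_weight _)).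
  by apply: measurable_funD => //; apply: measurable_maxr => //; exact: measurable_cst.
by move=> g y; rewrite [leLHS]ger0_norm ?mulr_ge0 ?weight_ge0.
Qed.

(** At fixed y the substitution t = g + b - y turns the integral over g into one of q over t > b -
    y. The values g >= y correspond to t >= b, where q vanishes. *)
Let reflected_tail x y :
  \int[mu]_g reflected x (g, y - Num.max g 0) = window x y * qtail (b - y).
Proof.
rewrite /qtail -(Rintegral_translate (y - b) (mlt1q _)).
rewrite -RintegralZl_measurable; last first.
  apply: (measurableT_comp (mlt1q (b - y))).
  exact: measurable_funB.
apply: eq_Rintegral => g _; rewrite /reflected /window /=.
have [g0|g0] := leP g 0.
  by rewrite (lt1_le g0) !mul0r (lt1_le (x := b - y)) ?mul0r ?mulr0//; lra.
rewrite (lt1_lt g0) (lt1_lt (x := b - y)) ?mul1r; last by lra.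
rewrite (_ : b - (y - g) = g - (y - b)); last by ring.
have [yg|gy] := leP y g; first by rewrite qb ?mulr0//; lra.
rewrite (lt1_lt (lt_trans g0 gy)) mul1r.
have [yx|yx] := ltP y (b - x).
  rewrite !lt1_lt ?mul1r//; last by exact: lt_trans yx.
  by lra.
by rewrite (lt1_le yx) mul0r (lt1_le (x := x + g)) ?mul0r ?mulr0//; lra.
Qed.

Let cmeasurable_lexp_tail kap : cmeasurable (fun t : TR => lexp kap (b - t)).
Proof. by apply: cmeasurable_lexp; exact: measurable_funB. Qed.

Let lexp_tail_le kap t : 0 <= complex.Re kap ->
  nrm1 ((q t)%:C * lexp kap (b - t)) <= 2 * `|q t|.
Proof.
move=> k0; rewrite nrm1Mr mulrC; have [bt|tb] := leP b t.
  by rewrite qb// normr0 !mulr0.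
rewrite ler_wpM2r//; apply: (le_trans (nrm1_lexp _ _)).
rewrite ler_piMr// -expR0 ler_expR oppr_le0 !mulr_ge0//.
by rewrite subr_ge0 ltW.
Qed.

Let ilexp_tail kap y : 0 <= complex.Re kap ->
  cintegrable mu (fun t => (lt1 y t * q t)%:C * lexp kap (b - t)).
Proof.
move=> k0.
apply: (cintegrable_dominated (g := fun t => 2 * `|q t|)).
- by apply: cmeasurableM => //; exact: cmeasurable_real.
- exact: (integrableZl _ _ niq).
- move=> t; apply: le_trans (lexp_tail_le _ k0).
  rewrite (nrm1Mr (_ * _)) (nrm1Mr (q t)) normrM.
  by rewrite ler_wpM2r ?nrm1_ge0// ler_piMl// normr_lt1.
Qed.

Let Re_rate_ge0 kap : rate <= complex.Re kap -> 0 <= complex.Re kap.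
Proof. by apply: le_trans; exact: ltW. Qed.

Let laplace_reflected kap x : rate <= complex.Re kap ->
  laplace (fun y => window x y * qtail (b - y)) kap =
  cint mu (fun g => (window x g)%:C * lexp kap g *
    cint mu (fun t => (lt1 (x + g) t * q t)%:C * lexp kap (b - t))).
Proof.
move=> rk.
have := laplace_shear_integrable (mreflected x) mmax max0 (@reflected0 x) (ireflected x) rk.
rewrite (_ : laplace _ kap = laplace (fun y => window x y * qtail (b - y)) kap); last first.
  by congr (laplace _ kap); apply/funext => y; exact: reflected_tail.
move=> <-; apply: eq_cint => g.
have [g0|g0] := leP g 0.
  rewrite /window (lt1_le g0) !mul0r.
  by apply: cint_eq0 => y; rewrite /reflected /window /= (lt1_le g0) !mul0r.
have iT := ilexp_tail (x + g) (Re_rate_ge0 rk).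
rewrite -cintZ//.
have mT : cmeasurable (fun t : TR => (window x g)%:C * lexp kap g *
    ((lt1 (x + g) t * q t)%:C * lexp kap (b - t))).
  by apply: cmeasurableM; [exact: cmeasurable_cst|exact: iT.1].
rewrite -(cint_reflect b mT); apply: eq_cint => y.
by rewrite /reflected /= lexpD subKr rmorphM /=; ring.
Qed.

Let windowed kap x (G : TR -> R[i]) (g : TR) : R[i] :=
  (window x g)%:C * lexp kap g * G g.

Let iwindowed kap x c (G : TR -> R[i]) : rate <= complex.Re kap ->
  cmeasurable G -> (forall g, nrm1 (G g) <= c) ->
  cintegrable mu (windowed kap x G).
Proof.
move=> rk mG Gc.
apply: (cintegrable_dominated (g := fun g => 2 * c * decay rate g)).
- apply: cmeasurableM => //; apply: cmeasurableM; last exact: cmeasurable_lexp.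
  exact: cmeasurable_real.
- exact: (integrableZl _ _ (integrable_decay rate0)).
- move=> g; rewrite /windowed; apply: (le_trans (nrm1M _ _)).
  rewrite mulrAC ler_pM ?nrm1_ge0//.
  have [g0|g0] := leP g 0.
    by rewrite /window lt1_le// !mul0r nrm1_0 mulr_ge0// decay_ge0.
  rewrite (nrm1Mr (window x g)) decayE ?(ltW g0)//.
  have /andP[w0 w1] := window_le x g; rewrite (ger0_norm w0).
  rewrite -[leRHS]mul1r ler_pM ?nrm1_ge0//.
  apply: (le_trans (nrm1_lexp _ _)); rewrite ler_wpM2l// ler_expR lerN2.
  rewrite ler_wpM2r ?(ltW g0)//; apply: (le_trans rk).
  by rewrite ler_peMl ?ler1n// (Re_rate_ge0 rk).
Qed.

Let cmeasurable_tail (F : TR -> R[i]) x : cmeasurable F ->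
  cmeasurable (fun g : TR => cint mu (fun t => (lt1 (x + g) t * q t)%:C * F t)).
Proof.
move=> mF; apply: (cmeasurable_cint mu
  (f := fun z : TR * TR => (lt1 (x + z.1) z.2 * q z.2)%:C * F z.2)).
apply: cmeasurableM; last exact: (cmeasurable_comp mF).
apply: cmeasurable_real; apply: measurable_funM; last exact: measurableT_comp.
by apply: measurable_lt1 => //; exact: measurable_funD.
Qed.

Lemma cintegrable_tail (F : TR -> R[i]) c y : cmeasurable F ->
  (forall t, t < b -> nrm1 (F t) <= c) ->
  cintegrable mu (fun t => (lt1 y t * q t)%:C * F t).
Proof.
move=> mF Fc; apply: (cintegrable_dominated (g := fun t => c * `|q t|)).
- by apply: cmeasurableM => //; exact: cmeasurable_real.
- exact: (integrableZl _ _ niq).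
- move=> t; rewrite nrm1Mr mulrC; have [bt|tb] := leP b t.
    by rewrite qb// !mulr0 normr0 !mulr0.
  by rewrite ler_pM ?nrm1_ge0 ?Fc.
Qed.

Lemma nrm1_tail (F : TR -> R[i]) c y : cmeasurable F ->
  (forall t, t < b -> nrm1 (F t) <= c) ->
  nrm1 (cint mu (fun t => (lt1 y t * q t)%:C * F t)) <= c * qnorm q.
Proof.
move=> mF Fc; rewrite /qnorm -RintegralZl//.
apply: nrm1_cint_dominated; first exact: (cintegrable_tail y mF Fc).1.
  exact: (integrableZl _ _ niq).
move=> t; rewrite nrm1Mr mulrC; have [bt|tb] := leP b t.
  by rewrite qb// !mulr0 normr0 !mulr0.
by rewrite ler_pM ?nrm1_ge0 ?Fc.
Qed.

Let nrm1_lexp_tail kap t : 0 <= complex.Re kap -> t < b ->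
  nrm1 (lexp kap (b - t)) <= 2.
Proof.
move=> k0 tb; apply: (le_trans (nrm1_lexp _ _)).
rewrite ler_piMr// -expR0 ler_expR oppr_le0 !mulr_ge0//.
by rewrite subr_ge0 ltW.
Qed.

Let khat_source kap x : rate <= complex.Re kap ->
  khat source kap x = cint mu (fun g => (window x g)%:C * lexp kap g *
    (a%:C + cint mu (fun t => (lt1 (x + g) t * q t)%:C *
       (1 - sigma%:C * lexp kap (b - t))))).
Proof.
move=> rk; have k0 := Re_rate_ge0 rk.
pose T g := cint mu (fun t => (lt1 (x + g) t * q t)%:C * lexp kap (b - t)).
have mT : cmeasurable T by exact: cmeasurable_tail.
have iT : cintegrable mu (windowed kap x T).
  apply: (iwindowed _ rk mT (c := 2 * qnorm q)) => g.
  by apply: nrm1_tail => // t tb; exact: nrm1_lexp_tail.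
pose G1 (g : TR) : R[i] := (a + qtail (x + g))%:C.
have iG1 : cintegrable mu (windowed kap x G1).
  apply: (iwindowed (c := `|a| + qnorm q) _ rk).
    apply: cmeasurable_real; apply: measurable_funD => //.
    by apply: (measurableT_comp measurable_qtail); exact: measurable_funD.
  move=> g; rewrite nrm1_real; apply: (le_trans (ler_normD _ _)).
  by rewrite lerD2l qtail_le.
pose G2 (g : TR) : R[i] := (qtail (b - g))%:C.
have iG2 : cintegrable mu (windowed kap x G2).
  apply: (iwindowed (c := qnorm q) _ rk).
    apply: cmeasurable_real; apply: (measurableT_comp measurable_qtail).
    exact: measurable_funB.
  by move=> g; rewrite nrm1_real qtail_le.
transitivity (cint mu (windowed kap x G1) + (- sigma%:C) * cint mu (windowed kap x T)).
  have -> : cint mu (windowed kap x T) = cint mu (windowed kap x G2).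
    rewrite -[LHS](laplace_reflected x rk); apply: eq_cint => y.
    by rewrite /windowed /G2 rmorphM /=; ring.
  rewrite -cintZ// -cintD//; last exact: cintegrableZ.
  apply: eq_cint => y; rewrite /source /windowed /G1 /G2 /window /=.
  by rewrite !(rmorphM, rmorphB, rmorphD) /=; ring.
rewrite -cintZ// -cintD//; last exact: cintegrableZ.
apply: eq_cint => g; rewrite /windowed /G1.
have -> : cint mu (fun t => (lt1 (x + g) t * q t)%:C * (1 - sigma%:C * lexp kap (b - t))) =
    (qtail (x + g))%:C - sigma%:C * T g.
  have i1 : cintegrable mu (fun t => (lt1 (x + g) t * q t)%:C * (1 : R[i])).
    by apply: (@cintegrable_tail _ (nrm1 (1 : R[i]))) => //; exact: cmeasurable_cst.
  have i2 := ilexp_tail (x + g) k0.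
  have i3 := cintegrableZ (- sigma%:C) i2.
  have e1 := cint_real_scale mu (1 : R[i]) (mlt1q (x + g)).
  rewrite mulr1 in e1; rewrite -e1 -mulNr -cintZ// -cintD//.
  by apply: eq_cint => t; ring.
by rewrite rmorphD /=; ring.
Qed.

(** The kernel is chosen before [kap]: the density A of the final representation has to be the same
    for all kappa. *)
Theorem volterra_solution : exists C k, kernel_bound q C k /\
  forall kap x, rate <= complex.Re kap ->
    khat k kap x = cint mu (fun g => (lt1 0 g * lt1 g (b - x))%:C * lexp kap g *
      (a%:C + cint mu (fun t => (lt1 (x + g) t * q t)%:C *
         (1 - sigma%:C * lexp kap (b - t) + khat k kap t)))).
Proof.
have [k kC kE] := volterra_fixpoint iq kernel_bound_source.
exists (2 * source_bound), k; split; first exact: kC.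
move=> kap x rk; have k0 := Re_rate_ge0 rk.
have kV := kernel_bound_volterra iq kC.
have mk := cmeasurable_khat kC kap.
have mS : cmeasurable (fun t : TR => 1 - sigma%:C * lexp kap (b - t)).
  apply: cmeasurableD; first exact: cmeasurable_cst.
  by apply: cmeasurableN; apply: cmeasurableM => //; exact: cmeasurable_cst.
have Sb t : t < b -> nrm1 (1 - sigma%:C * lexp kap (b - t)) <= nrm1 (1 : R[i]) + `|sigma| * 2.
  move=> tb; apply: (le_trans (nrm1D _ _)); rewrite lerD2l nrm1N.
  by rewrite (nrm1Mr sigma) ler_wpM2l// nrm1_lexp_tail.
have kb t : t < b -> nrm1 (khat k kap t) <= 2 * (2 * source_bound) * rate^-1.
  by move=> _; exact: nrm1_khat.
pose T g := cint mu (fun t => (lt1 (x + g) t * q t)%:C * (1 - sigma%:C * lexp kap (b - t))).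
pose V g := cint mu (fun t => (lt1 (x + g) t * q t)%:C * khat k kap t).
have iT : cintegrable mu (windowed kap x (fun g => a%:C + T g)).
  apply: (iwindowed (c := `|a| + (nrm1 (1 : R[i]) + `|sigma| * 2) * qnorm q) _ rk).
    by apply: cmeasurableD; [exact: cmeasurable_cst|exact: cmeasurable_tail].
  move=> g; apply: (le_trans (nrm1D _ _)); rewrite nrm1_real lerD2l.
  exact: nrm1_tail.
have iV : cintegrable mu (windowed kap x V).
  apply: (iwindowed (c := 2 * (2 * source_bound) * rate^-1 * qnorm q) _ rk).
    exact: cmeasurable_tail.
  by move=> g; exact: nrm1_tail.
transitivity (khat source kap x + khat (volterra q k) kap x).
  rewrite /khat /laplace -cintD.
  - by apply: eq_cint => y; rewrite kE rmorphD /= mulrDl.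
  - exact: (cintegrable_khat kernel_bound_source x rk).
  - exact: (cintegrable_khat kV x rk).
rewrite khat_source// (khat_volterra iq kC x rk).
(* The cut-off g < b - x can be inserted: beyond it t > x + g >= b, where q vanishes. *)
have -> : cint mu (fun g => (lt1 0 g)%:C * lexp kap g * cint mu (fun t =>
    (lt1 (x + g) t * q t)%:C * khat k kap t)) = cint mu (windowed kap x V).
  apply: eq_cint => g; rewrite /windowed /window.
  have [gb|bg] := ltP g (b - x); first by rewrite (lt1_lt gb) mulr1.
  rewrite /V cint_eq0 ?mulr0// => t.
  have [xt|tx] := ltP (x + g) t; last by rewrite (lt1_le tx) mul0r mul0r.
  by rewrite qb ?mulr0 ?mul0r//; lra.
rewrite -(cintD iT iV); apply: eq_cint => g; rewrite /windowed /window -mulrDr -addrA.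
congr (_ * (_ + _)); rewrite /T /V -cintD; last 2 first.
- exact: cintegrable_tail mS Sb.
- exact: cintegrable_tail mk kb.
by apply: eq_cint => t; ring.
Qed.

End Source.

(** * Complex-valued derivatives *)

Section ComplexDerivative.
Context {R : realType}.
Implicit Types (f g : R -> R[i]) (x : R) (l : R[i]).

Lemma is_derive_ext (f g : R -> R) x df dg : f =1 g -> df = dg ->
  is_derive x 1 f df -> is_derive x 1 g dg.
Proof. by move=> /funext -> ->. Qed.

Lemma is_derive_affine (m n x : R) : is_derive x 1 (fun y => m * y + n) m.
Proof.
apply: (@is_derive_ext (m \*: id + cst n)%R _ x (m *: 1 + 0)).
- by move=> y.
- by rewrite addr0 /GRing.scale /= mulr1.
Qed.

(** Existence and value of the derivative in one relation, so that the rules of calculus compose;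
    [cderivable] and [cderive] are read off from it. *)
Definition cderiv f x l := is_derive x 1 (fun y => complex.Re (f y)) (complex.Re l) /\
  is_derive x 1 (fun y => complex.Im (f y)) (complex.Im l).

Lemma cderiv_ext f g x l l' : f =1 g -> l = l' -> cderiv f x l -> cderiv g x l'.
Proof. by move=> /funext -> ->. Qed.

Lemma cderiv_cst (z : R[i]) x : cderiv (fun=> z) x 0.
Proof. by split; exact: is_derive_cst. Qed.

Lemma cderivD f g x l l' : cderiv f x l -> cderiv g x l' ->
  cderiv (fun y => f y + g y) x (l + l').
Proof.
move=> [f1 f2] [g1 g2]; split.
  by apply: is_derive_ext (is_deriveD f1 g1) => [y|]; rewrite ReD.
by apply: is_derive_ext (is_deriveD f2 g2) => [y|]; rewrite ImD.
Qed.

Lemma cderivN f x l : cderiv f x l -> cderiv (fun y => - f y) x (- l).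
Proof.
move=> [f1 f2]; split.
  by apply: is_derive_ext (is_deriveN f1) => [y|]; rewrite ReN.
by apply: is_derive_ext (is_deriveN f2) => [y|]; rewrite ImN.
Qed.

Lemma cderivM f g x l l' : cderiv f x l -> cderiv g x l' ->
  cderiv (fun y => f y * g y) x (l * g x + f x * l').
Proof.
move=> [f1 f2] [g1 g2]; split.
  apply: is_derive_ext (is_deriveB (is_deriveM f1 g1) (is_deriveM f2 g2)) => [y|].
    by rewrite ReM.
  by rewrite ReD !ReM /GRing.scale /=; ring.
apply: is_derive_ext (is_deriveD (is_deriveM f1 g2) (is_deriveM f2 g1)) => [y|].
  by rewrite ImM.
by rewrite ImD !ImM /GRing.scale /=; ring.
Qed.

Lemma cderivMl (z : R[i]) f x l : cderiv f x l -> cderiv (fun y => z * f y) x (z * l).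
Proof.
by move=> df; apply: cderiv_ext (cderivM (cderiv_cst z x) df) => //; rewrite mul0r add0r.
Qed.

(** The affine argument covers e^{kappa (b - x)}, e^{- 2 kappa (b - x)} and e^{2 kappa x}, the
    exponentials that occur in the solution. *)
Lemma cderiv_lexp (k : R[i]) (m n x : R) :
  cderiv (fun y => lexp k (m * y + n)) x (- (2 * m%:C * k) * lexp k (m * x + n)).
Proof.
pose r := complex.Re k; pose s := complex.Im k.
have dE : is_derive x 1 (fun y => expR (- (2 * r * (m * y + n))))
    (- (2 * r * m) * expR (- (2 * r * (m * x + n)))).
  have h := is_derive_affine (- (2 * r * m)) (- (2 * r * n)) x.
  apply: is_derive_ext (is_derive1_comp (is_derive_expR _) h) => [y|] /=.
    by congr expR; ring.
  by rewrite mulrC; congr (_ * expR _); ring.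
have dC : is_derive x 1 (fun y => cos (2 * s * (m * y + n)))
    (- sin (2 * s * (m * x + n)) * (2 * s * m)).
  have h := is_derive_affine (2 * s * m) (2 * s * n) x.
  apply: is_derive_ext (is_derive1_comp (is_derive_cos _) h) => [y|] /=.
    by congr cos; ring.
  by congr (- sin _ * _); ring.
have dS : is_derive x 1 (fun y => sin (2 * s * (m * y + n)))
    (cos (2 * s * (m * x + n)) * (2 * s * m)).
  have h := is_derive_affine (2 * s * m) (2 * s * n) x.
  apply: is_derive_ext (is_derive1_comp (is_derive_sin _) h) => [y|] /=.
    by congr sin; ring.
  by congr (cos _ * _); ring.
have kE : k = r +i* s by rewrite /r /s; case: (k).
split.
  apply: is_derive_ext (is_deriveM dE dC) => [y|].
    by rewrite lexpE ReM /= mul0r subr0.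
  by rewrite lexpE kE /GRing.scale /=; ring.
apply: is_derive_ext (is_deriveN (is_deriveM dE dS)) => [y|].
  by rewrite lexpE ImM /= mul0r addr0 mulrN.
by rewrite lexpE kE /GRing.scale /=; ring.
Qed.

Lemma cderiv_cderivable f x l : cderiv f x l -> cderivable f x.
Proof. by move=> [[d1 _] [d2 _]]; split. Qed.

Lemma cderiv_cderive f x l : cderiv f x l -> cderive f x = l.
Proof.
move=> [d1 d2]; rewrite /cderive !derive1E.
have -> : complex.Re \o f = (fun y => complex.Re (f y)) by [].
have -> : complex.Im \o f = (fun y => complex.Im (f y)) by [].
by rewrite (@derive_val _ _ _ _ _ _ _ d1) (@derive_val _ _ _ _ _ _ _ d2); case: l {d1 d2}.
Qed.

Lemma cderivableP f x : cderivable f x -> cderiv f x (cderive f x).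
Proof.
move=> [d1 d2]; rewrite /cderive !derive1E; split => /=.
  exact: (derivableP d1).
exact: (derivableP d2).
Qed.

End ComplexDerivative.

Lemma ReMr (R : realType) (r : R) (z : R[i]) : complex.Re (r%:C * z) = r * complex.Re z.
Proof. by rewrite ReM /= mul0r subr0. Qed.

Lemma ImMr (R : realType) (r : R) (z : R[i]) : complex.Im (r%:C * z) = r * complex.Im z.
Proof. by rewrite ImM /= mul0r addr0. Qed.

Section LexpIntegral.
Context {R : realType}.
Local Notation mu := (@lebesgue_measure R).
Local Notation TR := (measurableTypeR R).

Lemma Rintegral_lt1_FTC (f F : R -> R) (c : R) : 0 <= c -> continuous f ->
  (forall x : R, is_derive x 1 F (f x)) ->
  \int[mu]_g (lt1 0 g * lt1 g c * f g) = F c - F 0.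
Proof.
move=> c0 cf dF.
have E : \int[mu]_g (lt1 0 g * lt1 g c * f g) = \int[mu]_(g in `]0, c[) f g.
  rewrite [RHS]Rintegral_mkcond; apply: eq_Rintegral => g _.
  rewrite patchE; case: ifPn.
    by rewrite inE /= in_itv /= => /andP[h1 h2]; rewrite !lt1_lt// !mul1r.
  rewrite notin_setE /= in_itv /= => /negP; rewrite negb_and -!leNgt => /orP[h|h].
    by rewrite lt1_le// !mul0r.
  by rewrite (lt1_le h) mulr0 mul0r.
rewrite E; move: c0; rewrite le_eqVlt => /orP[/eqP <-|c0].
  by rewrite set_itvoo0 Rintegral_set0 subrr.
have mf : measurable_fun setT f by exact: continuous_measurable_fun.
have mE : measurable_fun setT (EFin \o f) by exact/measurable_EFinP.
rewrite /Rintegral integral_itv_obnd_cbnd; last exact: measurable_funTS.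
rewrite integral_itv_bndo_bndc; last exact: measurable_funTS.
rewrite (@continuous_FTC2 _ f F 0 c c0)//.
- exact: continuous_subspaceT.
- have cF : continuous F.
    by move=> x; apply: differentiable_continuous; apply/derivable1_diffP; case: (dF x).
  split.
  + by move=> x _; case: (dF x).
  + by apply: cvg_at_right_filter; exact: cF.
  + by apply: cvg_at_left_filter; exact: cF.
- by move=> x _; rewrite derive1E; apply: derive_val.
Qed.

Lemma continuous_lexp_Re (k : R[i]) : continuous (fun x : R => complex.Re (lexp k x)).
Proof.
move=> x; have [[h _] _] := cderiv_lexp k 1 0 x.
have -> : (fun x : R => complex.Re (lexp k x)) = (fun y => complex.Re (lexp k (1 * y + 0))).
  by apply/funext => y; rewrite mul1r addr0.
by apply: differentiable_continuous; exact/derivable1_diffP.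
Qed.

Lemma continuous_lexp_Im (k : R[i]) : continuous (fun x : R => complex.Im (lexp k x)).
Proof.
move=> x; have [_ [h _]] := cderiv_lexp k 1 0 x.
have -> : (fun x : R => complex.Im (lexp k x)) = (fun y => complex.Im (lexp k (1 * y + 0))).
  by apply/funext => y; rewrite mul1r addr0.
by apply: differentiable_continuous; exact/derivable1_diffP.
Qed.

Lemma cint_lexp (k : R[i]) (c : R) : 0 <= c -> k != 0 ->
  cint mu (fun g : TR => (lt1 0 g * lt1 g c)%:C * lexp k g) = (1 - lexp k c) / (2 * k).
Proof.
move=> c0 k0; pose z := - (2 * k)^-1.
have k2 : 2 * k != 0 by rewrite mulf_neq0// pnatr_eq0.
have dF x : cderiv (fun y => z * lexp k (1 * y + 0)) x (lexp k x).
  apply: cderiv_ext (cderivMl z (cderiv_lexp k 1 0 x)) => //.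
  by rewrite mul1r addr0 /z; field.
have -> : (1 - lexp k c) / (2 * k) = z * lexp k (1 * c + 0) - z * lexp k (1 * 0 + 0).
  by rewrite mul1r mulr0 !addr0 lexp0 /z; field.
apply: complex_eqP; [rewrite ReD ReN|rewrite ImD ImN].
  rewrite -(Rintegral_lt1_FTC c0 (@continuous_lexp_Re k) (fun x => (dF x).1)).
  by apply: eq_Rintegral => g _; rewrite ReMr.
rewrite -(Rintegral_lt1_FTC c0 (@continuous_lexp_Im k) (fun x => (dF x).2)).
by apply: eq_Rintegral => g _; rewrite ImMr.
Qed.

End LexpIntegral.

(** * Expansion of the m-function *)

Section LaplaceDensity.
Context {R : realType}.
Local Notation mu := (@lebesgue_measure R).
Local Notation TR := (measurableTypeR R).

Lemma is_laplace_density K (f : TR -> R) : 0 <= K ->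
  mu.-integrable setT (EFin \o f) -> (forall x, x <= 0 -> f x = 0) ->
  is_laplace K (laplace f) (\int[mu]_x `|f x|).
Proof.
move=> K0 intf f0; have /measurable_EFinP mf := measurable_int _ intf.
exists f; split => //.
have inf : mu.-integrable setT (EFin \o (fun x => `|f x|)).
  by have /integrable_norm := intf.
rewrite /Rintegral fineK; last exact: (integrable_fin_num measurableT inf).
apply: ge0_le_integral => //.
- by move=> x _; exact: norm_weight_ge0.
- exact: measurable_norm_weight.
- by have := measurable_int _ inf.
- move=> x _; rewrite lee_fin; have [/f0->|x0] := leP x 0.
    by rewrite normr0 mul0r.
  rewrite ler_piMr// -expR0 ler_expR oppr_le0 !mulr_ge0//.
  exact: ltW.
Qed.

End LaplaceDensity.

Section AtZero.
Context {R : realType}.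
Local Notation mu := (@lebesgue_measure R).
Local Notation TR := (measurableTypeR R).
Variable q : TR -> R.
Hypothesis iq : mu.-integrable setT (EFin \o q).
Variable b : R.
Hypothesis b0 : 0 < b.
Hypothesis q0 : forall x, x <= 0 -> q x = 0.
Hypothesis qb : forall x, b <= x -> q x = 0.
Variables (sigma a C : R) (k : TR * TR -> R).
Hypothesis kC : kernel_bound q C k.
Local Notation rate := (rate q).

(** The function psi; [tail] below is the integral of q psi over (y, b). *)
Definition psol (kap : R[i]) (x : TR) : R[i] :=
  1 - sigma%:C * lexp kap (b - x) + khat k kap x.

Definition tail (kap : R[i]) (y : TR) : R[i] :=
  cint mu (fun t => (lt1 y t * q t)%:C * psol kap t).

Hypothesis kE : forall kap x, rate <= complex.Re kap ->
  khat k kap x = cint mu (fun g => (lt1 0 g * lt1 g (b - x))%:C * lexp kap g *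
    (a%:C + tail kap (x + g))).

Let mq : measurable_fun setT q.
Proof. by have /measurable_EFinP := measurable_int _ iq. Qed.

Let niq : mu.-integrable setT (EFin \o (fun x => `|q x|)).
Proof. by have /integrable_norm := iq. Qed.

Let rate0 : 0 < rate. Proof. exact: rate_gt0. Qed.

Let mk : measurable_fun setT k. Proof. by case: kC. Qed.

Let C0 : 0 <= C.
Proof.
case: kC => _ _ /(_ 0 0); rewrite mulr0 expR0 mulr1; exact: le_trans.
Qed.

Lemma cmeasurable_psol kap : cmeasurable (psol kap).
Proof.
apply: cmeasurableD; last exact: (cmeasurable_khat kC).
apply: cmeasurableD; first exact: cmeasurable_cst.
apply: cmeasurableN; apply: cmeasurableM; first exact: cmeasurable_cst.
by apply: cmeasurable_lexp; exact: measurable_funB.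
Qed.

Let nrm1_lexp_ge0 kap t : rate <= complex.Re kap -> 0 <= t -> nrm1 (lexp kap t) <= 2.
Proof.
move=> rk t0; apply: (le_trans (nrm1_lexp _ _)).
rewrite ler_piMr// -expR0 ler_expR oppr_le0 !mulr_ge0//.
by apply: le_trans rk; exact: ltW.
Qed.

Definition psol_bound : R := 1 + `|sigma| * 2 + 2 * C * rate^-1.

Lemma nrm1_psol kap t : rate <= complex.Re kap -> t < b ->
  nrm1 (psol kap t) <= psol_bound.
Proof.
move=> rk tb; apply: (le_trans (nrm1D _ _)); apply: lerD; last exact: nrm1_khat.
apply: (le_trans (nrm1D _ _)); rewrite nrm1N (nrm1_real 1) normr1 lerD2l.
rewrite (nrm1Mr sigma) ler_wpM2l//; apply: nrm1_lexp_ge0 => //.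
by rewrite subr_ge0 ltW.
Qed.

Lemma Re_rate_neq0 kap : rate <= complex.Re kap -> kap != 0.
Proof.
move=> rk; apply/eqP => k0; move: rk; rewrite k0 /= leNgt rate0.
by [].
Qed.

(* Integration by parts of the Volterra equation at [x = 0]. *)
Lemma khat_zero kap : rate <= complex.Re kap ->
  2 * kap * khat k kap 0 = a%:C + tail kap 0 - a%:C * lexp kap b -
    cint mu (fun t => (lt1 0 t * q t)%:C * (lexp kap t * psol kap t)).
Proof.
move=> rk; have k0 := Re_rate_neq0 rk.
have k2 : 2 * kap != 0 by rewrite mulf_neq0// pnatr_eq0.
have mp := cmeasurable_psol kap.
pose W (g : TR) : R[i] := (lt1 0 g * lt1 g b)%:C * lexp kap g.
have mW : cmeasurable W.
  apply: cmeasurableM; last exact: cmeasurable_lexp.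
  by apply: cmeasurable_real; apply: measurable_funM; exact: measurable_lt1.
have Wb g : nrm1 (W g) <= 2 * decay rate g.
  rewrite /W (nrm1Mr (_ * _)); have [g0|g0] := leP g 0.
    by rewrite lt1_le// mul0r normr0 mul0r mulr_ge0// decay_ge0.
  rewrite (lt1_lt g0) mul1r -[leRHS]mul1r ler_pM ?nrm1_ge0 ?normr_lt1//.
  apply: (le_trans (nrm1_lexp _ _)); rewrite ler_wpM2l// decayE ?(ltW g0)//.
  rewrite ler_expR lerN2 ler_wpM2r ?(ltW g0)//; apply: (le_trans rk).
  by rewrite ler_peMl ?ler1n// (le_trans _ rk)// ltW.
have id2 := integrableZl measurableT 2 (integrable_decay rate0).
have iW : cintegrable mu W by apply: cintegrable_dominated id2 _.
have WE : cint mu W = (1 - lexp kap b) / (2 * kap) by rewrite -cint_lexp// ltW.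
pose F (z : TR * TR) : R[i] := W z.1 * ((lt1 z.1 z.2 * q z.2)%:C * psol kap z.2).
have mF : cmeasurable F.
  apply: cmeasurableM; first exact: (cmeasurable_comp mW).
  apply: cmeasurableM; last exact: (cmeasurable_comp mp).
  apply: cmeasurable_real; apply: measurable_funM; first exact: measurable_lt1.
  exact: measurableT_comp.
have Fb g t : nrm1 (F (g, t)) <= 2 * decay rate g * (psol_bound * `|q t|).
  apply: (le_trans (nrm1M _ _)); rewrite ler_pM ?nrm1_ge0//= (nrm1Mr (_ * _)).
  have [bt|tb] := leP b t; first by rewrite qb// mulr0 normr0 mul0r mulr0.
  rewrite mulrC ler_pM ?nrm1_ge0 ?nrm1_psol//.
  by rewrite normrM ler_piMl// normr_lt1.
have iF : cintegrable (mu \x mu)%E F.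
  apply: cintegrable_dominated (integrable_prod id2 (integrableZl measurableT psol_bound niq)) _ => //.
  by move=> [g t]; exact: Fb.
have khE : khat k kap 0 = a%:C * cint mu W + cint mu (fun g => cint mu (fun t => F (g, t))).
  rewrite kE// -cintZ// -cintD; last exact: cintegrable_cint iF.
    apply: eq_cint => g; rewrite /F /= cintZ.
      by rewrite /W /tail add0r subr0; ring.
    exact: (cintegrable_tail iq qb g mp (@nrm1_psol _^~ rk)).
  exact: cintegrableZ.
rewrite khE (cint_fubini iF) mulrDr (mulrCA _ a%:C) WE.
have -> : 2 * kap * ((1 - lexp kap b) / (2 * kap)) = 1 - lexp kap b by field.
have i1 : cintegrable mu (fun t => (lt1 0 t * q t)%:C * psol kap t).
  exact: (cintegrable_tail iq qb 0 mp (@nrm1_psol _^~ rk)).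
have i2 : cintegrable mu (fun t => (lt1 0 t * q t)%:C * (lexp kap t * psol kap t)).
  apply: (cintegrable_dominated (g := fun t => 2 * psol_bound * `|q t|)).
  - apply: cmeasurableM; last by apply: cmeasurableM => //; exact: cmeasurable_lexp.
    by apply: cmeasurable_real; apply: measurable_funM => //; exact: measurable_lt1.
  - exact: (integrableZl _ _ niq).
  - move=> t; rewrite (nrm1Mr (_ * _)); have [t0|t0] := leP t 0.
      by rewrite q0// mulr0 normr0 mul0r mulr0.
    have [bt|tb] := leP b t; first by rewrite qb// mulr0 normr0 mul0r mulr0.
    rewrite (lt1_lt t0) mul1r mulrC ler_wpM2r//.
    apply: (le_trans (nrm1M _ _)); rewrite ler_pM ?nrm1_ge0 ?nrm1_psol//.
    by apply: nrm1_lexp_ge0 => //; exact: ltW.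
(* With the order exchanged, the inner integral of e^{- 2 kap g} over 0 < g < t is (1 - e^{- 2 kap
   t}) / (2 kap). Fubini thus takes the place of integration by parts and produces the factor that
   cancels 2 kap. *)
have -> : cint mu (fun t => cint mu (fun g => F (g, t))) = (2 * kap)^-1 *
    (tail kap 0 - cint mu (fun t => (lt1 0 t * q t)%:C * (lexp kap t * psol kap t))).
  rewrite /tail -mulN1r -cintZ// -cintD//; last exact: cintegrableZ.
  rewrite -cintZ; last by apply: cintegrableD => //; exact: cintegrableZ.
  apply: eq_cint => t; have [t0|t0] := leP t 0.
    rewrite cint_eq0; last by move=> g; rewrite /F /= q0// !(mulr0, mul0r).
    by rewrite q0// !(mulr0, mul0r, addr0).
  have [bt|tb] := leP b t.
    rewrite cint_eq0; last by move=> g; rewrite /F /= qb// !(mulr0, mul0r).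
    by rewrite qb// !(mulr0, mul0r, addr0).
  transitivity (cint mu (fun g => (q t)%:C * psol kap t *
      ((lt1 0 g * lt1 g t)%:C * lexp kap g))).
    apply: eq_cint => g; rewrite /F /W /=; have [gt|tg] := ltP g t.
      by rewrite (lt1_lt gt) (lt1_lt (lt_trans gt tb)) !mulr1 mul1r; ring.
    by rewrite (lt1_le tg) !(mulr0, mul0r).
  rewrite cintZ; last first.
    apply: cintegrable_dominated id2 _.
      apply: cmeasurableM; last exact: cmeasurable_lexp.
      by apply: cmeasurable_real; apply: measurable_funM; exact: measurable_lt1.
    move=> g; apply: le_trans (Wb g); rewrite /W.
    have [gt|tg] := ltP g t; first by rewrite (lt1_lt gt) (lt1_lt (lt_trans gt tb)).
    by rewrite (lt1_le tg) mulr0 mul0r nrm1_0 nrm1_ge0.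
  rewrite cint_lexp ?(ltW t0)// (lt1_lt t0) mul1r.
  by field.
by rewrite mulrA divff// mul1r; ring.
Qed.

Let mlt1q : measurable_fun setT (fun t : TR => lt1 0 t * q t).
Proof. by apply: measurable_funM => //; exact: measurable_lt1. Qed.

Let lt1q_le t : `|lt1 0 t * q t| <= `|q t|.
Proof. by rewrite normrM ler_piMl// normr_lt1. Qed.

Let ilt1q : mu.-integrable setT (EFin \o (fun t : TR => lt1 0 t * q t)).
Proof. exact: integrable_dominated niq lt1q_le. Qed.

(** The three summands 1, - sigma e^{- 2 kappa (b - t)} and khat of psi, integrated against q and
    against q e^{- 2 kappa t}, give the four transforms defined here and two multiples of the
    integral of q. *)
Definition direct kap : R[i] := cint mu (fun t => (lt1 0 t * q t)%:C * lexp kap t).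

Definition reflected kap : R[i] :=
  cint mu (fun t => (lt1 0 t * q t)%:C * lexp kap (b - t)).

Definition mixed kap : R[i] := cint mu (fun t => (lt1 0 t * q t)%:C * khat k kap t).

Definition mixed_delayed kap : R[i] :=
  cint mu (fun t => (lt1 0 t * q t)%:C * (lexp kap t * khat k kap t)).

Lemma is_laplace_direct : exists c, is_laplace rate direct c.
Proof.
eexists; apply: (is_laplace_density (ltW rate0) ilt1q).
by move=> x x0; rewrite lt1_le// mul0r.
Qed.

Lemma is_laplace_reflected : exists c, is_laplace rate reflected c.
Proof.
eexists; apply: (eq_is_laplace (F := laplace (fun y => lt1 0 (b - y) * q (b - y)))).
  move=> kap _; rewrite /reflected -(cint_reflect b).
    by apply: eq_cint => y; rewrite subKr.
  apply: cmeasurableM; first exact: cmeasurable_real.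
  by apply: cmeasurable_lexp; exact: measurable_funB.
apply: (is_laplace_density (ltW rate0) (integrable_reflect b ilt1q)).
by move=> x x0; rewrite qb ?mulr0// lerBrDr gerDl.
Qed.

Let h (z : TR * TR) : R := lt1 0 z.1 * q z.1 * k z.

Let mh : measurable_fun setT h.
Proof. by apply: measurable_funM => //; exact: (measurableT_comp mlt1q). Qed.

Let h0 t y : y <= 0 -> h (t, y) = 0.
Proof. by move=> y0; case: kC => _ k0 _; rewrite /h k0// mulr0. Qed.

Let ih (tau : TR -> TR) : measurable_fun setT tau -> (forall t, 0 <= tau t) ->
  (mu \x mu)%E.-integrable setT
    (EFin \o (fun z => `|h z| * weight rate (z.2 + tau z.1))).
Proof.
move=> mt t0.
apply: (integrable_prod_dominated niq (integrableZl measurableT C (integrable_decay rate0))).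
  apply: measurable_funM; first exact: measurableT_comp.
  apply: (measurableT_comp (measurable_weight _)).
  by apply: measurable_funD => //; exact: measurableT_comp.
move=> t y; rewrite [leLHS]ger0_norm ?mulr_ge0 ?weight_ge0//= /h normrM -mulrA /=.
rewrite ler_pM ?mulr_ge0 ?weight_ge0//; apply: le_trans (kernel_weight_decay kC t y (lexx _)).
rewrite ler_wpM2l// weightD ler_piMr ?weight_ge0// -expR0 ler_expR oppr_le0.
by rewrite !mulr_ge0// ltW.
Qed.

Lemma is_laplace_mixed : exists c, is_laplace rate mixed c.
Proof.
have mt : measurable_fun setT (fun _ : TR => (0 : R) : TR) by exact: measurable_cst.
apply: (is_laplace_shear_integrable mh mt _ h0 (ih mt _)) => // kap rk.
apply: eq_cint => t; rewrite /khat /laplace -cintZ; last exact: (cintegrable_khat kC).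
by apply: eq_cint => y; rewrite /h addr0 !rmorphM /=; ring.
Qed.

Lemma is_laplace_mixed_delayed : exists c, is_laplace rate mixed_delayed c.
Proof.
have mt : measurable_fun setT (fun t : TR => Num.max t 0 : TR) by exact: measurable_maxr.
have t0 (t : TR) : 0 <= (Num.max t 0 : TR) by rewrite le_max lexx orbT.
apply: (is_laplace_shear_integrable mh mt t0 h0 (ih mt t0)) => // kap rk.
apply: eq_cint => t; have [tle|tgt] := leP t 0.
  rewrite q0// mulr0 mul0r cint_eq0// => y.
  by rewrite /h /= q0// !(mulr0, mul0r).
rewrite /khat /laplace mulrA -cintZ; last exact: (cintegrable_khat kC).
by apply: eq_cint => y; rewrite /h /= lexpD !rmorphM /=; ring.
Qed.

Let intq : R := \int[mu]_t (lt1 0 t * q t).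

Let il1 kap : rate <= complex.Re kap ->
  cintegrable mu (fun t => (lt1 0 t * q t)%:C * lexp kap (b - t)).
Proof.
move=> rk; apply: (cintegrable_tail iq qb (c := 2)).
  by apply: cmeasurable_lexp; exact: measurable_funB.
by move=> t tb; apply: nrm1_lexp_ge0 => //; rewrite subr_ge0 ltW.
Qed.

Let il2 kap : rate <= complex.Re kap ->
  cintegrable mu (fun t => (lt1 0 t * q t)%:C * khat k kap t).
Proof.
move=> rk; apply: (cintegrable_tail iq qb (c := 2 * C * rate^-1)).
  exact: (cmeasurable_khat kC).
by move=> t _; exact: nrm1_khat.
Qed.

Let bounded_delay (F : TR -> R[i]) kap :
  rate <= complex.Re kap -> cintegrable mu (fun t => (lt1 0 t * q t)%:C * F t) ->
  cmeasurable F ->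
  cintegrable mu (fun t => (lt1 0 t * q t)%:C * (lexp kap t * F t)).
Proof.
move=> rk iF mF; apply: (@cintegrable_dominated _ TR R mu _
  (fun t : TR => 2 * nrm1 ((lt1 0 t * q t)%:C * F t))).
- apply: cmeasurableM; first exact: cmeasurable_real.
  by apply: cmeasurableM => //; exact: cmeasurable_lexp.
- exact: (integrableZl _ _ iF.2).
- move=> t; rewrite !(nrm1Mr (_ * _)); have [t0|t0] := leP t 0.
    by rewrite lt1_le// mul0r normr0 !mul0r mulr0.
  rewrite mulrCA ler_wpM2l//; apply: (le_trans (nrm1M _ _)).
  by rewrite ler_wpM2r ?nrm1_ge0// nrm1_lexp_ge0// ltW.
Qed.

Lemma tail_zero kap : rate <= complex.Re kap ->
  tail kap 0 = intq%:C - sigma%:C * reflected kap + mixed kap.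
Proof.
move=> rk; have i1 := il1 rk; have i2 := il2 rk.
have e1 := cint_real_scale mu (1 : R[i]) mlt1q; rewrite mulr1 in e1.
have i0 : cintegrable mu (fun t => (lt1 0 t * q t)%:C * (1 : R[i])).
  exact: (cintegrable_tail iq qb _ (cmeasurable_cst _) (c := nrm1 (1 : R[i])) (fun _ _ => lexx _)).
have i1' := cintegrableZ (- sigma%:C) i1.
rewrite -/intq in e1; rewrite -e1 -mulNr -cintZ// -cintD// -cintD//; last exact: cintegrableD.
by apply: eq_cint => t; rewrite /psol; ring.
Qed.

(** The exponentials of t and of b - t multiply to e^{- 2 kap b}, independent of t. This term is a
    point mass rather than a density, and it enters the coefficients B_n. *)
Lemma delayed_zero kap : rate <= complex.Re kap ->
  cint mu (fun t => (lt1 0 t * q t)%:C * (lexp kap t * psol kap t)) =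
  direct kap - sigma%:C * lexp kap b * intq%:C + mixed_delayed kap.
Proof.
move=> rk; have i2 := bounded_delay rk (il2 rk) (cmeasurable_khat kC kap).
have e1 := cint_real_scale mu (- (sigma%:C * lexp kap b)) mlt1q.
have i0 : cintegrable mu (fun t => (lt1 0 t * q t)%:C * - (sigma%:C * lexp kap b)).
  exact: (cintegrable_tail iq qb _ (cmeasurable_cst _) (c := nrm1 (- (sigma%:C * lexp kap b))) (fun _ _ => lexx _)).
have i1 : cintegrable mu (fun t => (lt1 0 t * q t)%:C * lexp kap t).
  have i1 : cintegrable mu (fun t => (lt1 0 t * q t)%:C * (1 : R[i])).
    exact: (cintegrable_tail iq qb _ (cmeasurable_cst _) (c := nrm1 (1 : R[i])) (fun _ _ => lexx _)).
  have := bounded_delay rk i1 (cmeasurable_cst _); congr cintegrable.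
  by apply/funext => t; rewrite mulr1.
rewrite -mulNr [X in _ + X + _]mulrC -[in RHS]/intq -e1 /direct -cintD//.
rewrite -cintD//; last exact: cintegrableD.
apply: eq_cint => t; rewrite /psol.
have -> : lexp kap b = lexp kap t * lexp kap (b - t) by rewrite -lexpD addrC subrK.
by ring.
Qed.

(** With P = khat(0) and D = 1 - eps, psi(0) factors as D (1 + P / D), and both factors are inverted
    by geometric series. Every 2 kap P that arises is replaced by means of [khat_zero], so that kap
    survives only in the first two terms. *)
Lemma m_expansion : `|sigma| <= 1 -> exists K F c cB,
  [/\ rate <= K, is_laplace K F c & forall kap, K <= complex.Re kap ->
    [/\ psol kap 0 != 0, complex.Re `|sigma%:C * lexp kap b| < 1 &
      kap - (2 * kap + a%:C + tail kap 0) / psol kap 0 =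
      - kap - 2 * kap * (sigma%:C * lexp kap b) / (1 - sigma%:C * lexp kap b)
      - cB%:C * lexp kap b / (1 - sigma%:C * lexp kap b) ^+ 2 - F kap]].
Proof.
move=> s1.
(* The term 2 / b gives 2 K b >= 4, hence e^{- 2 K b} <= 1/4 by e^t >= 1 + t; the term 16 C makes
   the norm C / K of khat(0) at most 1/16. *)
pose K := rate + 2 / b + 16 * C + 1.
have b2 : 0 <= 2 / b by rewrite divr_ge0// ltW.
have C16 : 0 <= 16 * C by rewrite mulr_ge0.
have rK : rate <= K by rewrite /K; lra.
have K0 : 0 < K by exact: lt_le_trans rK.
have KC : C * K^-1 <= 16^-1.
  rewrite ler_pdivrMr// ler_pdivlMl// /K.
  by have := ltW rate0; lra.
pose th : R := 4^-1.
have th0 : 0 <= th by rewrite invr_ge0.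
have th1 : th < 1 by rewrite invf_lt1// ltr1n.
have wK : weight K b <= th.
  have K4 : 4 <= 2 * K * b.
    have -> : (4 : R) = 2 * (2 / b) * b by field; rewrite gt_eqF.
    rewrite ler_wpM2r ?(ltW b0)// ler_wpM2l// /K.
    by have := ltW rate0; lra.
  rewrite /weight expRN lef_pV2 ?posrE ?expR_gt0//.
  apply: le_trans (expR_ge1Dx _).
  by lra.
pose eps kap : R[i] := sigma%:C * lexp kap b.
(* Multiplication by [eps] is a delay by b times sigma, so it contracts by the weight at b because
   |sigma| <= 1. *)
have hS F c : is_laplace K F c -> is_laplace K (fun kap => eps kap * F kap) (th * c).
  move=> Fc; have c0 := is_laplace_ge0 Fc.
  have := is_laplaceZ sigma (is_laplace_delay (ltW b0) Fc).
  move/(is_laplace_le (c' := th * c)) => le_th.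
  apply: (eq_is_laplace (F := fun kap => sigma%:C * (lexp kap b * F kap))).
    by move=> kap _; rewrite /eps mulrA.
  apply: le_th; rewrite mulrA ler_wpM2r// -[leRHS]mul1r ler_pM ?weight_ge0//.
have hE F : (exists c, is_laplace K F c) ->
    exists c, is_laplace K (fun kap => F kap / (1 - eps kap)) c.
  by move=> [c Fc]; exists (c / (1 - th)); apply: is_laplace_geometric.
have hD F G : (exists c, is_laplace K F c) -> (exists c, is_laplace K G c) ->
    exists c, is_laplace K (fun kap => F kap + G kap) c.
  by move=> [c Fc] [c' Gc]; exists (c + c'); exact: is_laplaceD.
have hZ r F : (exists c, is_laplace K F c) ->
    exists c, is_laplace K (fun kap => r%:C * F kap) c.
  by move=> [c Fc]; exists (`|r| * c); exact: is_laplaceZ.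
have heps F : (exists c, is_laplace K F c) ->
    exists c, is_laplace K (fun kap => lexp kap b * F kap) c.
  by move=> [c Fc]; exists (weight K b * c); apply: is_laplace_delay => //; exact: ltW.
have hrK F : (exists c, is_laplace rate F c) -> exists c, is_laplace K F c.
  by move=> [c Fc]; exists c; exact: is_laplaceS Fc.
pose g kap := direct kap + mixed_delayed kap.
have lg : exists c, is_laplace K g c.
  by apply: hD; apply: hrK; [exact: is_laplace_direct|exact: is_laplace_mixed_delayed].
pose hh kap := (- sigma)%:C * reflected kap + mixed kap.
have lh : exists c, is_laplace K hh c.
  apply: hD; last by apply: hrK; exact: is_laplace_mixed.
  by apply: hZ; apply: hrK; exact: is_laplace_reflected.
pose P kap := khat k kap 0.
have lP : is_laplace K P (C * K^-1) by exact: (is_laplace_khat kC).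
pose EP kap := P kap / (1 - eps kap).
have lEP : is_laplace K EP (C * K^-1 / (1 - th)) by exact: is_laplace_geometric lP.
(* 1/12 is 1/16 divided by 1 - 1/4. Pointwise this gives at most 2/12, so 1 + EP does not vanish. *)
have lEP12 : is_laplace K EP (12^-1).
  apply: is_laplace_le lEP; rewrite ler_pdivrMr ?subr_gt0//.
  by apply: (le_trans KC); rewrite /th; lra.
have t0 : 0 <= 12^-1 :> R by rewrite invr_ge0.
have t1 : 12^-1 < 1 :> R by rewrite invf_lt1// ltr1n.
have hR F : (exists c, is_laplace K F c) ->
    exists c, is_laplace K (fun kap => F kap / (1 - (- EP kap))) c.
  move=> [c Fc]; exists (c / (1 - 12^-1)); apply: is_laplace_geometric => // G c' Gc.
  have := is_laplaceZ (-1) (is_laplaceM lEP12 Gc); rewrite normrN1 mul1r.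
  by apply: eq_is_laplace => kap _; rewrite rmorphN1 mulN1r mulNr.
(* The first bracket stems from the numerator, the second from inserting 2 kap P a second time; the
   terms of second order in e^{- 2 kap b} cancel. *)
pose cB := (a - sigma * intq) - sigma * (a + intq).
pose E kap := (1 - eps kap)^-1.
pose Y kap := g kap / (1 - eps kap)
  + (- sigma)%:C * (lexp kap b * (((hh kap + (-1)%:C * g kap) / (1 - eps kap)) / (1 - eps kap)))
  + (- cB)%:C * (lexp kap b * (((P kap / (1 - eps kap)) / (1 - eps kap)) / (1 - eps kap))).
have lY : exists c, is_laplace K Y c.
  apply: (hD); first (apply: (hD); first exact: hE).
    by apply/hZ/heps/hE/hE/hD => //; exact: hZ.
  by apply/hZ/heps/hE/hE/hE; exists (C * K^-1).
have [c lR] := hR _ lY.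
exists K, (fun kap => Y kap / (1 - (- EP kap))), c, cB; split => // kap Kk.
have rk : rate <= complex.Re kap by exact: le_trans Kk.
have k0 := Re_rate_neq0 rk.
have k2 : 2 * kap != 0 by rewrite mulf_neq0// pnatr_eq0.
have epsn : complex.Re `|eps kap| < 1.
  apply: (le_lt_trans (norm_nrm1 _)); rewrite /eps (nrm1Mr sigma).
  apply: (@le_lt_trans _ _ (1 * (2 * th))); last by rewrite /th; lra.
  rewrite ler_pM ?nrm1_ge0//; apply: (le_trans (nrm1_lexp _ _)).
  rewrite ler_wpM2l//; apply: le_trans wK.
  rewrite ler_expR lerN2 ler_wpM2r ?(ltW b0)//.
  by rewrite ler_wpM2l.
have neq1 (z : R[i]) : nrm1 z < 1 -> 1 - z != 0.
  move=> z1; apply/eqP => /eqP; rewrite subr_eq0 => /eqP zE.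
  by move: z1; rewrite -zE nrm1_real normr1 ltxx.
have e1 : 1 - eps kap != 0.
  apply/eqP => /eqP; rewrite subr_eq0 => /eqP zE.
  by move: epsn; rewrite -zE normr1 /= ltxx.
have EP1 : 1 - (- EP kap) != 0.
  apply: neq1; rewrite nrm1N; apply: (le_lt_trans (is_laplace_bound lEP12 Kk)).
  by lra.
have DE : psol kap 0 = (1 - eps kap) * (1 - (- EP kap)).
  rewrite /psol subr0 -/(P kap) -/(eps kap) /EP opprK mulrDr mulr1.
  by rewrite [X in _ = _ + X]mulrC divfK.
have D0 : psol kap 0 != 0 by rewrite DE mulf_neq0.
split => //.
have hP : 2 * kap * P kap = a%:C + intq%:C + hh kap - a%:C * lexp kap b
    + sigma%:C * lexp kap b * intq%:C - g kap.
  rewrite /P khat_zero// tail_zero// delayed_zero// /hh /g rmorphN /=; ring.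
have tE : tail kap 0 = intq%:C + hh kap.
  by rewrite tail_zero// /hh rmorphN /=; ring.
have YE : Y kap = g kap / (1 - eps kap)
    - sigma%:C * lexp kap b * (hh kap - g kap) / (1 - eps kap) ^+ 2
    - cB%:C * lexp kap b * P kap / (1 - eps kap) ^+ 3.
  rewrite /Y !rmorphN rmorph1 /=; field; exact: e1.
rewrite -/(eps kap) tE DE.
have EPE : EP kap = P kap / (1 - eps kap) by [].
have PE : P kap = EP kap * (1 - eps kap) by rewrite EPE divfK.
(* Eliminating [hh] through [hP], and [P] through [EP], leaves a rational identity in kap, EP, g and
   e^{- 2 kap b}. *)
have gE : hh kap = 2 * kap * P kap - (a%:C + intq%:C - a%:C * lexp kap b
    + sigma%:C * lexp kap b * intq%:C - g kap) by rewrite hP; ring.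
have cBE : cB%:C = a%:C - sigma%:C * intq%:C - sigma%:C * (a%:C + intq%:C) :> R[i].
  by rewrite /cB !(rmorphB, rmorphM, rmorphD).
rewrite YE gE cBE PE /eps; move: (EP kap) (g kap) EP1 e1; rewrite /eps => x y.
move: (lexp kap b) => l h1 h2.
field; apply/andP; split => //.
Qed.

End AtZero.

(** * Absolute continuity *)

Section AbsoluteContinuity.
Context {R : realType}.
Local Notation mu := (@lebesgue_measure R).
Implicit Types (f g : R -> R) (c d : R).

Definition real_ac c d f := forall e : R, 0 < e -> exists2 delta : R, 0 < delta &
  forall (n : nat) (s t : 'I_n -> R),
    (forall i, c <= s i /\ s i <= t i /\ t i <= d) ->
    (forall i j, i != j -> t i <= s j \/ t j <= s i) ->
    \sum_(i < n) (t i - s i) < delta ->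
    \sum_(i < n) `|f (t i) - f (s i)| < e.

Lemma real_ac_le c d (F f : R -> R) (M : R) : 0 <= M ->
  (forall x y, c <= x -> x <= y -> y <= d -> `|f y - f x| <= M * `|F y - F x|) ->
  real_ac c d F -> real_ac c d f.
Proof.
move=> M0 fF aF e e0.
have M1 : 0 < M + 1 by rewrite ltr_wpDl.
have [|delta d0 dP] := aF (e / (M + 1)); first by rewrite divr_gt0.
exists delta => // n s t st dj sd.
apply: (@le_lt_trans _ _ (\sum_(i < n) M * `|F (t i) - F (s i)|)).
  by apply: ler_sum => i _; have [h1 [h2 h3]] := st i; exact: fF.
rewrite -mulr_sumr; apply: (@le_lt_trans _ _ ((M + 1) * \sum_(i < n) `|F (t i) - F (s i)|)).
  by rewrite ler_wpM2r ?sumr_ge0// lerDl.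
by rewrite mulrC -ltr_pdivlMr//; exact: dP.
Qed.

Lemma real_acD c d f g : real_ac c d f -> real_ac c d g ->
  real_ac c d (fun x => f x + g x).
Proof.
move=> af ag e e0; have e2 : 0 < e / 2 by rewrite divr_gt0.
have [d1 d10 P1] := af _ e2; have [d2 d20 P2] := ag _ e2.
exists (Num.min d1 d2); first by rewrite lt_min d10.
move=> n s t st dj; rewrite lt_min => /andP[s1 s2].
have := ltrD (P1 n s t st dj s1) (P2 n s t st dj s2).
rewrite -splitr; apply: le_lt_trans; rewrite -big_split/=.
apply: ler_sum => i _; apply: le_trans (ler_normD _ _).
by rewrite le_eqVlt; apply/orP; left; apply/eqP; congr (`|_|); ring.
Qed.

Lemma real_ac_lip c d f (M : R) :
  (forall x y, c <= x -> x <= y -> y <= d -> `|f y - f x| <= M * (y - x)) ->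
  real_ac c d f.
Proof.
move=> fM; apply: (@real_ac_le _ _ id _ `|M|) => //.
  move=> x y cx xy yd; apply: (le_trans (fM x y cx xy yd)).
  by rewrite (@ger0_norm _ (y - x)) ?subr_ge0// ler_wpM2r ?subr_ge0// ler_norm.
move=> e e0; exists e => // n s t st dj; apply: le_lt_trans.
rewrite le_eqVlt; apply/orP; left; apply/eqP; apply: eq_bigr => i _.
by have [_ [h _]] := st i; rewrite ger0_norm// subr_ge0.
Qed.

Lemma real_acN c d f : real_ac c d f -> real_ac c d (fun x => - f x).
Proof.
apply: (@real_ac_le _ _ _ _ 1) => // x y _ _ _.
by rewrite mul1r -opprD normrN.
Qed.

Lemma real_acM c d f g (M : R) :
  (forall x, c <= x <= d -> `|f x| <= M) -> (forall x, c <= x <= d -> `|g x| <= M) ->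
  real_ac c d f -> real_ac c d g -> real_ac c d (fun x => f x * g x).
Proof.
move=> fM gM af ag.
have [dc|cd] := ltP d c.
  move=> e e0; exists 1 => // -[|n] s t st; first by move=> _ _; rewrite !big_ord0.
  by have [h1 [h2 h3]] := st ord0; have := le_trans (le_trans h1 h2) h3; rewrite leNgt dc.
have M0 : 0 <= M by apply: le_trans (fM c _); rewrite ?lexx.
move=> e e0; have e2 : 0 < e / (2 * (M + 1)) by rewrite divr_gt0// mulr_gt0// ltr_wpDl.
have [d1 d10 P1] := af _ e2; have [d2 d20 P2] := ag _ e2.
exists (Num.min d1 d2); first by rewrite lt_min d10.
move=> n s t st dj; rewrite lt_min => /andP[s1 s2].
have := ltrD (P1 n s t st dj s1) (P2 n s t st dj s2).
rewrite (_ : _ + e / _ = e / (M + 1)); last by field; lra.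
rewrite ltr_pdivlMr ?ltr_wpDl// => h.
apply: le_lt_trans h; rewrite -big_split/= mulr_suml.
apply: ler_sum => i _; have [h1 [h2 h3]] := st i.
have -> : f (t i) * g (t i) - f (s i) * g (s i) =
  (f (t i) - f (s i)) * g (t i) + f (s i) * (g (t i) - g (s i)) by ring.
apply: (le_trans (ler_normD _ _)); rewrite !normrM mulrDl; apply: lerD.
  rewrite ler_wpM2l//; apply: (@le_trans _ _ M); last by rewrite lerDl.
  by apply: gM; rewrite (le_trans h1 h2) h3.
rewrite mulrC ler_wpM2l//; apply: (@le_trans _ _ M); last by rewrite lerDl.
by apply: fM; rewrite h1 (le_trans h2 h3).
Qed.

Lemma norm_Re_Im_le (z : R[i]) : `|complex.Re z| <= complex.Re `|z| /\
  `|complex.Im z| <= complex.Re `|z|.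
Proof.
rewrite normc_def /=; split; rewrite -[leLHS]sqrtr_sqr ler_wsqrtr//.
  by rewrite lerDl sqr_ge0.
by rewrite lerDr sqr_ge0.
Qed.

Lemma abs_continuous_real (f : R -> R[i]) c d : abs_continuous c d f <->
  real_ac c d (fun x => complex.Re (f x)) /\ real_ac c d (fun x => complex.Im (f x)).
Proof.
split=> [af|[a1 a2] e e0].
  split=> e e0; have [dl dl0 P] := af e e0; exists dl => // n s t st dj sd;
    apply: le_lt_trans (P n s t st dj sd); apply: ler_sum => i _.
    by rewrite -ReN -ReD; case: (norm_Re_Im_le (f (t i) - f (s i))).
  by rewrite -ImN -ImD; case: (norm_Re_Im_le (f (t i) - f (s i))).
have e2 : 0 < e / 2 by rewrite divr_gt0.
have [d1 d10 P1] := a1 _ e2; have [d2 d20 P2] := a2 _ e2.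
exists (Num.min d1 d2); first by rewrite lt_min d10.
move=> n s t st dj; rewrite lt_min => /andP[s1 s2].
have := ltrD (P1 n s t st dj s1) (P2 n s t st dj s2).
rewrite -splitr; apply: le_lt_trans; rewrite -big_split/=.
apply: ler_sum => i _; apply: (le_trans (norm_nrm1 _)).
by rewrite /nrm1 ReD ReN ImD ImN.
Qed.

(* Vitali-free argument: cover the exceptional null set by an open set U of
   small measure and run a continuous induction on x, keeping a finite family
   of disjoint intervals of total length at most the measure of U below x. *)
Section ZeroDerivative.
Variables (c d : R) (f : R -> R).
Hypothesis cd : c <= d.
Hypothesis af : real_ac c d f.
Variables (e : R) (E U : set R).
Hypothesis e0 : 0 < e.
Hypothesis Uo : open U.
Hypothesis EU : E `<=` U.
Hypothesis Ufin : (mu U < +oo)%E.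
Hypothesis df : forall x, c <= x <= d -> ~ E x -> is_derive x 1 f 0.

Let G x : R := fine (mu (U `&` `[c, x[%classic)).

Let mU : measurable U. Proof. exact: open_measurable. Qed.

Let mu_le (A B : set R) : measurable A -> measurable B -> A `<=` B -> (mu A <= mu B)%E.
Proof. by move=> mA mB AB; apply: le_measure; rewrite ?inE. Qed.

(** The invariant of the continuous induction: up to slope e, the variation of f on [c, x] is
    carried by finitely many disjoint intervals whose total length U pays for. The list runs from
    right to left, so that a new interval goes in front. *)
Let covered x (l : seq (R * R)) :=
  [/\ all (fun p : R * R => [&& c <= p.1, p.1 <= p.2 & p.2 <= x]) l,
      pairwise (fun p r : R * R => r.2 <= p.1) l,
      \sum_(p <- l) (p.2 - p.1) <= G x &
      `|f x - f c| <= e * (x - c) + \sum_(p <- l) `|f p.2 - f p.1|].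

Let mUx x : measurable (U `&` `[c, x[%classic).
Proof. exact: measurableI. Qed.

Let muUx x : (mu (U `&` `[c, x[%classic) < +oo)%E.
Proof. by apply: le_lt_trans Ufin; apply: mu_le => // x []. Qed.

Let GE x : (G x)%:E = mu (U `&` `[c, x[%classic).
Proof. by rewrite /G fineK// ge0_fin_numE. Qed.

Let G_le x y : x <= y -> G x <= G y.
Proof.
move=> xy; rewrite -lee_fin !GE; apply: mu_le => //.
by apply: setIS; apply: subset_itvl; rewrite bnd_simp.
Qed.

Let G_add y z : c <= y -> y <= z -> `[y, z[%classic `<=` U -> G y + (z - y) <= G z.
Proof.
move=> cy yz yzU; rewrite -lee_fin EFinD !GE.
have -> : (z - y)%:E = mu `[y, z[%classic.
  rewrite lebesgue_measure_itv /= lte_fin; case: ltP => // zy.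
  by rewrite (@le_anti _ _ y z) ?yz// subrr.
rewrite -measureU//; [|exact: mUx|]; last first.
  apply/seteqP; split => // x [[_ /=]]; rewrite !in_itv /= => /andP[_ xy] /andP[yx _].
  by move: xy; rewrite ltNge yx.
apply: mu_le => //; first exact: measurableU.
move=> x [[Ux]|xyz].
  by rewrite /= !in_itv /= => /andP[h1 h2]; split => //=; rewrite ?in_itv /= h1 /= (lt_le_trans h2).
split; first exact: yzU.
move: xyz; rewrite /= !in_itv /= => /andP[h1 h2]; rewrite h2 andbT.
exact: le_trans h1.
Qed.

(** If x0 is exceptional, a neighbourhood of it lies in U and [y, z] joins the list, its length
    being part of the measure of U. Otherwise f' = 0 at x0, and f varies there by at most e per unit
    length, so the list stays. *)
Let step x0 : c <= x0 <= d -> exists2 r, 0 < r & forall y z, c <= y -> y <= x0 ->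
  x0 <= z -> z <= d -> x0 - r < y -> z < x0 + r ->
  (exists l, covered y l) -> exists l, covered z l.
Proof.
move=> x0cd; have [Ex0|nEx0] := pselect (E x0).
  have /nbhs_ballP[r /= r0 rU] : nbhs x0 U by apply: open_nbhs_nbhs; split => //; exact: EU.
  exists r => // y z cy yx xz zd yr zr [l [l1 l2 l3 l4]].
  have yz : y <= z by exact: le_trans xz.
  exists ((y, z) :: l); split => /=.
  - rewrite cy yz lexx /=; apply: sub_all l1 => p /and3P[h1 h2 h3].
    by rewrite h1 h2 (le_trans h3).
  - by rewrite l2 andbT; apply: sub_all l1 => p /and3P[].
  - rewrite big_cons /= addrC; apply: le_trans (G_add cy yz _); first by rewrite lerD2r.
    move=> x; rewrite /= in_itv /= => /andP[h1 h2]; apply: rU.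
    by rewrite /ball /= ltr_norml; apply/andP; split; lra.
  - rewrite big_cons /= addrCA -(subrKA (f y)).
    apply: (le_trans (ler_normD _ _)); rewrite lerD2l.
    apply: (le_trans l4); rewrite lerD2r ler_wpM2l ?(ltW e0)//.
    by rewrite lerD2r.
have [dx0 dv0] := df x0cd nEx0.
have /= cv : h^-1 *: ((f \o shift x0) (h *: (1 : R)) - f x0) @[h --> (0 : R)^'] --> 'D_1 f x0.
  exact: dx0.
rewrite dv0 in cv.
have /cvgrPdist_le/(_ e e0) := cv.
case=> r /= r0 rP.
have near_f w : `|w - x0| < r -> `|f w - f x0| <= e * `|w - x0|.
  move=> wr; have [->|wx] := eqVneq w x0; first by rewrite !subrr normr0 mulr0.
  have wx0 : w - x0 != 0 by rewrite subr_eq0.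
  have := rP (w - x0); rewrite /ball /= sub0r normrN => /(_ wr wx0).
  rewrite sub0r normrN /= /shift /GRing.scale /= mulr1 subrK normrM normfV.
  by rewrite mulrC ler_pdivrMr ?normr_gt0.
exists r => // y z cy yx xz zd yr zr [l [l1 l2 l3 l4]].
have yz : y <= z by exact: le_trans xz.
exists l; split => //.
- by apply: sub_all l1 => p /and3P[h1 h2 h3]; rewrite h1 h2 (le_trans h3).
- by apply: (le_trans l3); exact: G_le.
- have fy : `|f y - f x0| <= e * (x0 - y).
    have := near_f y; rewrite (distrC y) (@ger0_norm _ (x0 - y)) ?subr_ge0//.
    by apply; lra.
  have fz : `|f z - f x0| <= e * (z - x0).
    rewrite -[z - x0]ger0_norm ?subr_ge0//; apply: near_f.
    by rewrite ger0_norm ?subr_ge0//; lra.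
  have -> : f z - f c = (f z - f x0) + (f x0 - f y) + (f y - f c) by ring.
  apply: (le_trans (ler_normD _ _)).
  apply: (le_trans (lerD (le_trans (ler_normD _ _) (lerD fz _)) l4)).
    by rewrite distrC; exact: fy.
  by rewrite addrA lerD2r -!mulrDr ler_wpM2l ?(ltW e0)//; lra.
Qed.

(** At the supremum of the reachable points [step] still advances to the right, so the supremum is d
    and is reached. *)
Let covered_d : exists l, covered d l.
Proof.
pose S := [set x | c <= x <= d /\ exists l, covered x l].
have Sc : S c.
  split; first by rewrite lexx.
  exists [::]; split => //; rewrite big_nil.
    by rewrite -lee_fin GE.
  by rewrite !subrr normr0 mulr0 addr0.
have hS : has_sup S.
  by split; [exists c|exists d => x [/andP[]]].
pose m := sup S.
have mS x : S x -> x <= m by move=> Sx; exact: sup_upper_bound.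
have cm : c <= m by exact: mS.
have md : m <= d by apply: ge_sup; [exists c|move=> x [/andP[]]].
have [|r r0 rP] := @step m; first by rewrite cm md.
have [y [/andP[cy yd] yl] my] := sup_adherent r0 hS.
have ym : y <= m by apply: mS; split => //; rewrite cy.
have Sz z : m <= z -> z <= d -> z < m + r -> S z.
  move=> mz zd zr; split; first by rewrite (le_trans cm) ?zd.
  exact: (rP y).
have [dm|dm] := leP d m.
  have -> : d = m by apply/eqP; rewrite eq_le dm.
  by have [] := Sz m (lexx _) md _; rewrite ?ltrDl.
exfalso.
have h : m < Num.min d (m + r / 2) by rewrite lt_min dm ltrDl divr_gt0.
have := mS _ (Sz (Num.min d (m + r / 2)) (ltW h) _ _).
rewrite ge_min lexx /= => /(_ isT); rewrite leNgt h => H.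
suff : Num.min d (m + r / 2) < m + r by move/H.
by rewrite gt_min; apply/orP; right; lra.
Qed.

Lemma zero_derivative_bound delta :
  (forall (n : nat) (s t : 'I_n -> R),
    (forall i, c <= s i /\ s i <= t i /\ t i <= d) ->
    (forall i j, i != j -> t i <= s j \/ t j <= s i) ->
    \sum_(i < n) (t i - s i) < delta ->
    \sum_(i < n) `|f (t i) - f (s i)| < e) ->
  (mu U < delta%:E)%E -> `|f d - f c| <= e * (d - c) + e.
Proof.
move=> P Ud; have [l [l1 l2 l3 l4]] := covered_d.
apply: (le_trans l4); rewrite lerD2l ltW//.
pose s (i : 'I_(size l)) := (nth (0, 0) l i).1.
pose t (i : 'I_(size l)) := (nth (0, 0) l i).2.
rewrite (big_nth (0, 0)) big_mkord.
apply: (P _ s t).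
- by move=> i; have /and3P[] := all_nthP (0, 0) l1 i (ltn_ord i).
- have lt_dj (i j : 'I_(size l)) : (i < j)%N -> t j <= s i.
    move=> ij; apply: (pairwiseP (0, 0) l2) => //; rewrite inE; exact: ltn_ord.
  move=> i j; rewrite neq_ltn => /orP[|] /lt_dj; by [right|left].
- rewrite -[X in X < _](big_mkord xpredT (fun i => (nth (0, 0) l i).2 - (nth (0, 0) l i).1)).
  rewrite -(big_nth (0, 0) xpredT (fun p => p.2 - p.1)).
  apply: (le_lt_trans l3); rewrite -lte_fin GE; apply: le_lt_trans Ud.
  by apply: mu_le => // x [].
Qed.

End ZeroDerivative.

Lemma ac_zero_derivative c d f : c <= d -> real_ac c d f ->
  {ae mu, forall x, c < x < d -> is_derive x 1 f 0} -> f d = f c.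
Proof.
move=> cd af [A [mA A0 AP]].
(* The derivative is known only inside ]c, d[, so the end points join the null set. *)
pose E := A `|` [set c; d].
have mE : measurable E by apply: measurableU => //; exact: measurableU.
have mu_U2 (X Y : set R) : measurable X -> measurable Y ->
    (mu (X `|` Y) <= mu X + mu Y)%E by move=> mX mY; exact: measureU2.
have E0 : mu E = 0%E.
  apply/eqP; rewrite eq_le measure_ge0 andbT.
  apply: (le_trans (mu_U2 _ _ mA _)); first exact: measurableU.
  rewrite A0 add0e; apply: (le_trans (mu_U2 _ _ _ _)) => //.
  by rewrite !lebesgue_measure_set1 adde0.
suff bd e : 0 < e -> `|f d - f c| <= e * (d - c) + e.
  apply/eqP; rewrite -subr_eq0 -normr_eq0 eq_le normr_ge0 andbT.
  apply/ler_addgt0Pr => e e0; rewrite add0r.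
  have dc : 0 < d - c + 1 by rewrite ltr_wpDl ?subr_ge0.
  apply: (le_trans (bd (e / (d - c + 1)) _)); first by rewrite divr_gt0.
  by rewrite le_eqVlt; apply/orP; left; apply/eqP; field; lra.
move=> e0; have [delta d0 P] := af e e0.
have Efin : (mu E < +oo)%E by rewrite E0 ltry.
have [U [Uo EU UE]] := lebesgue_regularity_outer mE Efin d0.
have mU : measurable U by exact: open_measurable.
have muU : (mu U < delta%:E)%E.
  rewrite -(setDUK EU); apply: le_lt_trans UE.
  apply: (le_trans (mu_U2 _ _ mE _)); first exact: measurableD.
  by rewrite E0 add0e.
apply: (@zero_derivative_bound c d f cd e E U e0 Uo EU _ _ delta) => //.
  exact: lt_trans muU (ltry _).
move=> x /andP[cx xd] nE.
have cxd : c < x < d.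
  rewrite !lt_neqAle cx xd !andbT; apply/andP; split; apply/eqP => h; apply: nE; right; [left|right] => //.
by apply: contrapT => h; apply: nE; left; apply: AP => /= /(_ cxd).
Qed.

End AbsoluteContinuity.

Lemma integrable_patch d (T : measurableType d) (R : realType)
    (m : {measure set T -> \bar R}) (f : T -> R) (D : set T) : measurable D ->
  m.-integrable setT (EFin \o f) -> m.-integrable setT (EFin \o (f \_ D)).
Proof.
move=> mD intf; rewrite -restrict_EFin.
have := integrableS measurableT mD (@subsetT _ D) intf.
by rewrite integrable_mkcond.
Qed.

Lemma is_derive_derive1 (R : realType) (F : R -> R) (x l : R) :
  derivable F x 1 -> derive1 F x = l -> is_derive x 1 F l.
Proof. by move=> dF Fl; apply: DeriveDef => //; rewrite -derive1E. Qed.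

(** * Integrals with a variable lower limit *)

Section TailIntegral.
Context {R : realType}.
Local Notation mu := (@lebesgue_measure R).
Local Notation TR := (measurableTypeR R).
Variable f : TR -> R.
Hypothesis intf : mu.-integrable setT (EFin \o f).

Let mf : measurable_fun setT f.
Proof. by have /measurable_EFinP := measurable_int _ intf. Qed.

Let inf : mu.-integrable setT (EFin \o (fun x => `|f x|)).
Proof. by have /integrable_norm := intf. Qed.

Let rtail (y : R) : R := \int[mu]_t (lt1 y t * f t).

Let mlt1f y : measurable_fun setT (fun t : TR => lt1 y t * f t).
Proof. by apply: measurable_funM => //; exact: measurable_lt1. Qed.

Let ilt1f y : mu.-integrable setT (EFin \o (fun t : TR => lt1 y t * f t)).
Proof.
apply: integrable_dominated inf _ => // t.
by rewrite normrM ler_piMl// normr_lt1.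
Qed.

Lemma rtailE y : rtail y = \int[mu]_t f t - \int[mu]_(t in `]-oo, y]) f t.
Proof.
rewrite [X in _ - X]Rintegral_mkcond -RintegralB//; last first.
  exact: integrable_patch.
apply: eq_Rintegral => t _; rewrite patchE; case: ifPn.
  by rewrite inE /= in_itv /= => ty; rewrite lt1_le// mul0r subrr.
rewrite notin_setE /= in_itv /= => /negP; rewrite -ltNge => yt.
by rewrite lt1_lt// mul1r subr0.
Qed.

Lemma rtail_derive x : {for x, continuous (f : R -> R)} -> is_derive x 1 rtail (- f x).
Proof.
move=> fx.
have ifx : mu.-integrable `]-oo, x + 1] (EFin \o f) by exact: integrableS intf.
have [dF FE] := continuous_FTC1 (ltr_pwDr ltr01 (lexx x)) ifx (ltNyr x) fx.
have h : is_derive x 1 (fun y : R => \int[mu]_(t in `]-oo, y]) f t) (f x).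
  exact: is_derive_derive1 dF FE.
apply: is_derive_ext (is_deriveB (is_derive_cst (\int[mu]_t f t) x 1) h) => [y|].
  by rewrite rtailE.
by rewrite sub0r.
Qed.

(** The Lebesgue differentiation theorem: f is merely integrable, hence the restriction to almost
    every point. *)
Lemma rtail_derive_ae : {ae mu, forall x : R, is_derive x 1 rtail (- f x)}.
Proof.
have iNy (y : R) : mu.-integrable `]-oo, y] (EFin \o f) by exact: integrableS intf.
have lf : locally_integrable [set: R] f.
  exact: open_integrable_locally (@openT R) intf.
have := FTC1Ny iNy lf; apply: filterS; first exact: (ae_filter_ringOfSetsType mu).
move=> x [dF FE].
have h : is_derive x 1 (fun y : R => \int[mu]_(t in `]-oo, y]) f t) (f x).
  exact: is_derive_derive1 dF FE.
apply: is_derive_ext (is_deriveB (is_derive_cst (\int[mu]_t f t) x 1) h) => [y|].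
  by rewrite rtailE.
by rewrite sub0r.
Qed.

(** Absolute continuity of the integral of |f| as a set function, applied to the union of the
    intervals. *)
Lemma rtail_ac c d : real_ac c d rtail.
Proof.
move=> e e0; have [delta [d0 P]] := integral_normr_continuous intf e0.
exists delta => // n s t st dj sd.
(* Half-open intervals are disjoint even when they share an end point. *)
pose I i : set TR := `]s i, t i]%classic.
pose A : set TR := \big[setU/set0]_(i < n) I i.
have mI i : measurable (I i) by exact: measurable_itv.
have mA : measurable A by exact: bigsetU_measurable.
have muA : (mu A < delta%:E)%E.
  apply: (@le_lt_trans _ _ (\sum_(i < n) (t i - s i)%:E)%E).
    have : measurable A /\ (mu A <= \sum_(i < n) (t i - s i)%:E)%E.
      rewrite /A; elim/big_ind2 : _ => [|X x Y y [mX hX] [mY hY]|i _].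
      - by split => //; rewrite measure0.
      - split; first exact: measurableU.
        by apply: le_trans (leeD hX hY); exact: measureU2.
      - split => //; rewrite /I lebesgue_measure_itv /= lte_fin.
        by case: (st i) => _ [h _]; case: ifPn => // _; rewrite lee_fin subr_ge0.
    by case.
  by rewrite sumEFin lte_fin.
have iA := P A mA muA.
apply: le_lt_trans iA.
rewrite Rintegral_mkcond.
have iS i : mu.-integrable setT (EFin \o (fun x => ((fun x => `|f x|) \_ (I i)) x)).
  exact: integrable_patch.
apply: (@le_trans _ _ (\sum_(i < n) \int[mu]_x ((fun x => `|f x|) \_ (I i)) x)).
  apply: ler_sum => i _.
  rewrite /rtail -RintegralB//.
  apply: le_normr_Rintegral_dominated.
  - exact: measurable_funB.
  - exact: iS.
  - move=> x; rewrite patchE -mulrBl normrM; have [_ [sti _]] := st i.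
    have [xI|xI] := boolP (x \in I i).
      move: xI; rewrite inE /I /= in_itv /= => /andP[h1 h2]; rewrite (lt1_lt h1) (lt1_le h2).
      by rewrite sub0r normrN normr1 mul1r.
    move: xI; rewrite notin_setE /I /= in_itv /= => /negP.
    rewrite negb_and -leNgt -ltNge => /orP[h|h].
      by rewrite (lt1_le h) (lt1_le (le_trans h sti)) subrr normr0 mul0r.
    by rewrite (lt1_lt h) (lt1_lt (le_lt_trans sti h)) subrr normr0 mul0r.
have -> : \sum_(i < n) \int[mu]_x ((fun x => `|f x|) \_ (I i)) x =
    \int[mu]_x \sum_(i < n) ((fun x => `|f x|) \_ (I i)) x.
  have : mu.-integrable setT (EFin \o (fun x => \sum_(i < n) ((fun x => `|f x|) \_ (I i)) x)) /\
     \sum_(i < n) \int[mu]_x ((fun x => `|f x|) \_ (I i)) x =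
    \int[mu]_x \sum_(i < n) ((fun x => `|f x|) \_ (I i)) x; last by case.
  elim: n {s t st dj sd A mA muA mI} I iS => [|n IH] I iS.
    split.
      apply: eq_integrable (integrable0 mu setT) => // x _ /=.
      by rewrite big_ord0.
    rewrite big_ord0; under eq_Rintegral do rewrite big_ord0.
    by rewrite Rintegral_cst// mul0r.
  have [i1 e1] := IH (fun i => I (widen_ord (leqnSn n) i)) (fun i => iS _).
  split.
    apply: eq_integrable (integrableD measurableT i1 (iS ord_max)) => // x _ /=.
    by rewrite big_ord_recr.
  rewrite big_ord_recr /= e1 -RintegralD//.
  by apply: eq_Rintegral => x _; rewrite big_ord_recr.
apply: le_Rintegral => //.
- have -> : EFin \o (fun x => \sum_(i < n) ((fun x => `|f x|) \_ (I i)) x) =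
    (fun x => \sum_(i < n) (((fun x => `|f x|) \_ (I i)) x)%:E)%E.
    by apply/funext => x /=; rewrite sumEFin.
  by apply: integrable_sum => // i _; exact: iS.
- exact: integrable_patch.
(* By disjointness at most one summand is nonzero at x. *)
- move=> x _; have [[i Ii]|noI] := pselect (exists i, I i x).
    rewrite (bigD1 i)//= big1 ?addr0.
      by rewrite !patchE ifT ?inE// ifT// inE /A (bigD1 i)//=; left.
    move=> j ji; rewrite patchE ifN// notin_setE => Ij.
    move: Ii Ij; rewrite /I /= !in_itv /= => /andP[h1 h2] /andP[h3 h4].
    by case: (dj j i ji) => h; have := le_lt_trans (le_trans _ h) _; lra.
  rewrite big1; last by move=> i _; rewrite patchE ifN// notin_setE => h; apply: noI; exists i.
  by rewrite patchE; case: ifP.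
Qed.

End TailIntegral.

Lemma real_ac_continuous (R : realType) (f : R -> R) :
  (forall c d, real_ac c d f) -> continuous f.
Proof.
move=> af x; apply/cvgrPdist_lt => e e0.
have [dl d0 P] := af (x - 1) (x + 1) e e0.
exists (Num.min 1 dl); first by rewrite /= lt_min ltr01.
move=> y /=; rewrite lt_min ltr_norml ltr_norml => /andP[/andP[h1 h2] /andP[h3 h4]].
pose s (_ : 'I_1) := Num.min x y; pose t (_ : 'I_1) := Num.max x y.
have := P 1%N s t; rewrite !big_ord1 /s /t.
have [xy|yx] := leP x y.
  rewrite distrC; apply; [|by move=> i j; rewrite !ord1 eqxx|lra].
  by move=> _; lra.
by apply; [move=> _; lra|move=> i j; rewrite !ord1 eqxx|lra].
Qed.

Section ComplexTail.
Context {R : realType}.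
Local Notation mu := (@lebesgue_measure R).
Local Notation TR := (measurableTypeR R).
Implicit Types f g F : R -> R[i].

Definition ccont f (x : R) := {for x, continuous (fun y => complex.Re (f y))} /\
  {for x, continuous (fun y => complex.Im (f y))}.

Lemma cderiv_ccont f x l : cderiv f x l -> ccont f x.
Proof.
by move=> [[h1 _] [h2 _]]; split; apply: differentiable_continuous; exact/derivable1_diffP.
Qed.

Lemma ccontD f g x : ccont f x -> ccont g x -> ccont (fun y => f y + g y) x.
Proof.
move=> [f1 f2] [g1 g2]; split.
  have -> : (fun y => complex.Re (f y + g y)) = (fun y => complex.Re (f y) + complex.Re (g y)).
    by apply/funext => y; rewrite ReD.
  exact: cvgD f1 g1.
have -> : (fun y => complex.Im (f y + g y)) = (fun y => complex.Im (f y) + complex.Im (g y)).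
  by apply/funext => y; rewrite ImD.
exact: cvgD f2 g2.
Qed.

Lemma ccontM f g x : ccont f x -> ccont g x -> ccont (fun y => f y * g y) x.
Proof.
move=> [f1 f2] [g1 g2]; split.
  have -> : (fun y => complex.Re (f y * g y)) =
      (fun y => complex.Re (f y) * complex.Re (g y) - complex.Im (f y) * complex.Im (g y)).
    by apply/funext => y; rewrite ReM.
  by apply: cvgB; apply: cvgM.
have -> : (fun y => complex.Im (f y * g y)) =
    (fun y => complex.Re (f y) * complex.Im (g y) + complex.Im (f y) * complex.Re (g y)).
  by apply/funext => y; rewrite ImM.
by apply: cvgD; apply: cvgM.
Qed.

Lemma ccont_cst (z : R[i]) x : ccont (fun=> z) x.
Proof. by split; exact: cvg_cst. Qed.

Lemma ccontN f x : ccont f x -> ccont (fun y => - f y) x.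
Proof.
move=> fx; have := ccontM (ccont_cst (-1) x) fx.
by under eq_fun do rewrite mulN1r.
Qed.

Definition ctail F (y : R) : R[i] := cint mu (fun t : TR => (lt1 y t)%:C * F t).

Variable F : R -> R[i].
Hypothesis iF : cintegrable mu (F : TR -> R[i]).

Let iRe : mu.-integrable setT (EFin \o (fun t : TR => complex.Re (F t))).
Proof. exact: cintegrable_Re. Qed.

Let iIm : mu.-integrable setT (EFin \o (fun t : TR => complex.Im (F t))).
Proof. exact: cintegrable_Im. Qed.

Let Re_ctail y : complex.Re (ctail F y) = \int[mu]_t (lt1 y t * complex.Re (F t)).
Proof. by apply: eq_Rintegral => t _; rewrite ReMr. Qed.

Let Im_ctail y : complex.Im (ctail F y) = \int[mu]_t (lt1 y t * complex.Im (F t)).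
Proof. by apply: eq_Rintegral => t _; rewrite ImMr. Qed.

Lemma ctail_derive x : ccont F x -> cderiv (ctail F) x (- F x).
Proof.
move=> [c1 c2]; split.
  apply: is_derive_ext (rtail_derive iRe c1) => [y|]; first by rewrite Re_ctail.
  by rewrite ReN.
apply: is_derive_ext (rtail_derive iIm c2) => [y|]; first by rewrite Im_ctail.
by rewrite ImN.
Qed.

Lemma ctail_derive_ae : {ae mu, forall x : R, cderiv (ctail F) x (- F x)}.
Proof.
apply: filterS2 (rtail_derive_ae iRe) (rtail_derive_ae iIm) => [|x h1 h2].
  exact: (ae_filter_ringOfSetsType mu).
split.
  by apply: is_derive_ext h1 => [y|]; rewrite ?Re_ctail ?ReN.
by apply: is_derive_ext h2 => [y|]; rewrite ?Im_ctail ?ImN.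
Qed.

Lemma ctail_ac c d : real_ac c d (fun x => complex.Re (ctail F x)) /\
  real_ac c d (fun x => complex.Im (ctail F x)).
Proof.
split.
  by under eq_fun do rewrite Re_ctail; exact: rtail_ac.
by under eq_fun do rewrite Im_ctail; exact: rtail_ac.
Qed.

Lemma ctail_ccont x : ccont (ctail F) x.
Proof.
by split; apply: real_ac_continuous => c d; case: (ctail_ac c d).
Qed.

End ComplexTail.

Section AbsContinuousAlgebra.
Context {R : realType}.
Implicit Types (f g : R -> R[i]) (c d : R).

Lemma real_ac_bounded c d (f : R -> R) : real_ac c d f ->
  exists M, forall x, c <= x <= d -> `|f x| <= M.
Proof.
move=> af; have [dc|cd] := ltP d c.
  by exists 0 => x /andP[h1 h2]; have := le_trans h1 h2; rewrite leNgt dc.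
(* Clamping to [c, d] extends f to a function that is absolutely continuous on every interval, hence
   continuous on the line, so that it attains its bounds. *)
pose cl x := if x <= c then c else if d <= x then d else x.
have cl_le x y : x <= y -> cl x <= cl y.
  by rewrite /cl; case: (leP x c); case: (leP y c); case: (leP d x); case: (leP d y); lra.
have cl_lip x y : x <= y -> cl y - cl x <= y - x.
  by rewrite /cl; case: (leP x c); case: (leP y c); case: (leP d x); case: (leP d y); lra.
have clc x : c <= cl x by rewrite /cl; case: (leP x c); case: (leP d x); lra.
have cld x : cl x <= d by rewrite /cl; case: (leP x c); case: (leP d x); lra.
have cf : continuous (f \o cl).
  apply: real_ac_continuous => c' d' e e0; have [dl d0 P] := af e e0.
  exists dl => // n s t st dj sd; apply: (P n (cl \o s) (cl \o t)).
  - by move=> i; have [_ [h _]] := st i; split; [exact: clc|split; [exact: cl_le|exact: cld]].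
  - by move=> i j ij; case: (dj i j ij) => h; [left|right]; exact: cl_le.
  - apply: le_lt_trans sd; apply: ler_sum => i _.
    by have [_ [h _]] := st i; exact: cl_lip.
have [m _ mP] := EVT_max cd (continuous_subspaceT (fun x => continuous_comp (cf x) (@norm_continuous _ R^o _))).
exists `|f (cl m)| => x xcd.
have := mP x; rewrite in_itv /= => /(_ xcd) /=.
have -> // : cl x = x by rewrite /cl; case/andP: xcd; case: (leP x c); case: (leP d x); lra.
Qed.

Lemma abs_continuousD c d f g : abs_continuous c d f -> abs_continuous c d g ->
  abs_continuous c d (fun x => f x + g x).
Proof.
move=> /abs_continuous_real[f1 f2] /abs_continuous_real[g1 g2].
apply/abs_continuous_real; split.
  by under eq_fun do rewrite ReD; exact: (real_acD f1 g1).
by under eq_fun do rewrite ImD; exact: (real_acD f2 g2).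
Qed.

Lemma abs_continuousM c d f g : abs_continuous c d f -> abs_continuous c d g ->
  abs_continuous c d (fun x => f x * g x).
Proof.
have acM (u v : R -> R) : real_ac c d u -> real_ac c d v -> real_ac c d (fun x => u x * v x).
  move=> au av; have [M1 h1] := real_ac_bounded au; have [M2 h2] := real_ac_bounded av.
  apply: (@real_acM _ _ _ _ _ (Num.max M1 M2)) => // x xcd.
    by apply: (le_trans (h1 _ xcd)); rewrite le_max lexx.
  by apply: (le_trans (h2 _ xcd)); rewrite le_max lexx orbT.
move=> /abs_continuous_real[f1 f2] /abs_continuous_real[g1 g2].
apply/abs_continuous_real; split.
  under eq_fun do rewrite ReM.
  by exact: (real_acD (acM _ _ f1 g1) (real_acN (acM _ _ f2 g2))).
by under eq_fun do rewrite ImM; exact: (real_acD (acM _ _ f1 g2) (acM _ _ f2 g1)).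
Qed.

Lemma abs_continuous_cst c d (z : R[i]) : abs_continuous c d (fun=> z).
Proof.
apply/abs_continuous_real; split; apply: (@real_ac_lip _ _ _ _ 0) => x y _ _ _;
  by rewrite subrr normr0 mul0r.
Qed.

Lemma abs_continuousN c d f : abs_continuous c d f -> abs_continuous c d (fun x => - f x).
Proof.
move=> /(abs_continuousM (abs_continuous_cst c d (-1))).
by under eq_fun do rewrite mulN1r.
Qed.

Lemma real_ac_derive c d (f f' : R -> R) (M : R) :
  (forall x, c <= x <= d -> is_derive x 1 f (f' x)) ->
  (forall x, c <= x <= d -> `|f' x| <= M) -> real_ac c d f.
Proof.
move=> df fM; apply: (@real_ac_lip _ _ _ _ M) => x y cx xy yd.
have cxy z : x <= z <= y -> c <= z <= d.
  by move=> /andP[h1 h2]; rewrite (le_trans cx h1) (le_trans h2 yd).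
have dz (z : R) : z \in `]x, y[%R -> is_derive z 1 f (f' z).
  by rewrite in_itv /= => /andP[h1 h2]; apply: df; apply: cxy; rewrite !ltW.
have cf : {within `[x, y], continuous f}.
  apply: derivable_within_continuous => z; rewrite in_itv /= => h.
  by have [] := df z (cxy _ h).
have [z zxy ->] := MVT_segment xy dz cf.
rewrite normrM (@ger0_norm _ (y - x)) ?subr_ge0// ler_wpM2r ?subr_ge0//.
by apply: fM; apply: cxy; move: zxy; rewrite in_itv.
Qed.

Lemma abs_continuous_derive c d f f' (M : R) :
  (forall x, c <= x <= d -> cderiv f x (f' x)) ->
  (forall x, c <= x <= d -> nrm1 (f' x) <= M) -> abs_continuous c d f.
Proof.
move=> df fM; apply/abs_continuous_real; split.
  apply: (@real_ac_derive _ _ _ (fun x => complex.Re (f' x)) M) => x xcd.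
    by have [] := df x xcd.
  by apply: le_trans (fM x xcd); rewrite /nrm1 lerDl.
apply: (@real_ac_derive _ _ _ (fun x => complex.Im (f' x)) M) => x xcd.
  by have [] := df x xcd.
by apply: le_trans (fM x xcd); rewrite /nrm1 lerDr.
Qed.

(** An absolutely continuous f' is bounded, so f is Lipschitz. This is how absolute continuity of a
    solution u follows from that of u'. *)
Lemma abs_continuous_primitive c d f f' :
  (forall x, c <= x <= d -> cderiv f x (f' x)) ->
  abs_continuous c d f' -> abs_continuous c d f.
Proof.
move=> df /abs_continuous_real[/real_ac_bounded[M1 h1] /real_ac_bounded[M2 h2]].
apply: (abs_continuous_derive (M := M1 + M2) df) => x xcd.
by rewrite /nrm1 lerD ?h1 ?h2.
Qed.

Lemma abs_continuous_lexp c d (k : R[i]) (m n : R) :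
  abs_continuous c d (fun x => lexp k (m * x + n)).
Proof.
pose M := nrm1 (- (2 * m%:C * k)) *
  (2 * expR (2 * `|complex.Re k| * (`|m| * (`|c| + `|d|) + `|n|))).
apply: (abs_continuous_derive (M := M) (fun x _ => cderiv_lexp k m n x)) => x /andP[cx xd].
apply: (le_trans (nrm1M _ _)); rewrite ler_wpM2l ?nrm1_ge0//.
apply: (le_trans (nrm1_lexp _ _)); rewrite ler_wpM2l// ler_expR.
apply: (le_trans (ler_norm _)); rewrite normrN !normrM (@ger0_norm _ 2)// -!mulrA ler_wpM2l//.
rewrite ler_wpM2l//; apply: (le_trans (ler_normD _ _)); rewrite lerD2r normrM ler_wpM2l//.
by case: (ger0P x) => x0; case: (ger0P c); case: (ger0P d); lra.
Qed.

End AbsContinuousAlgebra.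

(** * Weyl solutions *)

Lemma lt1_near (R : realType) (c d x : R) : c < x -> x < d ->
  \forall y \near x, lt1 c y * lt1 y d = 1.
Proof.
move=> cx xd; near=> y; rewrite !lt1_lt ?mulr1//; near: y.
  exact: lt_nbhsl.
exact: lt_nbhsr.
Unshelve. all: by end_near.
Qed.

Section Near.
Context {R : realType}.
Implicit Types f g : R -> R[i].

Lemma cderiv_near f g x l : (\forall y \near x, f y = g y) ->
  cderiv f x l -> cderiv g x l.
Proof.
move=> fg [d1 d2]; split.
  by apply: near_eq_is_derive d1; apply: filterS fg => y ->.
by apply: near_eq_is_derive d2; apply: filterS fg => y ->.
Qed.

Lemma ccont_near f g x : (\forall y \near x, f y = g y) -> ccont f x -> ccont g x.
Proof.
move=> fg; have fgx : f x = g x by exact: nbhs_singleton fg.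
move=> [c1 c2]; split; rewrite /prop_for /continuous_at /= -fgx.
  by apply: cvg_trans c1; apply: near_eq_cvg; apply: filterS fg => y ->.
by apply: cvg_trans c2; apply: near_eq_cvg; apply: filterS fg => y ->.
Qed.

End Near.

(** * The explicit solution of the differential equation *)

Section OdeSolution.
Context {R : realType}.
Local Notation mu := (@lebesgue_measure R).
Local Notation TR := (measurableTypeR R).
Variable q : TR -> R.
Hypothesis iq : mu.-integrable setT (EFin \o q).
Variable b : R.
Hypothesis b0 : 0 < b.
Hypothesis qb : forall x, b <= x -> q x = 0.
Variables (sigma a C : R) (k : TR * TR -> R).
Hypothesis kC : kernel_bound q C k.
Variable kap : R[i].
Hypothesis rk : rate q <= complex.Re kap.
Local Notation psol := (psol b sigma k kap).
Local Notation tail := (tail q b sigma k kap).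
Hypothesis kE : forall x, khat k kap x =
  cint mu (fun g => (lt1 0 g * lt1 g (b - x))%:C * lexp kap g * (a%:C + tail (x + g))).

Let mq : measurable_fun setT q.
Proof. by have /measurable_EFinP := measurable_int _ iq. Qed.

Let niq : mu.-integrable setT (EFin \o (fun x => `|q x|)).
Proof. by have /integrable_norm := iq. Qed.

Let pot (t : R) : R[i] := (q t)%:C * psol t.

Let tailE : tail = ctail pot.
Proof.
apply/funext => y; apply: eq_cint => t.
by rewrite /pot rmorphM mulrA.
Qed.

Let ipot : cintegrable mu (pot : TR -> R[i]).
Proof.
have mp := cmeasurable_psol b sigma kC kap.
apply: (cintegrable_dominated (g := fun t => psol_bound q sigma C * `|q t|)).
- by apply: cmeasurableM => //; exact: cmeasurable_real.
- exact: (integrableZl _ _ niq).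
- move=> t; rewrite nrm1Mr mulrC; have [bt|tb] := leP b t.
    by rewrite qb// normr0 !mulr0.
  by rewrite ler_wpM2r// nrm1_psol.
Qed.

(* The lower cut-off at [-1] only makes the density integrable. *)
Let dens (s : R) : R[i] := (lt1 (-1) s * lt1 s b)%:C * (lexp kap s * (a%:C + tail s)).

Let mtail : cmeasurable (tail : TR -> R[i]).
Proof.
have mp := cmeasurable_psol b sigma kC kap.
apply: (cmeasurable_cint mu (f := fun z : TR * TR => (lt1 z.1 z.2 * q z.2)%:C * psol z.2)).
apply: cmeasurableM; last exact: (cmeasurable_comp mp).
by apply: cmeasurable_real; apply: measurable_funM; [exact: measurable_lt1|exact: measurableT_comp].
Qed.

Let idens : cintegrable mu (dens : TR -> R[i]).
Proof.
have mp := cmeasurable_psol b sigma kC kap.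
have k0 : 0 <= complex.Re kap by apply: le_trans rk; rewrite ltW// rate_gt0.
pose M := 2 * expR (2 * complex.Re kap) * (`|a| + psol_bound q sigma C * qnorm q).
apply: (cintegrable_dominated (g := fun t : TR => M * (lt1 (-1) t * lt1 t b))).
- apply: cmeasurableM.
    by apply: cmeasurable_real; apply: measurable_funM; exact: measurable_lt1.
  apply: cmeasurableM; first exact: cmeasurable_lexp.
  by apply: cmeasurableD => //; exact: cmeasurable_cst.
- have i1 : mu.-integrable setT (EFin \o \1_(`]-1, b[%classic : set TR)).
    exact: integrable_indic_itv.
  apply: eq_integrable (integrableZl measurableT M i1) => // t _ /=; congr (_ * _)%:E.
  rewrite indicE; have [t1|t1] := leP t (-1).
    by rewrite (lt1_le t1) mul0r memNset//= in_itv /= ltNge t1.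
  rewrite (lt1_lt t1) mul1r; have [tb|tb] := ltP t b.
    by rewrite (lt1_lt tb) mem_set//= in_itv /= t1.
  by rewrite (lt1_le tb) memNset//= in_itv /= t1 ltNge tb.
- move=> t; rewrite nrm1Mr mulrC.
  have [t1|t1] := leP t (-1); first by rewrite (lt1_le t1) mul0r normr0 !mulr0.
  rewrite (@ger0_norm _ (_ * _)) ?mulr_ge0 ?lt1_ge0// ler_wpM2r ?mulr_ge0 ?lt1_ge0//.
  apply: (le_trans (nrm1M _ _)); apply: ler_pM; rewrite ?nrm1_ge0//.
    apply: (le_trans (nrm1_lexp _ _)); rewrite ler_wpM2l// ler_expR -mulrN.
    by rewrite ler_piMr ?mulr_ge0//; lra.
  apply: (le_trans (nrm1D _ _)); rewrite nrm1_real lerD2l.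
  by apply: (nrm1_tail iq qb t mp) => s sb; exact: nrm1_psol.
Qed.

(** The substitution s = x + g gives khat(x) = e^{2 kap x} times an integral over s > x whose
    integrand no longer depends on x; in this form khat can be differentiated. *)
Lemma khat_ctail x : -1 <= x -> khat k kap x = lexp kap (-1 * x + 0) * ctail dens x.
Proof.
move=> x1; have il : cintegrable mu (fun t => (lt1 x t)%:C * dens t).
  apply: (cintegrable_dominated _ idens.2).
    by apply: cmeasurableM; [apply: cmeasurable_real; exact: measurable_lt1|exact: idens.1].
  by move=> t; rewrite nrm1Mr ler_piMl ?nrm1_ge0 ?normr_lt1.
rewrite kE addr0 mulN1r -cintZ//.
pose F g : R[i] := lexp kap (- x) * ((lt1 x g)%:C * dens g).
have mF : cmeasurable (F : TR -> R[i]) by exact: (cintegrableZ _ il).1.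
rewrite -[RHS](cint_translate (- x) mF); apply: eq_cint => g.
rewrite /F /dens opprK (addrC g) (lexpD kap x g).
have -> : lt1 x (x + g) = lt1 0 g by rewrite /lt1 ltrDl.
have -> : lt1 (x + g) b = lt1 g (b - x) by rewrite /lt1 ltrBrDl.
have [g0|g0] := leP g 0; first by rewrite (lt1_le g0) !mul0r !mulr0.
have -> : lt1 (-1) (x + g) = 1 by rewrite lt1_lt//; lra.
rewrite mul1r rmorphM; have := lexpN kap x => e.
transitivity ((lexp kap (- x) * lexp kap x) * ((lt1 0 g)%:C * (lt1 g (b - x))%:C * lexp kap g * (a%:C + tail (x + g)))).
  by rewrite e mul1r.
by ring.
Qed.

(** The function e^{kap (b - x)} psi(x), the first factor being [lexp] at (x - b) / 2, with khat in
    its differentiable form. *)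
Definition usol (x : R) : R[i] := lexp kap (2^-1 * x + - (2^-1 * b)) *
  (1 - sigma%:C * lexp kap (-1 * x + b) + lexp kap (-1 * x + 0) * ctail dens x).

(** The derivative of [usol], since psi' = 2 kap (psi - 1) - a - tail. Written without derivatives
    it makes sense at 0 and b too, and is absolutely continuous because its ingredients are
    integrals and exponentials. *)
Definition vsol (x : R) : R[i] := kap * usol x -
  lexp kap (2^-1 * x + - (2^-1 * b)) * (2 * kap + a%:C + tail x).

Lemma usolE x : -1 <= x -> usol x = lexp kap (2^-1 * x + - (2^-1 * b)) * psol x.
Proof.
move=> x1; rewrite /usol -(khat_ctail x1) /psol.
have -> : b - x = -1 * x + b by ring.
by [].
Qed.

(** The potential enters [dens] only through the integral [tail], so [dens] is continuous on ]-1, b[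
    and u is differentiable at each point there. *)
Lemma usol_derive x : -1 < x -> x < b -> cderiv usol x (vsol x).
Proof.
move=> x1 xb.
have cd : ccont dens x.
  have ct : ccont (fun s : R => lexp kap (1 * s + 0) * (a%:C + tail s)) x.
    apply: ccontM; first exact: cderiv_ccont (cderiv_lexp kap 1 0 x).
    by apply: ccontD; [exact: ccont_cst|rewrite tailE; exact: ctail_ccont].
  have near1 : \forall y \near x, lexp kap (1 * y + 0) * (a%:C + tail y) = dens y.
    apply: filterS (lt1_near x1 xb) => y y1.
    by rewrite /dens y1 !mul1r addr0.
  exact: ccont_near near1 ct.
have dW := ctail_derive idens cd.
have dE1 := cderiv_lexp kap 2^-1 (- (2^-1 * b)) x.
have dE2 := cderivMl sigma%:C (cderiv_lexp kap (-1) b x).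
have dE3 := cderiv_lexp kap (-1) 0 x.
have d1 := cderivM dE1 (cderivD (cderivD (cderiv_cst 1 x) (cderivN dE2)) (cderivM dE3 dW)).
apply: cderiv_ext d1 => //.
rewrite /vsol /usol /dens !lt1_lt// !mulr1 mul1r.
have e : lexp kap (-1 * x + 0) * lexp kap x = 1 by rewrite mulN1r addr0 lexpN.
have e2 : (2^-1 : R)%:C = (2^-1 : R[i]) by rewrite fmorphV rmorph_nat.
rewrite e2 rmorphN1.
set E := lexp kap (2^-1 * x + _); set S := lexp kap (-1 * x + b); set W := ctail _ _.
set E3 := lexp kap (-1 * x + 0) in e *.
have -> : E3 * - (lexp kap x * (a%:C + tail x)) = - (a%:C + tail x) by rewrite mulrN mulrA e mul1r.
by field.
Qed.

(** [tail] has derivative - q psi at almost every point. The terms kap (2 kap + a + tail) cancel,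
    which leaves kap^2 u + q u. *)
Lemma vsol_derive_ae : {ae mu, forall x : R, -1 < x -> x < b ->
  cderiv vsol x (((q x)%:C + kap ^+ 2) * usol x)}.
Proof.
apply: filterS (ctail_derive_ae ipot); first exact: (ae_filter_ringOfSetsType mu).
move=> x dT x1 xb.
have du := cderivMl kap (usol_derive x1 xb).
have dE1 := cderiv_lexp kap 2^-1 (- (2^-1 * b)) x.
rewrite -tailE in dT.
have d1 := cderivD du (cderivN (cderivM dE1 (cderivD (cderiv_cst (2 * kap + a%:C) x) dT))).
apply: cderiv_ext d1 => //.
rewrite /vsol usolE ?(ltW x1)// /pot.
have e2 : (2^-1 : R)%:C = (2^-1 : R[i]) by rewrite fmorphV rmorph_nat.
by rewrite e2; field.
Qed.

Lemma usol_ccont x : ccont usol x.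
Proof.
apply: ccontM; first exact: cderiv_ccont (cderiv_lexp _ _ _ _).
apply: ccontD; last first.
  by apply: ccontM; [exact: cderiv_ccont (cderiv_lexp _ _ _ _)|exact: ctail_ccont].
apply: ccontD; first exact: ccont_cst.
apply: ccontN; apply: ccontM; first exact: ccont_cst.
exact: cderiv_ccont (cderiv_lexp _ _ _ _).
Qed.

Lemma vsol_ccont x : ccont vsol x.
Proof.
apply: ccontD; first by apply: ccontM; [exact: ccont_cst|exact: usol_ccont].
apply: ccontN; apply: ccontM; first exact: cderiv_ccont (cderiv_lexp _ _ _ _).
by apply: ccontD; [exact: ccont_cst|rewrite tailE; exact: ctail_ccont].
Qed.

Lemma vsol_ac c d : abs_continuous c d vsol.
Proof.
have acW : abs_continuous c d (ctail dens) by apply/abs_continuous_real; exact: ctail_ac.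
have acT : abs_continuous c d tail.
  by rewrite tailE; apply/abs_continuous_real; exact: ctail_ac.
have acE m n := @abs_continuous_lexp R c d kap m n.
have acc := @abs_continuous_cst R c d.
apply: abs_continuousD.
  apply: abs_continuousM => //; apply: abs_continuousM => //.
  apply: abs_continuousD; last exact: abs_continuousM.
  apply: abs_continuousD => //; apply: abs_continuousN; exact: abs_continuousM.
apply: abs_continuousN; apply: abs_continuousM => //.
exact: abs_continuousD.
Qed.

Let ctail_ge (F : R -> R[i]) : (forall t, b <= t -> F t = 0) -> ctail F b = 0.
Proof.
move=> Fb; apply: cint_eq0 => t; have [bt|tb] := leP b t; first by rewrite Fb// mulr0.
by rewrite lt1_le ?mul0r// ltW.
Qed.

Lemma usol_b : usol b = (1 - sigma)%:C.
Proof.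
rewrite /usol subrr lexp0 mul1r mulN1r addNr lexp0 mulr1 ctail_ge.
  by rewrite mulr0 addr0 rmorphB.
by move=> t bt; rewrite /dens (lt1_le bt) mulr0 mul0r.
Qed.

Lemma vsol_b : vsol b = - (kap * (1 + sigma)%:C + a%:C).
Proof.
rewrite /vsol usol_b subrr lexp0 mul1r tailE ctail_ge; last first.
  by move=> t bt; rewrite /pot qb// mul0r.
by rewrite rmorphB rmorphD; ring.
Qed.

Lemma usol_solution : solution q b (- kap ^+ 2) usol.
Proof.
have cdE x : 0 < x < b -> cderive usol x = vsol x.
  by move=> /andP[x0 xb]; apply: cderiv_cderive; apply: usol_derive => //; lra.
split.
- move=> x /andP[x0 xb]; apply: cderiv_cderivable (usol_derive _ xb); lra.
- move=> c d c0 cd db e e0; have [dl d0 P] := vsol_ac c d e0; exists dl => // n s t st dj sd.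
  have := P n s t st dj sd; congr (_ < _); apply: eq_bigr => i _.
  have [h1 [h2 h3]] := st i.
  rewrite !cdE//; first by rewrite (lt_le_trans c0 h1) (le_lt_trans (le_trans h2 h3) db).
  by rewrite (lt_le_trans c0 (le_trans h1 h2)) (le_lt_trans h3 db).
- apply: filterS vsol_derive_ae; first exact: (ae_filter_ringOfSetsType mu).
  move=> x H /andP[x0 xb].
  have h := H (lt_trans (ltrN10 R) x0) xb.
  have h' : cderiv (cderive usol) x (((q x)%:C + kap ^+ 2) * usol x).
    have nr : \forall y \near x, vsol y = cderive usol y.
      near=> y; rewrite cdE//; apply/andP; split; near: y; [exact: lt_nbhsr|exact: lt_nbhsl].
    exact: cderiv_near nr h.
  split; first exact: cderiv_cderivable h'.
  by rewrite (cderiv_cderive h'); ring.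
Unshelve. all: by end_near.
Qed.

End OdeSolution.

Section OneSidedLimits.
Context {R : realType}.
Implicit Types f g : R -> R[i].

(** The bridge from componentwise continuity to the norm topology in which [rlim] and [llim] are
    taken. *)
Lemma ccont_cvg f x (F : set_system R) : Filter F -> F `=>` nbhs x -> ccont f x ->
  (f y : R[i]^o) @[y --> F] --> (f x : R[i]^o).
Proof.
move=> FF Fx [c1 c2]; apply/cvgrPdist_lt => /= e e0.
have eE : e = (complex.Re e)%:C.
  by rewrite -[LHS](RRe_real (ger0_real (ltW e0))).
have re0 : 0 < complex.Re e by move: e0; rewrite {1}eE ltcR.
have e2 : 0 < complex.Re e / 2 by rewrite divr_gt0.
move/cvgrPdist_lt : c1 => /(_ _ e2) n1; move/cvgrPdist_lt : c2 => /(_ _ e2) n2.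
apply: Fx; apply: filterS2 n1 n2 => y h1 h2.
rewrite eE -(RRe_real (normr_real _)) ltcR.
apply: (le_lt_trans (norm_nrm1 _)).
by rewrite [ltRHS]splitr /nrm1 ReD ReN ImD ImN ltrD.
Qed.

Lemma rlim_eq f g (x y : R) : x < y -> (forall t, x < t -> t < y -> g t = f t) ->
  ccont f x -> rlim g x = f x.
Proof.
move=> xy gf cf; apply: (@cvg_lim R[i]^o); first exact: norm_hausdorff.
have cv : (f y : R[i]^o) @[y --> x^'+] --> (f x : R[i]^o).
  by apply: ccont_cvg cf; exact: cvg_within.
apply: cvg_trans cv.
apply: near_eq_cvg; near=> t; apply/esym/gf; near: t.
  exact: nbhs_right_gt.
exact: nbhs_right_lt.
Unshelve. all: by end_near.
Qed.

Lemma llim_eq f g (x y : R) : y < x -> (forall t, y < t -> t < x -> g t = f t) ->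
  ccont f x -> llim g x = f x.
Proof.
move=> xy gf cf; apply: (@cvg_lim R[i]^o); first exact: norm_hausdorff.
have cv : (f y : R[i]^o) @[y --> x^'-] --> (f x : R[i]^o).
  by apply: ccont_cvg cf; exact: cvg_within.
apply: cvg_trans cv.
apply: near_eq_cvg; near=> t; apply/esym/gf; near: t.
  exact: nbhs_left_gt.
exact: nbhs_left_lt.
Unshelve. all: by end_near.
Qed.

End OneSidedLimits.

(** * Wronskians and uniqueness of Weyl solutions *)

Section Uniqueness.
Context {R : realType}.
Local Notation mu := (@lebesgue_measure R).
Variables (q : R -> R) (b : R) (z : R[i]).
Hypothesis b0 : 0 < b.
Implicit Types u : R -> R[i].

Definition wronskian u1 u2 (x : R) : R[i] :=
  u1 x * cderive u2 x - cderive u1 x * u2 x.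

Lemma wronskian_constant u1 u2 c d : solution q b z u1 -> solution q b z u2 ->
  0 < c -> c <= d -> d < b -> wronskian u1 u2 d = wronskian u1 u2 c.
Proof.
move=> [d1 a1 e1] [d2 a2 e2] c0 cd db.
have cdb x : c <= x <= d -> 0 < x < b.
  by move=> /andP[cx xd]; rewrite (lt_le_trans c0 cx) (le_lt_trans xd db).
have ac1 := a1 c d c0 cd db; have ac2 := a2 c d c0 cd db.
have au1 : abs_continuous c d u1.
  by apply: abs_continuous_primitive ac1 => x /cdb/d1/cderivableP.
have au2 : abs_continuous c d u2.
  by apply: abs_continuous_primitive ac2 => x /cdb/d2/cderivableP.
have aW : abs_continuous c d (wronskian u1 u2).
  apply: abs_continuousD; first exact: abs_continuousM.
  by apply: abs_continuousN; exact: abs_continuousM.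
have dW : {ae mu, forall x, c < x < d -> cderiv (wronskian u1 u2) x 0}.
  apply: filterS2 e1 e2 => [|x h1 h2 /andP[cx xd]].
    exact: (ae_filter_ringOfSetsType mu).
  have xb : 0 < x < b by apply: cdb; rewrite !ltW.
  have [/cderivableP k1 g1] := h1 xb; have [/cderivableP k2 g2] := h2 xb.
  have f1 : cderive (cderive u1) x = (q x)%:C * u1 x - z * u1 x by rewrite -g1; ring.
  have f2 : cderive (cderive u2) x = (q x)%:C * u2 x - z * u2 x by rewrite -g2; ring.
  have D := cderivD (cderivM (cderivableP (d1 x xb)) k2)
    (cderivN (cderivM k1 (cderivableP (d2 x xb)))).
  by apply: cderiv_ext D => //; rewrite f1 f2; ring.
have [aW1 aW2] := (abs_continuous_real _ _ _).1 aW.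
apply: complex_eqP.
  apply: ac_zero_derivative aW1 _ => //; apply: filterS dW.
    exact: (ae_filter_ringOfSetsType mu).
  by move=> x /[apply] -[].
apply: ac_zero_derivative aW2 _ => //; apply: filterS dW.
  exact: (ae_filter_ringOfSetsType mu).
by move=> x /[apply] -[].
Qed.

Lemma wronskian_eq u1 u2 x y : solution q b z u1 -> solution q b z u2 ->
  0 < x -> x < b -> 0 < y -> y < b -> wronskian u1 u2 x = wronskian u1 u2 y.
Proof.
move=> s1 s2 x0 xb y0 yb; have [xy|yx] := leP x y.
  by rewrite (wronskian_constant s1 s2 x0 xy yb).
by rewrite (wronskian_constant s1 s2 y0 (ltW yx) xb).
Qed.

Variable h : option R.

Definition bdry (u v : R[i]) : R[i] := if h is Some h0 then v + h0%:C * u else u.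

(** G0 satisfies the boundary condition at b and O0 violates it. G1 and O1 extend their derivatives
    continuously to the end points. *)
Variables G0 G1 O0 O1 : R -> R[i].
Hypothesis solG : solution q b z G0.
Hypothesis solO : solution q b z O0.
Hypothesis dG : forall x, 0 < x -> x < b -> cderive G0 x = G1 x.
Hypothesis dO : forall x, 0 < x -> x < b -> cderive O0 x = O1 x.
Hypothesis cG0 : forall x, ccont G0 x.
Hypothesis cG1 : forall x, ccont G1 x.
Hypothesis cO0 : forall x, ccont O0 x.
Hypothesis cO1 : forall x, ccont O1 x.
Hypothesis bG : bdry (G0 b) (G1 b) = 0.
Hypothesis bO : bdry (O0 b) (O1 b) != 0.
Hypothesis GO : G0 b * O1 b - G1 b * O0 b != 0.
Hypothesis G00 : G0 0 != 0.

Let b2 : 0 < b / 2. Proof. by rewrite divr_gt0. Qed.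
Let b2b : b / 2 < b. Proof. by rewrite ltr_pdivrMr// ltr_pMr// ltr1n. Qed.

Let w := wronskian G0 O0 (b / 2).

(** The Wronskian is constant on (0, b), and the continuous extensions carry its value to b, where
    [GO] applies. *)
Let w_neq0 : w != 0.
Proof.
have cW : ccont (fun x => G0 x * O1 x - G1 x * O0 x) b.
  by apply: ccontD; [exact: ccontM|apply: ccontN; exact: ccontM].
have WE t : 0 < t -> t < b -> w = G0 t * O1 t - G1 t * O0 t.
  by move=> t0 tb; rewrite /w (wronskian_eq solG solO b2 b2b t0 tb) /wronskian dG// dO.
by move: GO; rewrite -(llim_eq b0 WE cW) (llim_eq b0 (fun _ _ _ => erefl) (ccont_cst w b)).
Qed.

(** Cramer's rule: the coefficients are quotients of Wronskians, hence constants. The four one-sided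
    limits of u exist because those of G and O do. *)
Lemma solution_limits u : solution q b z u -> exists c1 c2 : R[i],
  [/\ rlim u 0 = c1 * G0 0 + c2 * O0 0,
      rlim (cderive u) 0 = c1 * G1 0 + c2 * O1 0,
      llim u b = c1 * G0 b + c2 * O0 b,
      llim (cderive u) b = c1 * G1 b + c2 * O1 b &
      forall x, 0 < x -> x < b -> u x = c1 * G0 x + c2 * O0 x].
Proof.
move=> su; pose c1 := wronskian u O0 (b / 2) / w; pose c2 := wronskian G0 u (b / 2) / w.
have uE x : 0 < x -> x < b -> u x = c1 * G0 x + c2 * O0 x.
  move=> x0 xb; rewrite /c1 /c2 (wronskian_eq su solO b2 b2b x0 xb).
  rewrite (wronskian_eq solG su b2 b2b x0 xb).
  have := w_neq0; rewrite {1}/w (wronskian_eq solG solO b2 b2b x0 xb).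
  rewrite /w (wronskian_eq solG solO b2 b2b x0 xb) /wronskian => w0.
  by field.
have vE x : 0 < x -> x < b -> cderive u x = c1 * G1 x + c2 * O1 x.
  move=> x0 xb; rewrite /c1 /c2 (wronskian_eq su solO b2 b2b x0 xb).
  rewrite (wronskian_eq solG su b2 b2b x0 xb).
  have := w_neq0; rewrite {1}/w (wronskian_eq solG solO b2 b2b x0 xb).
  rewrite /w (wronskian_eq solG solO b2 b2b x0 xb) /wronskian dG// dO// => w0.
  by field.
have lc f g x : ccont f x -> ccont g x -> ccont (fun y => c1 * f y + c2 * g y) x.
  by move=> cf cg; exact: (ccontD (ccontM (ccont_cst c1 x) cf) (ccontM (ccont_cst c2 x) cg)).
exists c1, c2; split => //.
- exact: rlim_eq b0 uE (lc _ _ _ _ _).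
- exact: rlim_eq b0 vE (lc _ _ _ _ _).
- exact: llim_eq b0 uE (lc _ _ _ _ _).
- exact: llim_eq b0 vE (lc _ _ _ _ _).
Qed.

Lemma weyl_solution_good : weyl_solution q b h z G0.
Proof.
have lG0 : llim G0 b = G0 b by exact: llim_eq b0 (fun _ _ _ => erefl) (cG0 b).
have lG1 : llim (cderive G0) b = G1 b by exact: llim_eq b0 dG (cG1 b).
split => //.
  by move: bG; rewrite /bdry /boundary_condition; case: h => [h0|]; rewrite lG0 ?lG1.
(* If G0 vanished throughout (0, b), its value at 0 would be 0 by continuity. *)
apply: contrapT => no; move/eqP: G00; apply.
rewrite -(rlim_eq b0 (fun _ _ _ => erefl) (cG0 0)).
apply: (rlim_eq b0 _ (ccont_cst 0 0)) => t t0 tb.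
by apply: contrapT => /eqP Gt; apply: no; exists t => //; rewrite t0.
Qed.

(** The boundary condition at b eliminates the O-component, and u being nonzero leaves c1 != 0,
    which cancels in the quotient. *)
Lemma weyl_solution_limits u : weyl_solution q b h z u ->
  rlim u 0 != 0 /\ rlim (cderive u) 0 / rlim u 0 = G1 0 / G0 0.
Proof.
move=> [su bu [x /andP[x0 xb] ux]].
have [c1 [c2 [e1 e2 e3 e4 e5]]] := solution_limits su.
have c20 : c2 = 0.
  have : c2 * bdry (O0 b) (O1 b) = 0.
    transitivity (c1 * bdry (G0 b) (G1 b) + c2 * bdry (O0 b) (O1 b)).
      by rewrite bG mulr0 add0r.
    move: bu; rewrite /boundary_condition /bdry; case: h => [h0|]; rewrite ?e4 e3 => <-; ring.
  by move/eqP; rewrite mulf_eq0 (negbTE bO) orbF => /eqP.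
have c10 : c1 != 0.
  by apply: contra_neq ux => c10; rewrite e5// c10 c20 !mul0r addr0.
by rewrite e1 e2 c20 !mul0r !addr0 mulf_neq0//; split => //; field; rewrite G00.
Qed.

(** [xget] returns some Weyl solution because G0 is one, and all of them give the same quotient. *)
Lemma m_fun_good : ~ m_pole q b h z /\ m_fun q b h z = G1 0 / G0 0.
Proof.
split.
  by move=> [u /weyl_solution_limits[u0 _]] /eqP; rewrite (negbTE u0).
have : weyl_solution q b h z (xget (fun=> 0) [set u | weyl_solution q b h z u]).
  by apply: (@xgetPex _ _ [set u | weyl_solution q b h z u]); exists G0; exact: weyl_solution_good.
by move/weyl_solution_limits => [].
Qed.

End Uniqueness.

(** * The geometric series and its derivative *)

Section ComplexSeries.
Context {R : realType}.
Implicit Types (u : nat -> R[i]) (w z l : R[i]).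

Lemma csum_eq u l (g : nat -> R) : g @ \oo --> 0 ->
  (forall n, `|l - \sum_(1 <= k < n.+1) u k| <= (g n)%:C) -> csum u = l.
Proof.
move=> g0 H; apply: (@cvg_lim R[i]^o); first exact: norm_hausdorff.
rewrite -cvg_shiftS; apply/cvgrPdist_lt => /= e e0.
have eE : e = (complex.Re e)%:C by rewrite -[LHS](RRe_real (ger0_real (ltW e0))).
have re0 : 0 < complex.Re e by move: e0; rewrite {1}eE ltcR.
move/cvgrPdist_lt : g0 => /(_ _ re0); apply: filterS => n.
rewrite sub0r normrN => h; apply: (le_lt_trans (H n)); rewrite eE ltcR.
exact: le_lt_trans (ler_norm _) h.
Qed.

(** With s = (1 + r) / 2 one has r <= s^2 and s < 1. Bernoulli's inequality for 1 / s bounds n s^n,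
    and the remaining factor s^n tends to 0. *)
Lemma cvg_natr_expr (r : R) : 0 <= r -> r < 1 -> n%:R * r ^+ n @[n --> \oo] --> 0.
Proof.
move=> r0 r1; pose s := (1 + r) / 2.
have s0 : 0 < s by rewrite /s; lra.
have s1 : s < 1 by rewrite /s; lra.
have d0 : 0 < s^-1 - 1 by rewrite subr_gt0 invf_gt1.
have rs : r <= s * s by rewrite /s; nra.
have bernoulli n : n%:R * (s^-1 - 1) <= s^-1 ^+ n.
  elim: n => [|n IH]; first by rewrite mul0r expr0.
  have s1n : 1 <= s^-1 ^+ n by rewrite exprn_ege1// ltW// invf_gt1.
  have : s^-1 - 1 <= (s^-1 - 1) * s^-1 ^+ n by rewrite ler_peMr// ltW.
  by rewrite -[n.+1%:R]natr1 exprS; lra.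
apply: (@squeeze_cvgr _ _ _ _ (fun=> 0) (fun n => (s^-1 - 1)^-1 * s ^+ n)).
- near=> n; rewrite mulr_ge0 ?exprn_ge0//=.
  apply: (@le_trans _ _ (n%:R * (s * s) ^+ n)).
    by rewrite ler_wpM2l// lerXn2r ?nnegrE// mulr_ge0// ltW.
  rewrite exprMn mulrA ler_wpM2r ?exprn_ge0 ?(ltW s0)//.
  rewrite -[leRHS]mul1r ler_pdivlMr// mulrAC.
  apply: (le_trans (ler_wpM2r _ (bernoulli n))); first by rewrite exprn_ge0// ltW.
  by rewrite exprVn mulVf// expf_neq0// gt_eqF.
- exact: cvg_cst.
- rewrite -[X in _ --> X](mulr0 (s^-1 - 1)^-1); apply: cvgMr.
  by apply: cvg_expr; rewrite ger0_norm// ltW.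
Unshelve. all: by end_near.
Qed.

Let norm_Re w : `|w| = (complex.Re `|w|)%:C.
Proof. by rewrite RRe_real ?normr_real. Qed.

Let Re_norm_ge0 w : 0 <= complex.Re `|w|.
Proof. by have := normr_ge0 w; rewrite {1}norm_Re lecR. Qed.

Lemma one_sub_neq0 w : complex.Re `|w| < 1 -> 1 - w != 0.
Proof. by apply: contraTN => /eqP/subr0_eq <-; rewrite normr1 ltxx. Qed.

Lemma csum_geometric z w : complex.Re `|w| < 1 ->
  csum (fun n => z * w ^+ n) = z * w / (1 - w).
Proof.
move=> w1; have w10 := one_sub_neq0 w1.
pose r := complex.Re `|w|; pose d := complex.Re `|z * w / (1 - w)|.
apply: (@csum_eq _ _ (fun n => d * r ^+ n)).
  rewrite -[X in _ --> X](mulr0 d); apply: cvgMr.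
  by apply: cvg_expr; rewrite ger0_norm ?Re_norm_ge0.
move=> n; have -> : \sum_(1 <= k < n.+1) z * w ^+ k = z * w / (1 - w) * (1 - w ^+ n).
  elim: n => [|n IH]; first by rewrite big_geq// expr0 subrr mulr0.
  by rewrite big_nat_recr//= IH exprS; field.
by rewrite mulrBr mulr1 opprB addrC subrK normrM normrX norm_Re (norm_Re w) rmorphM rmorphXn.
Qed.

Lemma csum_derivative_geometric z w : complex.Re `|w| < 1 ->
  csum (fun n => z * (n%:R * w ^+ n.-1)) = z / (1 - w) ^+ 2.
Proof.
move=> w1; have w10 := one_sub_neq0 w1.
pose r := complex.Re `|w|; pose d := complex.Re `|z / (1 - w) ^+ 2|.
apply: (@csum_eq _ _ (fun n => d * (r ^+ n + (n%:R * r ^+ n + n%:R * r ^+ n)))).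
  have c1 : r ^+ n @[n --> \oo] --> 0 by apply: cvg_expr; rewrite ger0_norm ?Re_norm_ge0.
  have c2 := cvg_natr_expr (Re_norm_ge0 w) w1.
  rewrite -[X in _ --> X](mulr0 d); apply: cvgMr.
  by rewrite -[X in _ --> X](addr0 0); apply: cvgD => //; rewrite -[X in _ --> X](addr0 0); exact: cvgD.
move=> n; have -> : \sum_(1 <= k < n.+1) z * (k%:R * w ^+ k.-1) =
    z / (1 - w) ^+ 2 * (1 - (w ^+ n + (n%:R * w ^+ n - n%:R * w ^+ n * w))).
  elim: n => [|n IH]; first by rewrite big_geq// expr0 !mul0r subrr addr0 subrr mulr0.
  by rewrite big_nat_recr//= IH (exprS w n) -[n.+1%:R]natr1; field.
rewrite mulrBr mulr1 opprB addrC subrK normrM norm_Re -/d rmorphM.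
apply: ler_wpM2l; first by rewrite lecR Re_norm_ge0.
have nw : `|n%:R * w ^+ n| = (n%:R * r ^+ n)%:C.
  by rewrite normrM normrX normr_nat norm_Re rmorphM rmorphXn rmorph_nat.
rewrite !rmorphD; apply: (le_trans (ler_normD _ _)); apply: lerD.
  by rewrite normrX norm_Re rmorphXn.
apply: (le_trans (ler_normB _ _)); rewrite (normrM (_ * _)) nw lerD2l ler_piMr//.
  by rewrite lecR mulr_ge0 ?exprn_ge0 ?Re_norm_ge0 ?ler0n.
by rewrite norm_Re lecR ltW.
Qed.

End ComplexSeries.

Lemma solution_eq (R : realType) (q1 q2 : R -> R) (b : R) z u :
  (forall x, 0 < x < b -> q1 x = q2 x) -> solution q1 b z u -> solution q2 b z u.
Proof.
move=> qE [d1 d2 d3]; split => //; apply: filterS d3.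
  exact: (ae_filter_ringOfSetsType lebesgue_measure).
by move=> x H xb; have [] := H xb; rewrite (qE _ xb).
Qed.

(** * Expansion of the m-function for both types of boundary condition *)

Section MFunctionExpansion.
Context {R : realType}.
Local Notation mu := (@lebesgue_measure R).
Local Notation TR := (measurableTypeR R).
Variables (q q0 : R -> R) (b : R) (h : option R).
Hypothesis b0 : 0 < b.
Hypothesis iq0 : mu.-integrable setT (EFin \o (q0 : TR -> R)).
Hypothesis q0E : forall x, 0 < x < b -> q0 x = q x.
Hypothesis q00 : forall x, x <= 0 -> q0 x = 0.
Hypothesis q0b : forall x, b <= x -> q0 x = 0.

(* The solution with parameters [sigma, a] equals [1 - sigma] at [b] and has
   derivative [- kap (1 + sigma) - a] there. *)
Let sigma : R := if h is Some _ then - 1 else 1.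
Let a : R := if h is Some h0 then 2 * h0 else 0.

Lemma m_fun_expansion : exists K F c cB, [/\ 0 < K, is_laplace K F c &
  forall kap, K <= complex.Re kap ->
    [/\ ~ m_pole q b h (- kap ^+ 2), complex.Re `|sigma%:C * lexp kap b| < 1 &
      m_fun q b h (- kap ^+ 2) =
      - kap - 2 * kap * (sigma%:C * lexp kap b) / (1 - sigma%:C * lexp kap b)
      - cB%:C * lexp kap b / (1 - sigma%:C * lexp kap b) ^+ 2 - F kap]].
Proof.
have [C [k [kC kE]]] := volterra_solution iq0 q0b sigma a.
(* The companion solution with parameters - sigma and 0: at b its boundary form is nonzero, and its
   Wronskian with the first solution is 4 kap up to sign. *)
have [C' [k' [kC' kE']]] := volterra_solution iq0 q0b (- sigma) 0.
have s1 : `|sigma| <= 1 by rewrite /sigma; case: h => [_|]; rewrite ?normrN normr1.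
have [K [F [c [cB [rK FL E]]]]] := m_expansion iq0 b0 q00 q0b kC kE s1.
exists K, F, c, cB; split => //; first exact: lt_le_trans (rate_gt0 _) rK.
move=> kap Kk; have [p0 n1 <-] := E kap Kk.
have rk : rate q0 <= complex.Re kap by exact: le_trans Kk.
have k0 : kap != 0 by exact: (Re_rate_neq0 rk).
have ke x := kE kap x rk; have ke' x := kE' kap x rk.
have solG := solution_eq q0E (usol_solution iq0 q0b kC rk ke).
have solO := solution_eq q0E (usol_solution iq0 q0b kC' rk ke').
have dG x (x0 : 0 < x) (xb : x < b) := cderiv_cderive
  (usol_derive iq0 q0b sigma a kC rk (lt_trans (ltrN10 R) x0) xb).
have dO x (x0 : 0 < x) (xb : x < b) := cderiv_cderive
  (usol_derive iq0 q0b (- sigma) 0 kC' rk (lt_trans (ltrN10 R) x0) xb).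
have bG := usol_b q0 b sigma a k kap.
have bO := usol_b q0 b (- sigma) 0 k' kap.
have vG := vsol_b q0b sigma a k kap.
have vO := vsol_b q0b (- sigma) 0 k' kap.
have L0 : lexp kap (2^-1 * 0 + - (2^-1 * b)) != 0 by exact: lexp_neq0.
have uG0 := usolE iq0 q0b kC rk ke (ltW (ltrN10 R)).
have two_kap : 2 * kap != 0 by rewrite mulf_neq0// pnatr_eq0.
have castE := (rmorphD (real_complex R), rmorphN (real_complex R), rmorphM (real_complex R),
  rmorph1 (real_complex R), rmorph0 (real_complex R), rmorph_nat (real_complex R)).
have H1 : bdry h (usol q0 b sigma a k kap b) (vsol q0 b sigma a k kap b) = 0.
  rewrite bG vG /bdry /sigma /a; case: h => [h0|]; rewrite !castE; ring.
have H2 : bdry h (usol q0 b (- sigma) 0 k' kap b) (vsol q0 b (- sigma) 0 k' kap b) != 0.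
  rewrite bO vO /bdry /sigma; case: h => [h0|]; rewrite !castE.
    by rewrite (_ : _ + _ = - (2 * kap)) ?oppr_eq0//; ring.
  by rewrite (_ : _ - _ = 2) ?pnatr_eq0//; ring.
have H3 : usol q0 b sigma a k kap b * vsol q0 b (- sigma) 0 k' kap b -
    vsol q0 b sigma a k kap b * usol q0 b (- sigma) 0 k' kap b != 0.
  rewrite bG bO vG vO /sigma /a; case: h => [h0|]; rewrite !castE.
    by rewrite (_ : _ - _ = - (2 * (2 * kap))) ?oppr_eq0 ?mulf_neq0 ?pnatr_eq0//; ring.
  by rewrite (_ : _ - _ = 2 * (2 * kap)) ?mulf_neq0 ?pnatr_eq0//; ring.
have H4 : usol q0 b sigma a k kap 0 != 0 by rewrite uG0 mulf_neq0.
have [nop ->] := m_fun_good b0 solG solO dG dO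
  (usol_ccont iq0 q0b sigma a kC rk) (vsol_ccont iq0 q0b sigma a kC rk)
  (usol_ccont iq0 q0b (- sigma) 0 kC' rk) (vsol_ccont iq0 q0b (- sigma) 0 kC' rk) H1 H2 H3 H4.
split => //; rewrite /vsol uG0.
by field; rewrite p0.
Qed.


End MFunctionExpansion.

(** On ]0, a[ the weight is at least e^{- 2 K a}. *)
Lemma weighted_integral_le (R : realType) (K c : R) (f : measurableTypeR R -> R) :
  0 < K -> measurable_fun setT f ->
  (\int[lebesgue_measure]_x (`|f x| * weight K x)%:E <= c%:E)%E -> forall a : R, 0 < a ->
  (\int[lebesgue_measure]_(x in `]0%R, a[%classic) `|f x|%:E <=
    (c * expR (2 * K * a))%:E)%E.
Proof.
move=> K0 mf fc a a0.
have mn : measurable_fun setT (fun x => (`|f x| * weight K x)%:E).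
  by apply/measurable_EFinP; apply: measurable_funM => //; [exact: measurableT_comp|exact: measurable_weight].
apply: (@le_trans _ _ (\int[lebesgue_measure]_(x in `]0%R, a[%classic)
    ((expR (2 * K * a))%:E * (`|f x| * weight K x)%:E))%E).
  apply: ge0_le_integral => //.
  - by apply/measurable_EFinP; apply: measurable_funTS; exact: measurableT_comp.
  - by apply: emeasurable_funM => //; apply: measurable_funTS.
  - move=> x /=; rewrite in_itv /= => /andP[x0 xa].
    rewrite -EFinM lee_fin mulrCA ler_peMr// /weight -expRD -expR0 ler_expR.
    by rewrite -mulrBr mulr_ge0 ?subr_ge0 ?(ltW xa)// mulr_ge0// ltW.
rewrite ge0_integralZl//; last 2 first.
- exact: measurable_funTS.
- by move=> x _; rewrite lee_fin mulr_ge0 ?expR_ge0.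
rewrite (mulrC c) EFinM lee_wpmul2l//.
apply: le_trans fc; apply: ge0_subset_integral => //.
by move=> x _; rewrite lee_fin mulr_ge0 ?expR_ge0.
Qed.

Theorem theorem1p6 (R : realType) (b : R) (hb : 0 < b) (q : R -> R)
    (hq : lebesgue_measure.-integrable `]0, b[%classic (EFin \o q))
    (h : option R) :
  exists (An Bn : nat -> R) (A : R -> R) (C K0 : R),
    0 < C /\ 0 < K0 /\
    (forall n, (1 <= n)%N -> `|An n| <= C) /\
    (forall n, (1 <= n)%N -> `|Bn n| <= C * n%:R) /\
    measurable_fun `]0 : R, +oo[%classic A /\
    (forall a : R, 0 < a ->
      (\int[lebesgue_measure]_(x in `]0%R, a[%classic) `|A x|%:E
        <= (C * expR (K0 * `|a|))%:E)%E) /\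
    (forall kappa : R[i], K0 / 2 < complex.Re kappa ->
      ~ m_pole q b h (- kappa ^+ 2) /\
      m_fun q b h (- kappa ^+ 2) =
        - kappa
        - csum (fun n => (An n)%:C * kappa
                           * cexp (- (2 * kappa * b%:C * n%:R)))
        - csum (fun n => (Bn n)%:C * cexp (- (2 * kappa * b%:C * n%:R)))
        - cintegral `]0 : R, +oo[%classic
            (fun x => (A x)%:C * cexp (- (2 * x%:C * kappa)))).
Proof.
(* Extension by zero makes q integrable on the whole line; solutions on (0, b) do not notice the
   change. *)
pose q0 : R -> R := q \_ `]0, b[%classic.
have iq0 : lebesgue_measure.-integrable setT (EFin \o (q0 : measurableTypeR R -> R)).
  by move: hq; rewrite integrable_mkcond//= restrict_EFin.
have q0E x : 0 < x < b -> q0 x = q x.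
  by move=> xb; rewrite /q0 patchE mem_set//= in_itv.
have q00 x : x <= 0 -> q0 x = 0.
  by move=> x0; rewrite /q0 patchE memNset//= in_itv /= ltNge x0.
have q0b x : b <= x -> q0 x = 0.
  by move=> bx; rewrite /q0 patchE memNset//= in_itv /= (ltNge x) bx andbF.
pose sigma : R := if h is Some _ then - 1 else 1.
have s1 n : `|sigma ^+ n| = 1.
  by rewrite normrX /sigma; case: (h) => [_|]; rewrite ?normrN normr1 expr1n.
have := m_fun_expansion h hb iq0 q0E q00 q0b; rewrite -/sigma.
clearbody sigma => -[K [F [c [cB [K0 [f [mf f0 fc FE]] E]]]]].
(* The summands bound A_n, B_n and the integral of |A|, in this order. *)
pose C : R := 2 + `|cB| + `|c|.
(* With w = sigma l, w / (1 - w) is the sum of sigma^n l^n and l / (1 - w)^2 the sum of n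
   sigma^(n-1) l^n. Taking 2 K for K0 matches both the growth e^{2 K a} and the half-plane Re kappa
   > K. *)
exists (fun n => 2 * sigma ^+ n), (fun n => cB * (n%:R * sigma ^+ n.-1)), f, C, (2 * K).
have nB := normr_ge0 cB; have nc := normr_ge0 c.
split; first by rewrite /C; lra.
split; first by rewrite mulr_gt0.
split; first by move=> n _; rewrite normrM s1 mulr1 ger0_norm// /C; lra.
split.
  move=> n _; rewrite !normrM s1 mulr1 normr_nat ler_wpM2r// /C; lra.
split; first exact: measurable_funTS.
split.
  move=> a a0; apply: (le_trans (weighted_integral_le K0 mf fc a0)).
  rewrite lee_fin (ger0_norm (ltW a0)) ler_wpM2r ?expR_ge0//.
  by apply: (le_trans (ler_norm c)); rewrite /C; lra.
move=> kap; rewrite (mulrC 2) mulfK// => Kk.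
have [nop n1 ->] := E kap (ltW Kk); split => //.
have expE (n : nat) : cexp (- (2 * kap * b%:C * n%:R)) = lexp kap b ^+ n.
  by rewrite -lexpM /lexp; congr cexp; rewrite rmorphM rmorph_nat; ring.
have -> : csum (fun n => (2 * sigma ^+ n)%:C * kap * cexp (- (2 * kap * b%:C * n%:R))) =
    2 * kap * (sigma%:C * lexp kap b) / (1 - sigma%:C * lexp kap b).
  rewrite -(csum_geometric (2 * kap) n1); congr csum; apply/funext => n.
  rewrite expE (exprMn _ sigma%:C) rmorphM rmorphXn rmorph_nat /=; ring.
have -> : csum (fun n => (cB * (n%:R * sigma ^+ n.-1))%:C * cexp (- (2 * kap * b%:C * n%:R))) =
    cB%:C * lexp kap b / (1 - sigma%:C * lexp kap b) ^+ 2.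
  rewrite -(csum_derivative_geometric _ n1); congr csum; apply/funext => -[|n].
    (* The index 0 lies outside [csum], but the summands are compared as functions; both vanish
       there. *)
    by rewrite !mul0r !mulr0 mul0r.
  by rewrite expE (exprMn _ sigma%:C) !rmorphM rmorphXn rmorph_nat (exprS (lexp kap b)) /=; ring.
congr (_ - _); rewrite FE ?(ltW Kk)// /laplace /cint /cintegral.
(* The density vanishes for x <= 0, so the transform over the line is the integral over ]0, oo[. *)
have set0E (g : R -> R) : (forall x, x <= 0 -> g x = 0) ->
    \int[lebesgue_measure]_x g x = \int[lebesgue_measure]_(x in `]0%R, +oo[%classic) g x.
  move=> g0; rewrite [RHS]Rintegral_mkcond; apply: eq_Rintegral => x _.
  rewrite patchE; case: ifPn => //; rewrite notin_setE /= in_itv /= andbT => /negP.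
  by rewrite -leNgt => /g0.
by congr (_ +i* _); apply: set0E => x x0; rewrite f0// mul0r.
Qed.
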